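(* Let $\phi,\psi\in C^\infty([0,\infty))$ be supported in $[0,1)$, and let $u$ be the unique moderate-growth solution of the heat equation $$u_t-u_{xx}=0$$ on $Q=[0,\infty)_t\times[0,\infty)_x$ with $$u(0,x)=\phi(x),\qquad u(t,0)=\psi(t).$$ Then $u$ is smooth on the space $Q_h$ obtained by parabolically blowing up $Q$ at the origin. Moreover, $u$ is $C^\infty$ on the closed quarter-space $Q$ only when the infinitely many matching conditions $$\psi^{(k)}(0)=\phi^{(2k)}(0),\qquad k=0,1,2,\dots$$ are satisfied.
   Context: Moderate growth: for every $T>0$ there are constants $A,a$ with $|u(t,x)|\le A e^{a x^2}$ on $(0,T]\times(0,\infty)$; the boundary values $\phi,\psi$ are attained away from the origin $(t,x)=(0,0)$. Smoothness on $Q_h=[Q;(0,0);dt]$ (parabolic blowup of the origin): a function $u$ on $Q\setminus\{(0,0)\}$ is smooth on $Q_h$ if (i) it is $C^\infty$ in $(t,x)$ on $Q\setminus\{(0,0)\}$, including at the boundary points; (ii) the function $(\tau,s)\mapsto u(\tau^2/2,\tau s)$, i.e. $u$ written in the projective coordinates $\tau=\sqrt{2t}$, $s=x/\sqrt{2t}$, extends from $\tau>0$ to a $C^\infty$ function on $[0,\infty)_\tau\times[0,\infty)_s$; and (iii) the function $(T,y)\mapsto u(Ty^2,y)$, i.e. $u$ written in the projective coordinates $T=t/x^2$, $y=x$, extends from $y>0$ to a $C^\infty$ function on $[0,\infty)_T\times[0,\infty)_y$. *)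

(* Defs.v *)
From Stdlib Require Import Reals.
From Coquelicot Require Import Coquelicot.

Open Scope R_scope.

(** Derivatives relative to a set [D]: [y] tends to [x] inside [D] only, so
    that at an endpoint of an interval they are one-sided derivatives.  They
    only depend on the values of [f] on [D]. *)

Definition is_derive_on (D : R -> Prop) (f : R -> R) (x l : R) : Prop :=
  filterdiff f (within D (locally x)) (fun h => scal h l).

Definition ex_derive_on (D : R -> Prop) (f : R -> R) (x : R) : Prop :=
  exists l : R, is_derive_on D f x l.

Definition Derive_on (D : R -> Prop) (f : R -> R) (x : R) : R :=
  iota (is_derive_on D f x).

Fixpoint Derive_n_on (D : R -> Prop) (f : R -> R) (n : nat) : R -> R :=
  match n with
  | O => f
  | S m => Derive_on D (Derive_n_on D f m)
  end.

Definition smooth_on (D : R -> Prop) (f : R -> R) : Prop :=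
  forall (n : nat) (x : R), D x -> ex_derive_on D (Derive_n_on D f n) x.

Definition half_line (x : R) : Prop := 0 <= x.

(** The (closed) support of a function on [[0,oo)]. *)
Definition support (f : R -> R) (x : R) : Prop :=
  half_line x /\ ~ locally x (fun y => half_line y -> f y = 0).

(** Functions of two variables on a set [D] of the plane. *)

Definition ex_partial1_on (D : R -> R -> Prop) (f : R -> R -> R) (a b : R) :=
  ex_derive_on (fun a' => D a' b) (fun a' => f a' b) a.

Definition ex_partial2_on (D : R -> R -> Prop) (f : R -> R -> R) (a b : R) :=
  ex_derive_on (D a) (f a) b.

Definition partial1_on (D : R -> R -> Prop) (f : R -> R -> R) (a b : R) : R :=
  Derive_on (fun a' => D a' b) (fun a' => f a' b) a.

Definition partial2_on (D : R -> R -> Prop) (f : R -> R -> R) (a b : R) : R :=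
  Derive_on (D a) (f a) b.

Definition continuous2_on (D : R -> R -> Prop) (f : R -> R -> R) : Prop :=
  continuous_on (fun p : R * R => D (fst p) (snd p))
                (fun p : R * R => f (fst p) (snd p)).

(** All mixed partial derivatives of order at most [k], in any order of
    differentiation, exist and are jointly continuous on [D], points of [D] on
    its boundary included. *)
Fixpoint Ck2_on (D : R -> R -> Prop) (k : nat) (f : R -> R -> R) : Prop :=
  continuous2_on D f /\
  match k with
  | O => True
  | S m =>
      (forall a b : R, D a b -> ex_partial1_on D f a b /\ ex_partial2_on D f a b)
      /\ Ck2_on D m (partial1_on D f) /\ Ck2_on D m (partial2_on D f)
  end.

Definition smooth2_on (D : R -> R -> Prop) (f : R -> R -> R) : Prop :=
  forall k : nat, Ck2_on D k f.

Definition quarter (a b : R) : Prop := 0 <= a /\ 0 <= b.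

Definition quarter_punctured (a b : R) : Prop :=
  quarter a b /\ ~ (a = 0 /\ b = 0).

Definition eq2_on (D : R -> R -> Prop) (f g : R -> R -> R) : Prop :=
  forall a b : R, D a b -> f a b = g a b.

(** A function on the quarter-space minus the origin is a [u : R -> R -> R] of
    which only the values [u t x] with [quarter_punctured t x] are relevant. *)

Definition moderate_growth (u : R -> R -> R) : Prop :=
  forall T : R, 0 < T ->
  exists A a : R, forall t x : R, 0 < t <= T -> 0 < x ->
    Rabs (u t x) <= A * exp (a * x ^ 2).

Definition heat_equation (u : R -> R -> R) : Prop :=
  forall t x : R, 0 < t -> 0 < x ->
    ex_derive (fun t' => u t' x) t /\
    ex_derive (u t) x /\
    ex_derive (Derive (u t)) x /\
    Derive (fun t' => u t' x) t - Derive (Derive (u t)) x = 0.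

(** [phi] and [psi] may disagree at the origin, so the boundary values are
    attained, continuously, away from it only. *)
Definition boundary_values (phi psi : R -> R) (u : R -> R -> R) : Prop :=
  continuous2_on quarter_punctured u /\
  (forall x : R, 0 < x -> u 0 x = phi x) /\
  (forall t : R, 0 < t -> u t 0 = psi t).

Definition moderate_solution (phi psi : R -> R) (u : R -> R -> R) : Prop :=
  heat_equation u /\ boundary_values phi psi u /\ moderate_growth u.

(** Smoothness on the parabolic blowup [[Q;(0,0);dt]]; [v] and [w] are the
    expressions of [u] in the projective coordinates
    [tau = sqrt (2 t), s = x / sqrt (2 t)] and [T = t / x^2, y = x]. *)
Definition smooth_Qh (u : R -> R -> R) : Prop :=
  smooth2_on quarter_punctured u /\
  (exists v : R -> R -> R, smooth2_on quarter v /\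
     forall tau s : R, 0 < tau -> 0 <= s -> v tau s = u (tau ^ 2 / 2) (tau * s)) /\
  (exists w : R -> R -> R, smooth2_on quarter w /\
     forall T y : R, 0 <= T -> 0 < y -> w T y = u (T * y ^ 2) y).

(** Smoothness on the closed quarter-space, after the right choice of the
    value at the origin. *)
Definition smooth_Q (u : R -> R -> R) : Prop :=
  exists v : R -> R -> R, smooth2_on quarter v /\ eq2_on quarter_punctured v u.

(* Main.v *)
Require Import Defs.
From Stdlib Require Import Reals Lra Lia Psatz Classical ClassicalEpsilon FunctionalExtensionality.
From Coquelicot Require Import Coquelicot.
From mathcomp Require Import ssreflect.
Open Scope general_if_scope.
Open Scope R_scope.

(** The solution is written down explicitly, as a sum of three pieces [line_solution],
    [corner_solution] and [dirichlet], each an integral over the positive half-line with a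
    Gaussian weight.

    The first piece is the evolution on the whole line of a smooth extension of [phi].  It is
    smooth up to [t = 0], where differentiating in time amounts to differentiating the initial
    datum twice.

    The second piece carries all the singularity at the corner.  It is the evolution of an
    initial datum that vanishes for [x > 0] and is [D (- x)] for [x < 0], with [D] smooth.  With
    [tau = sqrt (2 * t)] and [s = x / tau] it is a multiple of the integral of
    [D (tau * r) * gauss (r + s)] over [r > 0], which is visibly smooth in [tau] and [s]
    ([inner_layer]).  With [T = t / x ^ 2] and [y = x] it is the integral over [q > 0] of
    [D (y * q)] against the heat kernel at time [T] and distance [1 + q]; this distance stays
    away from [0], so that the integral is smooth and vanishes to infinite order at [T = 0]
    ([outer_layer]).

    On the side [x = 0], for even [D], the [k]-th time derivatives of these two pieces tend to the
    derivative of order [2 k] of [phi] at [0] and to half that of [D], as [t] tends to [0].  Borel's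
    lemma gives a [D] for which the sum is the [k]-th derivative of [psi] at [0], for every [k].
    What is missing at [x = 0] is then a function of [t] that extends smoothly by [0] to [t <= 0],
    and the third piece, the double-layer heat potential of that function, is smooth up to the
    boundary ([Ck_potentials]).  Composing with polynomial charts gives smoothness on the blowup.

    Uniqueness is a maximum principle with two barriers ([comparison]).  One grows like
    [exp (b * x ^ 2)] and absorbs the moderate growth during a short time, whose length depends
    on the growth only.  The other is a multiple of a heat kernel started at time [- e ^ 2]: it
    dominates the solution, which is bounded, in the parabolic box of size [e] at the origin, and
    tends to [0] elsewhere as [e] tends to [0].

    Finally, at a point [(0, x)] with [x > 0] the [k]-th time derivative of [u] is the derivative of
    order [2 k] of [phi] at [x], since the second and third pieces vanish to infinite order there;
    at [(t, 0)] it is the [k]-th derivative of [psi] at [t].  If [u] is smooth on the closed quarter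
    plane this derivative is continuous at the origin, whence the matching conditions. *)

(** * Derivatives and partial derivatives relative to a set *)

Lemma filterlim_R_eps {T : Type} (F : (T -> Prop) -> Prop) (f : T -> R) (l : R) :
  filterlim f F (locally l) -> forall eps, 0 < eps -> F (fun x => Rabs (f x - l) < eps).
Proof. move=> H eps He. exact: (H _ (locally_ball l (mkposreal eps He))). Qed.

Lemma filterlim_R {T : Type} (F : (T -> Prop) -> Prop) {FF : Filter F} (f : T -> R) (l : R) :
  (forall eps, 0 < eps -> F (fun x => Rabs (f x - l) < eps)) -> filterlim f F (locally l).
Proof. move=> H. apply/filterlim_locally => eps. exact: (H eps (cond_pos eps)). Qed.

Lemma filterlim_within {T U : UniformSpace} (D : T -> Prop) (f : T -> U) (x : T) (l : U) :
  filterlim f (locally x) (locally l) -> filterlim f (within D (locally x)) (locally l).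
Proof. move=> H P HP. apply: (filter_le_within D). exact: H. Qed.

Lemma ball_R (x d y : R) : ball x d y -> x - d < y < x + d.
Proof. move=> H. have := Rabs_def2 _ _ H. rewrite /minus /plus /opp /=. lra. Qed.

(** Carathéodory's form of differentiability turns the rules of
    differentiation into rules for limits, whatever the set [D] is. *)
Lemma is_derive_on_caratheodory (D : R -> Prop) (f : R -> R) (x l : R) : D x ->
  is_derive_on D f x l <->
  exists q : R -> R, (forall y, D y -> f y = f x + q y * (y - x)) /\
    q x = l /\ filterlim q (within D (locally x)) (locally l).
Proof.
  move=> Dx; split.
  - move=> [_ H].
    have Hx : is_filter_lim (within D (locally x)) x.
    { move=> P HP. apply: filter_imp HP => y Py _. exact: Py. }
    have {Hx} H := H x Hx.
    exists (fun y => if Req_dec_T y x then l else (f y - f x) / (y - x)).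
    split; [|split].
    + move=> y Dy. case: (Req_dec_T y x) => [->|n]; first by ring.
      field. lra.
    + case: (Req_dec_T x x) => //.
    + apply: filterlim_R => eps He.
      have He2 : 0 < eps / 2 by lra.
      have := H (mkposreal _ He2).
      rewrite /within; apply: filter_imp => y Hy Dy.
      case: (Req_dec_T y x) => [_|n]; first by rewrite Rminus_diag Rabs_R0.
      move: (Hy Dy). rewrite /norm /= /abs /= /minus /plus /opp /scal /= /mult /= => H1.
      have n0 : y - x <> 0 by lra.
      have -> : (f y - f x) / (y - x) - l = (f y + - f x + - ((y + - x) * l)) / (y - x)
        by field.
      rewrite Rabs_div //.
      have Hp : 0 < Rabs (y - x) by apply: Rabs_pos_lt.
      apply: (Rmult_lt_reg_r (Rabs (y - x))) => //.
      rewrite /Rdiv Rmult_assoc Rinv_l; last by lra.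
      rewrite Rmult_1_r.
      apply: (Rle_lt_trans _ _ _ H1). rewrite -/(y - x). nra.
  - move=> [q [Hq [qx Hl]]]. split; first by exact: (is_linear_scal_l l).
    move=> x' Hx'.
    have -> : x' = x.
    { apply: NNPP => n.
      have Hd : 0 < Rabs (x - x') by apply: Rabs_pos_lt; lra.
      have := Hx' (fun y => y <> x).
      move=> H. have {}H : within D (locally x) (fun y => y <> x).
      { apply: H. exists (mkposreal _ Hd) => y Hy Hyx. rewrite Hyx in Hy. exact: (Rlt_irrefl _ Hy). }
      exact: (locally_singleton _ _ H Dx eq_refl). }
    move=> eps.
    have Hlim := filterlim_R_eps _ _ _ Hl eps (cond_pos eps).
    rewrite /is_domin /within. rewrite /within in Hlim. apply: (filter_imp _ _ _ Hlim) => y Hy Dy. move: (Hy Dy) => {}Hy.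
    rewrite /norm /= /abs /= /minus /plus /opp /scal /= /mult /= (Hq y Dy).
    have -> : f x + q y * (y - x) + - f x + - ((y + - x) * l) = (q y - l) * (y - x) by ring.
    rewrite Rabs_mult. apply: Rmult_le_compat_r; first by exact: Rabs_pos. lra.
Qed.

(** The condition under which derivatives relative to [D] are unique at [x]. *)
Definition non_isolated (D : R -> Prop) (x : R) : Prop :=
  forall d, 0 < d -> exists y, D y /\ y <> x /\ Rabs (y - x) < d.

Lemma is_derive_on_unique (D : R -> Prop) (f : R -> R) (x l1 l2 : R) :
  D x -> non_isolated D x -> is_derive_on D f x l1 -> is_derive_on D f x l2 -> l1 = l2.
Proof.
  move=> Dx Ax /(is_derive_on_caratheodory _ _ _ _ Dx) [q1 [H1 [_ L1]]].
  move=> /(is_derive_on_caratheodory _ _ _ _ Dx) [q2 [H2 [_ L2]]].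
  apply: NNPP => n.
  have He : 0 < Rabs (l1 - l2) / 2.
  { have : 0 < Rabs (l1 - l2) by apply: Rabs_pos_lt; lra. lra. }
  have [d1 K1] := filterlim_R_eps _ _ _ L1 _ He.
  have [d2 K2] := filterlim_R_eps _ _ _ L2 _ He.
  have [y [Dy [yx Hy]]] := Ax (Rmin d1 d2) (Rmin_pos _ _ (cond_pos d1) (cond_pos d2)).
  have B1 : ball x d1 y by apply: (Rlt_le_trans _ _ _ Hy); exact: Rmin_l.
  have B2 : ball x d2 y by apply: (Rlt_le_trans _ _ _ Hy); exact: Rmin_r.
  move: (K1 y B1 Dy) (K2 y B2 Dy) (H1 y Dy) (H2 y Dy) => E1 E2 E3 E4.
  have E : q1 y = q2 y.
  { apply: (Rmult_eq_reg_r (y - x)); last by lra. lra. }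
  rewrite E in E1.
  have : Rabs (l1 - l2) <= Rabs (q2 y - l1) + Rabs (q2 y - l2).
  { have -> : l1 - l2 = - (q2 y - l1) + (q2 y - l2) by ring.
    apply: (Rle_trans _ _ _ (Rabs_triang _ _)). rewrite Rabs_Ropp. lra. }
  lra.
Qed.

Lemma Derive_on_eq (D : R -> Prop) (f : R -> R) (x l : R) :
  D x -> non_isolated D x -> is_derive_on D f x l -> Derive_on D f x = l.
Proof.
  move=> Dx Ax H. apply: iota_unique => // y Hy.
  exact: (is_derive_on_unique D f x).
Qed.

Lemma Derive_on_correct (D : R -> Prop) (f : R -> R) (x : R) :
  D x -> non_isolated D x -> ex_derive_on D f x -> is_derive_on D f x (Derive_on D f x).
Proof. by move=> Dx Ax [l H]; rewrite (Derive_on_eq _ _ _ _ Dx Ax H). Qed.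

(** Derivatives depend on germs only: this transports them between sets that agree near [x], and
    from a set to a smaller one. *)
Lemma is_derive_on_local (D D' : R -> Prop) (f g : R -> R) (x l : R) :
  D x -> D' x -> locally x (fun y => D y -> D' y /\ g y = f y) ->
  is_derive_on D' f x l -> is_derive_on D g x l.
Proof.
  move=> Dx D'x Hloc /(is_derive_on_caratheodory _ _ _ _ D'x) [q [H1 [H2 H3]]].
  apply/is_derive_on_caratheodory => //.
  have gx : g x = f x by apply: (proj2 (locally_singleton _ _ Hloc Dx)).
  exists (fun y => if Req_dec_T y x then l else (g y - g x) / (y - x)).
  split; [|split].
  - move=> y Dy. case: (Req_dec_T y x) => [->|n]; first by ring. field; lra.
  - by case: (Req_dec_T x x).
  - apply: filterlim_R => eps He.
    have H := filterlim_R_eps _ _ _ H3 _ He.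
    rewrite /within in H |- *.
    apply: (filter_imp (fun y => (D y -> D' y /\ g y = f y) /\ (D' y -> Rabs (q y - l) < eps)));
      last by apply: filter_and.
    move=> y [A B] Dy. case: (Req_dec_T y x) => [_|n]; first by rewrite Rminus_diag Rabs_R0.
    have [D'y ->] := A Dy.
    have -> : (f y - g x) / (y - x) = q y by rewrite gx (H1 _ D'y); field; lra.
    exact: B.
Qed.

Lemma is_derive_on_ext (D : R -> Prop) (f g : R -> R) (x l : R) :
  D x -> (forall y, D y -> g y = f y) -> is_derive_on D f x l -> is_derive_on D g x l.
Proof.
  move=> Dx H. apply: is_derive_on_local => //. exists (mkposreal 1 Rlt_0_1) => y _ Dy. split=> //. exact: H.
Qed.

Lemma is_derive_on_continuous (D : R -> Prop) (f : R -> R) (x l : R) :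
  D x -> is_derive_on D f x l -> filterlim f (within D (locally x)) (locally (f x)).
Proof.
  move=> Dx /(is_derive_on_caratheodory _ _ _ _ Dx) [q [H1 [H2 H3]]].
  apply: (filterlim_within_ext D (fun y => f x + q y * (y - x))); first by move=> y Dy; rewrite -H1.
  have {2}-> : f x = f x + l * (x - x) by ring.
  have HW : Filter (within D (locally x)) by apply: within_filter.
  apply: (filterlim_comp_2 (H := locally (l * (x - x)))); [by apply: filterlim_const| |exact: (filterlim_plus (V := R_NormedModule))].
  apply: (filterlim_comp_2 (G := locally l) (H := locally (x - x))) => //; last exact: (filterlim_mult (K := R_AbsRing)).
  apply: filterlim_within.
  have : continuous (fun y => y - x) x by apply: (continuous_minus (V := R_NormedModule)); [exact: continuous_id|exact: continuous_const].
  by [].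
Qed.

Lemma is_derive_on_of_is_derive (D : R -> Prop) (f : R -> R) (x l : R) :
  D x -> is_derive f x l -> is_derive_on D f x l.
Proof.
  move=> Dx [H1 H2]. split=> // x' Hx'.
  have Hx : x' = x.
  { apply: NNPP => n.
    have Hd : 0 < Rabs (x - x') by apply: Rabs_pos_lt; lra.
    have H : within D (locally x) (fun y => y <> x).
    { apply: Hx'. exists (mkposreal _ Hd) => y Hy Hyx. rewrite Hyx in Hy. exact: (Rlt_irrefl _ Hy). }
    exact: (locally_singleton _ _ H Dx eq_refl). }
  rewrite Hx => eps. have Hl : is_filter_lim (locally x) x by [].
  apply: (filter_le_within D). exact: (H2 x Hl eps).
Qed.

Lemma is_derive_of_is_derive_on (D : R -> Prop) (f : R -> R) (x l : R) :
  locally x D -> is_derive_on D f x l -> is_derive f x l.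
Proof.
  move=> Dx [H1 H2]. split=> // x' Hx' eps.
  have Hl : is_filter_lim (within D (locally x)) x'.
  { move=> P HP. apply: (filter_le_within D). exact: Hx'. }
  have H := H2 x' Hl eps. rewrite /within in H.
  apply: filter_imp (filter_and _ _ Dx H) => y [A B]. exact: B.
Qed.

Lemma is_derive_on_plus (D : R -> Prop) (f g : R -> R) (x lf lg : R) : D x ->
  is_derive_on D f x lf -> is_derive_on D g x lg ->
  is_derive_on D (fun y => f y + g y) x (lf + lg).
Proof.
  move=> Dx /(is_derive_on_caratheodory _ _ _ _ Dx) [q1 [H1 [E1 L1]]].
  move=> /(is_derive_on_caratheodory _ _ _ _ Dx) [q2 [H2 [E2 L2]]].
  apply/is_derive_on_caratheodory => //. exists (fun y => q1 y + q2 y).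
  split; [|split].
  - move=> y Dy. rewrite (H1 y Dy) (H2 y Dy). ring.
  - by rewrite E1 E2.
  - apply: (filterlim_comp_2 (G := locally lf) (H := locally lg)) => //.
    exact: (filterlim_plus (V := R_NormedModule)).
Qed.

Lemma is_derive_on_mult (D : R -> Prop) (f g : R -> R) (x lf lg : R) : D x ->
  is_derive_on D f x lf -> is_derive_on D g x lg ->
  is_derive_on D (fun y => f y * g y) x (lf * g x + f x * lg).
Proof.
  move=> Dx Hf Hg. have Cg := is_derive_on_continuous _ _ _ _ Dx Hg.
  move: Hf Hg => /(is_derive_on_caratheodory _ _ _ _ Dx) [q1 [H1 [E1 L1]]].
  move=> /(is_derive_on_caratheodory _ _ _ _ Dx) [q2 [H2 [E2 L2]]].
  apply/is_derive_on_caratheodory => //. exists (fun y => q1 y * g y + f x * q2 y).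
  have HW : Filter (within D (locally x)) by apply: within_filter.
  split; [|split].
  - move=> y Dy. rewrite (H1 y Dy). rewrite {2}(H2 y Dy). rewrite (H2 y Dy). ring.
  - by rewrite E1 E2.
  - apply: (filterlim_comp_2 (G := locally (lf * g x)) (H := locally (f x * lg))).
    + apply: (filterlim_comp_2 (G := locally lf) (H := locally (g x))) => //.
      exact: (filterlim_mult (K := R_AbsRing)).
    + apply: (filterlim_comp_2 (G := locally (f x)) (H := locally lg)) => //.
      * exact: filterlim_const.
      * exact: (filterlim_mult (K := R_AbsRing)).
    + exact: (filterlim_plus (V := R_NormedModule)).
Qed.

(** * Functions of class [C^k] on subsets of the plane *)

Lemma within_imp {T : Type} (D : T -> Prop) (F : (T -> Prop) -> Prop) {FF : Filter F} (P Q : T -> Prop) :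
  (forall x, D x -> P x -> Q x) -> within D F P -> within D F Q.
Proof. move=> H. rewrite /within. apply: filter_imp => x Hx Dx. apply: H => //. exact: Hx. Qed.

(** Partial derivatives are related to [f] instead of being described by [iota] as in [Ck2_on]:
    a family of functions closed under partial derivatives is then of class [C^k] for every [k]
    by induction.  The two notions agree on sets with unique derivatives. *)
Fixpoint Ck (D : R -> R -> Prop) (k : nat) (f : R -> R -> R) : Prop :=
  continuous2_on D f /\
  match k with
  | O => True
  | S m => exists f1 f2 : R -> R -> R,
      (forall a b, D a b ->
         is_derive_on (fun a' => D a' b) (fun a' => f a' b) a (f1 a b) /\
         is_derive_on (D a) (f a) b (f2 a b)) /\ Ck D m f1 /\ Ck D m f2
  end.

Definition perfect2 (D : R -> R -> Prop) : Prop :=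
  forall a b, D a b -> non_isolated (fun a' => D a' b) a /\ non_isolated (D a) b.

Lemma Ck_continuous D k f : Ck D k f -> continuous2_on D f.
Proof. by case: k => [|k] []. Qed.

Lemma continuous2_on_ext D f g : eq2_on D g f -> continuous2_on D f -> continuous2_on D g.
Proof.
  move=> E C [a b] Dab /=. rewrite (E a b Dab).
  apply: (filterlim_within_ext _ (fun p : R * R => f (fst p) (snd p))); last exact: (C (a, b) Dab).
  by move=> [x y] Dxy /=; rewrite E.
Qed.

Lemma Ck_ext D k f g : eq2_on D g f -> Ck D k f -> Ck D k g.
Proof.
  case: k => [|k] E [C H].
  - split=> //. exact: (continuous2_on_ext _ f).
  - split; first exact: (continuous2_on_ext _ f).
    have [f1 [f2 [H1 H2]]] := H. exists f1, f2. split=> // a b Dab. have [A B] := H1 a b Dab.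
    split.
    + apply: is_derive_on_ext A => // a' Da'. exact: E.
    + apply: is_derive_on_ext B => // a' Da'. exact: E.
Qed.

Lemma Ck_pred D k f : Ck D (S k) f -> Ck D k f.
Proof.
  elim: k f => [|k IH] f [C H]; first by split.
  have [f1 [f2 [H1 [H2 H3]]]] := H. split=> //. exists f1, f2. split=> //. split; exact: IH.
Qed.

Lemma Ck2_on_of_Ck D k f : perfect2 D -> Ck D k f -> Ck2_on D k f.
Proof.
  move=> P. elim: k f => [|k IH] f [C H]; first by split.
  have [f1 [f2 [H1 [H2 H3]]]] := H. split=> //. split; [|split].
  - move=> a b Dab. have [A B] := H1 a b Dab. by split; [exists (f1 a b)|exists (f2 a b)].
  - apply: IH. apply: Ck_ext H2 => a b Dab. apply: Derive_on_eq => //; first by apply: (proj1 (P a b Dab)).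
    by apply: (proj1 (H1 a b Dab)).
  - apply: IH. apply: Ck_ext H3 => a b Dab. apply: Derive_on_eq => //; first by apply: (proj2 (P a b Dab)).
    by apply: (proj2 (H1 a b Dab)).
Qed.

Lemma Ck_of_Ck2_on D k f : perfect2 D -> Ck2_on D k f -> Ck D k f.
Proof.
  move=> P. elim: k f => [|k IH] f [C H]; first by split.
  have [H1 [H2 H3]] := H. split=> //. exists (partial1_on D f), (partial2_on D f). split; [|split].
  - move=> a b Dab. have [A B] := H1 a b Dab. have [A1 B1] := P a b Dab.
    split; exact: Derive_on_correct.
  - exact: IH.
  - exact: IH.
Qed.

Definition open_in2 (D D1 : R -> R -> Prop) : Prop :=
  forall a b, D1 a b -> locally (a, b) (fun p : R * R => D (fst p) (snd p) -> D1 (fst p) (snd p)).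

Lemma locally_prod_left (a b : R) (P : R * R -> Prop) : locally (a, b) P -> locally a (fun x => P (x, b)).
Proof. move=> [d H]. exists d => x Hx. apply: H. split=> //=. exact: ball_center. Qed.

Lemma locally_prod_right (a b : R) (P : R * R -> Prop) : locally (a, b) P -> locally b (fun y => P (a, y)).
Proof. move=> [d H]. exists d => x Hx. apply: H. split=> //=. exact: ball_center. Qed.

(** The derivatives found on the two relatively open pieces agree on the overlap by uniqueness,
    so that they can be patched. *)
Lemma Ck_glue (D D1 D2 : R -> R -> Prop) k f :
  perfect2 D1 -> perfect2 D2 -> open_in2 D D1 -> open_in2 D D2 ->
  (forall a b, D1 a b -> D a b) -> (forall a b, D2 a b -> D a b) ->
  (forall a b, D a b -> D1 a b \/ D2 a b) ->
  Ck D1 k f -> Ck D2 k f -> Ck D k f.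
Proof.
  move=> P1 P2 O1 O2 S1 S2 U.
  have HC : forall g, continuous2_on D1 g -> continuous2_on D2 g -> continuous2_on D g.
  { move=> g C1 C2 [a b] Dab P HP.
    have aux : forall D', open_in2 D D' -> continuous2_on D' g -> D' a b ->
       filtermap (fun p : R * R => g (fst p) (snd p))
         (within (fun p : R * R => D (fst p) (snd p)) (locally (a, b))) P.
    { move=> D' O' C' D'ab. have H := C' (a, b) D'ab P HP. rewrite /filtermap /within in H |- *.
      apply: filter_imp (filter_and _ _ (O' a b D'ab) H) => p [A B] Dp. exact: B (A Dp). }
    case: (U a b Dab); exact: aux. }
  elim: k f => [|k IH] f [C1 H1] [C2 H2]; first by split=> //; exact: HC.
  split; first exact: HC.
  have [f1 [f2 [F1 [F2 F3]]]] := H1. have [g1 [g2 [G1 [G2 G3]]]] := H2.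
  have E1 : forall a b, D1 a b -> D2 a b -> f1 a b = g1 a b.
  { move=> a b D1ab D2ab.
    have [A _] := F1 a b D1ab. have [B _] := G1 a b D2ab. have [A1 _] := P1 a b D1ab.
    apply: (is_derive_on_unique (fun a' => D1 a' b) (fun a' => f a' b) a) => //.
    apply: (is_derive_on_local _ (fun a' => D2 a' b)) B => //.
    apply: filter_imp (locally_prod_left _ _ _ (O2 a b D2ab)) => y /= Hy Dy. split=> //. apply: Hy. exact: S1. }
  have E2 : forall a b, D1 a b -> D2 a b -> f2 a b = g2 a b.
  { move=> a b D1ab D2ab.
    have [_ A] := F1 a b D1ab. have [_ B] := G1 a b D2ab. have [_ A1] := P1 a b D1ab.
    apply: (is_derive_on_unique (D1 a) (f a) b) => //.
    apply: (is_derive_on_local _ (D2 a)) B => //.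
    apply: filter_imp (locally_prod_right _ _ _ (O2 a b D2ab)) => y /= Hy Dy. split=> //. apply: Hy. exact: S1. }
  pose h1 a b := if excluded_middle_informative (D1 a b) then f1 a b else g1 a b.
  pose h2 a b := if excluded_middle_informative (D1 a b) then f2 a b else g2 a b.
  have h1f : eq2_on D1 h1 f1 by move=> a b D1ab; rewrite /h1; case: excluded_middle_informative.
  have h2f : eq2_on D1 h2 f2 by move=> a b D1ab; rewrite /h2; case: excluded_middle_informative.
  have h1g : eq2_on D2 h1 g1.
  { move=> a b D2ab; rewrite /h1; case: excluded_middle_informative => // D1ab. exact: E1. }
  have h2g : eq2_on D2 h2 g2.
  { move=> a b D2ab; rewrite /h2; case: excluded_middle_informative => // D1ab. exact: E2. }
  exists h1, h2. split; [|split; apply: IH; [exact: Ck_ext F2|exact: Ck_ext G2|exact: Ck_ext F3|exact: Ck_ext G3]].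
  move=> a b Dab.
  case: (U a b Dab) => D'ab.
  - have [A B] := F1 a b D'ab. rewrite (h1f _ _ D'ab) (h2f _ _ D'ab). split.
    + apply: (is_derive_on_local _ (fun a' => D1 a' b)) A => //.
      apply: filter_imp (locally_prod_left _ _ _ (O1 a b D'ab)) => y /= Hy Dy. split=> //. exact: Hy.
    + apply: (is_derive_on_local _ (D1 a)) B => //.
      apply: filter_imp (locally_prod_right _ _ _ (O1 a b D'ab)) => y /= Hy Dy. split=> //. exact: Hy.
  - have [A B] := G1 a b D'ab. rewrite (h1g _ _ D'ab) (h2g _ _ D'ab). split.
    + apply: (is_derive_on_local _ (fun a' => D2 a' b)) A => //.
      apply: filter_imp (locally_prod_left _ _ _ (O2 a b D'ab)) => y /= Hy Dy. split=> //. exact: Hy.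
    + apply: (is_derive_on_local _ (D2 a)) B => //.
      apply: filter_imp (locally_prod_right _ _ _ (O2 a b D'ab)) => y /= Hy Dy. split=> //. exact: Hy.
Qed.

Lemma continuous2_on_plus D f g : continuous2_on D f -> continuous2_on D g ->
  continuous2_on D (fun a b => f a b + g a b).
Proof.
  move=> Cf Cg p Dp.
  apply: (filterlim_comp_2 (G := locally (f (fst p) (snd p))) (H := locally (g (fst p) (snd p))));
    [exact: Cf|exact: Cg|exact: (filterlim_plus (V := R_NormedModule))].
Qed.

Lemma continuous2_on_mult D f g : continuous2_on D f -> continuous2_on D g ->
  continuous2_on D (fun a b => f a b * g a b).
Proof.
  move=> Cf Cg p Dp.
  apply: (filterlim_comp_2 (G := locally (f (fst p) (snd p))) (H := locally (g (fst p) (snd p))));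
    [exact: Cf|exact: Cg|exact: (filterlim_mult (K := R_AbsRing))].
Qed.

Lemma Ck_const D k c : Ck D k (fun _ _ => c).
Proof.
  elim: k c => [|k IH] c.
  - split=> // p Dp. exact: filterlim_const.
  - split; first by move=> p Dp; exact: filterlim_const.
    exists (fun _ _ => 0), (fun _ _ => 0). split; [|by split].
    move=> a b Dab. split; apply: is_derive_on_of_is_derive => //; exact: is_derive_const.
Qed.

Lemma Ck_coord1 D k : Ck D k (fun a _ => a).
Proof.
  have C : continuous2_on D (fun a _ => a) by move=> [a b] Dp; apply: filterlim_within; move=> P [d H]; exists d => [[x y]] [Hx Hy]; exact: H.
  case: k => [|k]; split=> //.
  exists (fun _ _ => 1), (fun _ _ => 0). split; [|by split; exact: Ck_const].
  move=> a b Dab. split; apply: is_derive_on_of_is_derive => //; [exact: is_derive_id|exact: is_derive_const].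
Qed.

Lemma Ck_coord2 D k : Ck D k (fun _ b => b).
Proof.
  have C : continuous2_on D (fun _ b => b) by move=> [a b] Dp; apply: filterlim_within; move=> P [d H]; exists d => [[x y]] [Hx Hy]; exact: H.
  case: k => [|k]; split=> //.
  exists (fun _ _ => 0), (fun _ _ => 1). split; [|by split; exact: Ck_const].
  move=> a b Dab. split; apply: is_derive_on_of_is_derive => //; [exact: is_derive_const|exact: is_derive_id].
Qed.

Lemma Ck_plus D k f g : Ck D k f -> Ck D k g -> Ck D k (fun a b => f a b + g a b).
Proof.
  elim: k f g => [|k IH] f g [Cf Hf] [Cg Hg]; split=> //; try exact: continuous2_on_plus.
  have [f1 [f2 [F1 [F2 F3]]]] := Hf. have [g1 [g2 [G1 [G2 G3]]]] := Hg.
  exists (fun a b => f1 a b + g1 a b), (fun a b => f2 a b + g2 a b).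
  split; last by split; exact: IH.
  move=> a b Dab. have [A B] := F1 a b Dab. have [A' B'] := G1 a b Dab.
  split.
  - exact: (is_derive_on_plus _ (fun a' => f a' b) (fun a' => g a' b)).
  - exact: (is_derive_on_plus _ (f a) (g a)).
Qed.

Lemma Ck_mult D k f g : Ck D k f -> Ck D k g -> Ck D k (fun a b => f a b * g a b).
Proof.
  elim: k f g => [|k IH] f g Hf Hg.
  - case: Hf => Cf _; case: Hg => Cg _; split=> //; exact: continuous2_on_mult.
  - have Hf' := Ck_pred _ _ _ Hf. have Hg' := Ck_pred _ _ _ Hg.
    case: Hf => Cf [f1 [f2 [F1 [F2 F3]]]]. case: Hg => Cg [g1 [g2 [G1 [G2 G3]]]].
    split; first exact: continuous2_on_mult.
    exists (fun a b => f1 a b * g a b + f a b * g1 a b), (fun a b => f2 a b * g a b + f a b * g2 a b).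
    split; last by split; apply: Ck_plus; apply: IH.
    move=> a b Dab. have [A B] := F1 a b Dab. have [A' B'] := G1 a b Dab.
    split.
    + exact: (is_derive_on_mult _ (fun a' => f a' b) (fun a' => g a' b)).
    + exact: (is_derive_on_mult _ (f a) (g a)).
Qed.

Lemma Ck_scal D k c f : Ck D k f -> Ck D k (fun a b => c * f a b).
Proof. move=> H. apply: Ck_mult => //. exact: Ck_const. Qed.

(** * Composition on the quarter plane *)

Lemma mvt_half_line (f df : R -> R) (p r : R) :
  (forall c, 0 < c -> is_derive f c (df c)) ->
  (forall c, 0 <= c -> filterlim f (within half_line (locally c)) (locally (f c))) -> 0 <= p -> 0 <= r ->
  exists c, Rmin p r <= c <= Rmax p r /\ f r - f p = df c * (r - p).
Proof.
  move=> H HC Hp Hr.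
  (* constant prolongation to the left makes [f] continuous on the whole line *)
  pose g c := f (Rmax 0 c).
  have gE : forall c, 0 <= c -> g c = f c by move=> c Hc; rewrite /g Rmax_right.
  have Hmin : 0 <= Rmin p r by apply: Rmin_glb.
  have [c [Hc E]] : exists c, Rmin p r <= c <= Rmax p r /\ g r - g p = df c * (r - p).
  { apply: MVT_gen.
    - move=> c [Hc1 Hc2].
      have Hc : 0 < c by lra.
      apply: (is_derive_ext_loc f); last by apply: H.
      exists (mkposreal c Hc) => y Hy. rewrite gE //.
      move: (ball_R _ _ _ Hy) => /=. lra.
    - move=> c [Hc1 Hc2]. apply/continuity_pt_filterlim.
      have Hc : 0 <= c by lra.
      rewrite gE //. rewrite /g.
      apply: (filterlim_comp _ _ _ (Rmax 0) f _ (within half_line (locally c))); last by apply: HC.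
      move=> P [d HP]. exists d => y Hy. apply: HP; last by exact: Rmax_l.
      have [A B] := ball_R _ _ _ Hy.
      apply: Rabs_def1; rewrite /minus /plus /opp /= /Rmax; case: Rle_dec; lra. }
  exists c. split=> //. by rewrite -!gE.
Qed.

Lemma locally_half_line (c : R) : 0 < c -> locally c half_line.
Proof.
  move=> Hc. exists (mkposreal c Hc) => y Hy. have := ball_R _ _ _ Hy. rewrite /half_line /=. lra.
Qed.

Lemma mvt_on_half_line (f df : R -> R) (p r : R) :
  (forall c, 0 <= c -> is_derive_on half_line f c (df c)) -> 0 <= p -> 0 <= r ->
  exists c, Rmin p r <= c <= Rmax p r /\ f r - f p = df c * (r - p).
Proof.
  move=> H. apply: mvt_half_line => c Hc.
  - apply: (is_derive_of_is_derive_on half_line); [exact: locally_half_line|apply: H; lra].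
  - apply: is_derive_on_continuous => //. exact: H.
Qed.

(** Difference quotients, with the value [l] at [r = p]: the factor in Carathéodory's form. *)
Definition slope (f : R -> R) (l p r : R) : R :=
  if Req_dec_T r p then l else (f r - f p) / (r - p).

Lemma slope_eq f l p r : f r - f p = slope f l p r * (r - p).
Proof. rewrite /slope. case: (Req_dec_T r p) => [->|n]; first by ring. field. lra. Qed.

(** By the mean value theorem the difference quotients at [0] are values of [df] at points tending
    to [0]. *)
Lemma is_derive_on_half_line_zero (f df : R -> R) :
  (forall c, 0 < c -> is_derive f c (df c)) ->
  filterlim f (within half_line (locally 0)) (locally (f 0)) ->
  filterlim df (within half_line (locally 0)) (locally (df 0)) ->
  is_derive_on half_line f 0 (df 0).
Proof.
  move=> H Hf Hdf. have H0 : half_line 0 by apply: Rle_refl.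
  apply/is_derive_on_caratheodory => //.
  exists (slope f (df 0) 0). split; [|split].
  - move=> y _. rewrite -slope_eq. ring.
  - rewrite /slope. by case: (Req_dec_T 0 0).
  - have HW : Filter (within half_line (locally 0)) by apply: within_filter.
    apply: filterlim_R => e He. have [d Hd] := filterlim_R_eps _ _ _ Hdf e He.
    exists d => y Hy Dy.
    rewrite /slope. case: (Req_dec_T y 0) => n; first by rewrite Rminus_diag Rabs_R0.
    have Hc : forall c, 0 <= c -> filterlim f (within half_line (locally c)) (locally (f c)).
    { move=> c [Hc|<-] //. apply: filterlim_within. apply: (ex_derive_continuous f). exists (df c). exact: H. }
    have [c [Hcc E]] := mvt_half_line f df 0 y H Hc H0 Dy.
    rewrite E. have -> : df c * (y - 0) / (y - 0) = df c by field; lra.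
    have Dy' : 0 <= y by exact: Dy.
    rewrite Rmin_left // Rmax_right // in Hcc.
    apply: Hd; last by case: Hcc.
    have [A B] := ball_R _ _ _ Hy. apply: Rabs_def1; rewrite /minus /plus /opp /=; lra.
Qed.

(** The chain rule for a function of two variables on the closed quarter plane.  The increment is
    split along a horizontal and a vertical segment, which stay in the quarter plane, and each
    part is handled by the mean value theorem. *)
Lemma is_derive_on_comp2 (D : R -> Prop) (F F1 F2 : R -> R -> R) (a b : R -> R) (x la lb : R) :
  (forall p r, quarter p r -> is_derive_on (fun p' => quarter p' r) (fun p' => F p' r) p (F1 p r) /\
     is_derive_on (quarter p) (F p) r (F2 p r)) ->
  continuous2_on quarter F1 -> continuous2_on quarter F2 ->
  D x -> (forall y, D y -> quarter (a y) (b y)) ->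
  is_derive_on D a x la -> is_derive_on D b x lb ->
  is_derive_on D (fun y => F (a y) (b y)) x (F1 (a x) (b x) * la + F2 (a x) (b x) * lb).
Proof.
  move=> HF C1 C2 Dx Hq Ha Hb.
  have Ca := is_derive_on_continuous _ _ _ _ Dx Ha.
  have Cb := is_derive_on_continuous _ _ _ _ Dx Hb.
  move: Ha Hb => /(is_derive_on_caratheodory _ _ _ _ Dx) [q1 [H1 [E1 L1]]].
  move=> /(is_derive_on_caratheodory _ _ _ _ Dx) [q2 [H2 [E2 L2]]].
  apply/is_derive_on_caratheodory => //.
  have [Qa Qb] := Hq x Dx.
  pose s1 y := slope (fun p => F p (b y)) (F1 (a x) (b x)) (a x) (a y).
  pose s2 y := slope (F (a x)) (F2 (a x) (b x)) (b x) (b y).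
  have M1 : forall p p' r, 0 <= r -> 0 <= p -> 0 <= p' ->
     exists c, Rmin p p' <= c <= Rmax p p' /\ F p' r - F p r = F1 c r * (p' - p).
  { move=> p p' r Hr Hp Hp'. apply: (mvt_on_half_line (fun p => F p r) (fun p => F1 p r)) => // c Hc.
    have [A _] := HF c r (conj Hc Hr).
    apply: (is_derive_on_local _ (fun p' => quarter p' r)) A => //.
    exists (mkposreal 1 Rlt_0_1) => y _ Dy. by split. }
  have M2 : forall p r r', 0 <= p -> 0 <= r -> 0 <= r' ->
     exists c, Rmin r r' <= c <= Rmax r r' /\ F p r' - F p r = F2 p c * (r' - r).
  { move=> p r r' Hp Hr Hr'. apply: (mvt_on_half_line (F p) (F2 p)) => // c Hc.
    have [_ A] := HF p c (conj Hp Hc).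
    apply: (is_derive_on_local _ (quarter p)) A => //.
    exists (mkposreal 1 Rlt_0_1) => y _ Dy. by split. }
  have HW : Filter (within D (locally x)) by apply: within_filter.
  have bnd : forall p p' c d, Rmin p p' <= c <= Rmax p p' -> Rabs (p' - p) < d -> Rabs (c - p) < d.
  { move=> p p' c d [A B] /Rabs_def2 [A' B'].
    move: A B; rewrite /Rmin /Rmax; case: Rle_dec => _ A B; apply: Rabs_def1; lra. }
  have Near : forall d, 0 < d -> within D (locally x)
      (fun y => D y /\ Rabs (a y - a x) < d /\ Rabs (b y - b x) < d).
  { move=> d Hd.
    have A := filterlim_R_eps _ _ _ Ca d Hd. have B := filterlim_R_eps _ _ _ Cb d Hd.
    by apply: (within_imp _ _ _ _ _ (filter_and _ _ A B)). }
  have Lim : forall G : R -> R -> R, continuous2_on quarter G -> forall eps, 0 < eps ->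
     exists d, 0 < d /\ forall p r, quarter p r -> Rabs (p - a x) < d -> Rabs (r - b x) < d ->
        Rabs (G p r - G (a x) (b x)) < eps.
  { move=> G CG eps He. have [d Hd] := filterlim_R_eps _ _ _ (CG (a x, b x) (Hq x Dx)) eps He.
    exists d; split; first exact: cond_pos. move=> p r Hpr A B. apply: (Hd (p, r)) => //. }
  exists (fun y => s1 y * q1 y + s2 y * q2 y). split; [|split].
  - move=> y Dy.
    have -> : F (a y) (b y) = F (a x) (b x) + (F (a y) (b y) - F (a x) (b y)) + (F (a x) (b y) - F (a x) (b x)) by ring.
    rewrite (slope_eq (fun p => F p (b y)) (F1 (a x) (b x)) (a x) (a y)).
    rewrite (slope_eq (F (a x)) (F2 (a x) (b x)) (b x) (b y)).
    rewrite -/(s1 y) -/(s2 y) {1}(H1 y Dy) {1}(H2 y Dy). ring.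
  - rewrite E1 E2 /s1 /s2 /slope. case: (Req_dec_T (a x) (a x)) => //. case: (Req_dec_T (b x) (b x)) => //.
  - have K1 : filterlim s1 (within D (locally x)) (locally (F1 (a x) (b x))).
    { apply: filterlim_R => eps He. have [d [Hd H]] := Lim F1 C1 eps He.
      apply: (within_imp _ _ _ _ _ (Near d Hd)) => y Dy [_ [A B]]. have [Qay Qby] := Hq y Dy.
      rewrite /s1 /slope. case: (Req_dec_T (a y) (a x)) => n; first by rewrite Rminus_diag Rabs_R0.
      have [c [Hc ->]] := M1 (a x) (a y) (b y) Qby Qa Qay.
      have -> : F1 c (b y) * (a y - a x) / (a y - a x) = F1 c (b y) by field; lra.
      apply: H => //; last by apply: bnd Hc A.
      split=> //. have : 0 <= Rmin (a x) (a y) by apply: Rmin_glb. lra. }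
    have K2 : filterlim s2 (within D (locally x)) (locally (F2 (a x) (b x))).
    { apply: filterlim_R => eps He. have [d [Hd H]] := Lim F2 C2 eps He.
      apply: (within_imp _ _ _ _ _ (Near d Hd)) => y Dy [_ [A B]]. have [Qay Qby] := Hq y Dy.
      rewrite /s2 /slope. case: (Req_dec_T (b y) (b x)) => n; first by rewrite Rminus_diag Rabs_R0.
      have [c [Hc ->]] := M2 (a x) (b x) (b y) Qa Qb Qby.
      have -> : F2 (a x) c * (b y - b x) / (b y - b x) = F2 (a x) c by field; lra.
      apply: H => //; last by apply: bnd Hc B.
      - split=> //. have : 0 <= Rmin (b x) (b y) by apply: Rmin_glb. lra.
      - by rewrite Rminus_diag Rabs_R0. }
    apply: (filterlim_comp_2 (G := locally (F1 (a x) (b x) * la)) (H := locally (F2 (a x) (b x) * lb)));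
      last exact: (filterlim_plus (V := R_NormedModule)).
    + apply: (filterlim_comp_2 (G := locally (F1 (a x) (b x))) (H := locally la)) => //.
      exact: (filterlim_mult (K := R_AbsRing)).
    + apply: (filterlim_comp_2 (G := locally (F2 (a x) (b x))) (H := locally lb)) => //.
      exact: (filterlim_mult (K := R_AbsRing)).
Qed.

Lemma continuous2_on_comp D F a b : continuous2_on quarter F -> continuous2_on D a -> continuous2_on D b ->
  (forall p r, D p r -> quarter (a p r) (b p r)) -> continuous2_on D (fun p r => F (a p r) (b p r)).
Proof.
  move=> CF Ca Cb Hq [p r] Dpr /=.
  have HW : Filter (within (fun p : R * R => D (fst p) (snd p)) (locally (p, r))) by apply: within_filter.
  apply: filterlim_R => eps He.
  have [d Hd] := filterlim_R_eps _ _ _ (CF (a p r, b p r) (Hq _ _ Dpr)) eps He.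
  have A := filterlim_R_eps _ _ _ (Ca (p, r) Dpr) d (cond_pos d).
  have B := filterlim_R_eps _ _ _ (Cb (p, r) Dpr) d (cond_pos d).
  apply: (within_imp _ _ _ _ _ (filter_and _ _ A B)) => [[x y]] /= Dy [A' B']. apply: (Hd (a x y, b x y)); first by split.
  exact: Hq.
Qed.

Lemma Ck_comp D k F a b : (forall p r, D p r -> quarter (a p r) (b p r)) ->
  Ck quarter k F -> Ck D k a -> Ck D k b -> Ck D k (fun p r => F (a p r) (b p r)).
Proof.
  move=> Hq. elim: k F => [|k IH] F HF Ha Hb.
  - case: HF => CF _; case: Ha => Ca _; case: Hb => Cb _; split=> //; exact: continuous2_on_comp.
  - have Ha' := Ck_pred _ _ _ Ha. have Hb' := Ck_pred _ _ _ Hb.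
    case: HF => CF [F1 [F2 [HF [HF1 HF2]]]].
    case: Ha => Ca [a1 [a2 [Ha [Ha1 Ha2]]]]. case: Hb => Cb [b1 [b2 [Hb [Hb1 Hb2]]]].
    split; first exact: continuous2_on_comp.
    exists (fun p r => F1 (a p r) (b p r) * a1 p r + F2 (a p r) (b p r) * b1 p r),
           (fun p r => F1 (a p r) (b p r) * a2 p r + F2 (a p r) (b p r) * b2 p r).
    have C1 := Ck_continuous _ _ _ HF1. have C2 := Ck_continuous _ _ _ HF2.
    split; last by split; apply: Ck_plus; apply: Ck_mult => //; exact: IH.
    move=> p r Dpr. have [A1 A2] := Ha p r Dpr. have [B1 B2] := Hb p r Dpr. split.
    + apply: (is_derive_on_comp2 (fun p' => D p' r) F F1 F2 (fun p' => a p' r) (fun p' => b p' r)) => // y Dy.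
      exact: Hq.
    + apply: (is_derive_on_comp2 (D p) F F1 F2 (a p) (b p)) => // y Dy. exact: Hq.
Qed.

(** * Dominated integrals over the positive half-line *)

(** One fixed weight serves all the integrals of this file; it absorbs polynomials times Gaussians. *)
Definition dominated (M : R) (f : R -> R) : Prop :=
  forall z, 0 < z -> Rabs (f z) <= M / (1 + z ^ 2).

(** Nothing is asked at [0]: some integrands have no limit there. *)
Definition continuous_pos (f : R -> R) : Prop := forall z, 0 < z -> continuous f z.

Definition cutoff_integral (f : R -> R) (n : nat) : R := RInt f (/ (INR n + 1)) (INR n + 1).

Definition integral (f : R -> R) : R := real (Lim_seq (cutoff_integral f)).

Lemma ex_RInt_pos f a b : continuous_pos f -> 0 < a -> 0 < b -> ex_RInt f a b.
Proof.
  move=> C Ha Hb. apply: (ex_RInt_continuous (V := R_CompleteNormedModule)) => z [Hz _]. apply: C.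
  have := Rmin_pos a b Ha Hb. lra.
Qed.

Lemma dominated_nonneg M f : dominated M f -> 0 <= M.
Proof. move=> /(_ 1 Rlt_0_1) H. have := Rabs_pos (f 1). lra. Qed.

Lemma weight_le_one z : / (1 + z ^ 2) <= 1.
Proof. rewrite -{2}Rinv_1. apply: Rinv_le_contravar; nra. Qed.

Lemma RInt_dominated_near_zero M f a b : continuous_pos f -> dominated M f -> 0 < a <= b ->
  Rabs (RInt f a b) <= M * (b - a).
Proof.
  move=> C Dm [Ha Hb]. rewrite (Rmult_comm M). apply: abs_RInt_le_const => //; first by apply: ex_RInt_pos => //; lra.
  move=> t Ht. have Hz : 0 < t by lra.
  apply: (Rle_trans _ _ _ (Dm t Hz)).
  have := weight_le_one t. have := dominated_nonneg _ _ Dm. rewrite /Rdiv. nra.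
Qed.

Lemma RInt_dominated_near_infinity M f a b : continuous_pos f -> dominated M f -> 0 < a <= b ->
  Rabs (RInt f a b) <= M * (/ a - / b).
Proof.
  move=> C Dm [Ha Hb].
  have H : is_RInt (fun z => M * / z ^ 2) a b (minus (- M / b) (- M / a)).
  { apply: (is_RInt_derive (fun z => - M / z)).
    - move=> x [Hx _]. have Hx0 : 0 < x by rewrite Rmin_left in Hx; lra.
      auto_derive; first by lra. field. lra.
    - move=> x [Hx _]. have Hx0 : 0 < x by rewrite Rmin_left in Hx; lra.
      apply: ex_derive_continuous. auto_derive. nra. }
  have E : M * (/ a - / b) = minus (- M / b) (- M / a) by rewrite /minus /plus /opp /=; field; lra.
  rewrite E.
  apply: (norm_RInt_le f _ a b _ _ Hb _ (RInt_correct _ _ _ (ex_RInt_pos f a b C Ha ltac:(lra))) H).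
  move=> x [Hx _]. have Hx0 : 0 < x by lra.
  apply: (Rle_trans _ _ _ (Dm x Hx0)). apply: Rmult_le_compat_l; first exact: (dominated_nonneg _ _ Dm).
  apply: Rinv_le_contravar; nra.
Qed.

Lemma RInt_enlarge M f a b a' b' : continuous_pos f -> dominated M f -> 0 < a' <= a -> a <= b -> b <= b' ->
  Rabs (RInt f a' b' - RInt f a b) <= M * (a + / b).
Proof.
  move=> C Dm [Ha' Ha] Hab Hb.
  have H1 : RInt f a' b' = RInt f a' a + RInt f a b + RInt f b b'.
  { rewrite -(RInt_Chasles f a' b b'); try (by apply: ex_RInt_pos => //; lra).
    rewrite -(RInt_Chasles f a' a b); try (by apply: ex_RInt_pos => //; lra). reflexivity. }
  rewrite H1. have -> : RInt f a' a + RInt f a b + RInt f b b' - RInt f a b = RInt f a' a + RInt f b b' by ring.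
  apply: (Rle_trans _ _ _ (Rabs_triang _ _)).
  have A := RInt_dominated_near_zero M f a' a C Dm (conj Ha' Ha).
  have Hb0 : 0 < b by lra.
  have B := RInt_dominated_near_infinity M f b b' C Dm (conj Hb0 Hb).
  have M0 := dominated_nonneg _ _ Dm.
  have : 0 < / b' by apply: Rinv_0_lt_compat; lra.
  nra.
Qed.

Lemma inv_INR_small e : 0 < e -> exists N, forall n, (N <= n)%nat -> / (INR n + 1) < e /\ / e < INR n + 1.
Proof.
  move=> He. have [N HN] := INR_unbounded (/ e). exists N => n Hn.
  have H : / e < INR n + 1 by have := le_INR _ _ Hn; lra.
  split=> //. rewrite -(Rinv_inv e). apply: Rinv_lt_contravar => //.
  apply: Rmult_lt_0_compat; first exact: Rinv_0_lt_compat. have := pos_INR n; lra.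
Qed.

Lemma cutoff_bounds n : 0 < / (INR n + 1) <= 1 /\ 1 <= INR n + 1.
Proof.
  have := pos_INR n => H. split; last by lra. split; first by apply: Rinv_0_lt_compat; lra.
  rewrite -{2}Rinv_1. apply: Rinv_le_contravar; lra.
Qed.

Lemma is_lim_cutoff_integral M f : continuous_pos f -> dominated M f -> is_lim_seq (cutoff_integral f) (integral f).
Proof.
  move=> C Dm. have M0 := dominated_nonneg _ _ Dm.
  have : ex_finite_lim_seq (cutoff_integral f).
  { apply/ex_lim_seq_cauchy_corr => eps.
    have He : 0 < eps / (4 * (M + 1)) by apply: Rdiv_lt_0_compat; [exact: cond_pos|lra].
    have [N HN] := inv_INR_small _ He. exists N => n m Hn Hm.
    have aux : forall n, (N <= n)%nat -> Rabs (cutoff_integral f n - cutoff_integral f N) <= eps / 2 * (M / (M + 1)).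
    { move=> k Hk. have [A1 A2] := cutoff_bounds N. have [B1 B2] := cutoff_bounds k.
      have HNk := le_INR _ _ Hk.
      have L := RInt_enlarge M f (/ (INR N + 1)) (INR N + 1) (/ (INR k + 1)) (INR k + 1) C Dm.
      apply: (Rle_trans _ _ _ (L _ _ _)); try lra.
      - split; first by lra. apply: Rinv_le_contravar; lra.
      - have [S _] := HN N (le_n N).
        have -> : eps / 2 * (M / (M + 1)) = M * (2 * (eps / (4 * (M + 1)))) by field; lra.
        apply: Rmult_le_compat_l => //. lra. }
    have := aux n Hn. have := aux m Hm => H1 H2.
    have -> : cutoff_integral f n - cutoff_integral f m =
      (cutoff_integral f n - cutoff_integral f N) - (cutoff_integral f m - cutoff_integral f N) by ring.
    apply: (Rle_lt_trans _ _ _ (Rabs_triang _ _)). rewrite Rabs_Ropp.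
    have : M / (M + 1) < 1 by apply: (proj1 (Rdiv_lt_1 M (M + 1) _)); lra.
    have := cond_pos eps. nra. }
  move=> [l Hl]. rewrite /integral (is_lim_seq_unique _ _ Hl). exact: Hl.
Qed.

(** The truncation error depends on [M] only, hence is uniform in families. *)
Lemma integral_approx M f a b : continuous_pos f -> dominated M f -> 0 < a <= b ->
  Rabs (integral f - RInt f a b) <= M * (a + / b).
Proof.
  move=> C Dm [Ha Hb]. have HL := is_lim_cutoff_integral M f C Dm.
  have HL2 : is_lim_seq (fun n => Rabs (cutoff_integral f n - RInt f a b)) (Rabs (integral f - RInt f a b)).
  { apply: (is_lim_seq_abs _ (Finite (integral f - RInt f a b))).
    apply: is_lim_seq_minus'; [exact: HL|exact: is_lim_seq_const]. }
  have := is_lim_seq_le_loc _ (fun _ => M * (a + / b)) _ _ _ HL2 (is_lim_seq_const _).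
  apply.
  have Hm : 0 < Rmin a (/ b) by apply: Rmin_pos => //; apply: Rinv_0_lt_compat; lra.
  have [N HN] := inv_INR_small _ Hm. exists N => n Hn. have [A B] := HN n Hn.
  have [A' _] := cutoff_bounds n.
  have Hbi : 0 < / b by apply: Rinv_0_lt_compat; lra.
  apply: RInt_enlarge => //.
  - split; first by lra. have := Rmin_l a (/ b); lra.
  - have : / / b <= / Rmin a (/ b) by apply: Rinv_le_contravar => //; exact: Rmin_r.
    rewrite Rinv_inv. lra.
Qed.

Definition is_integral (f : R -> R) (l : R) : Prop :=
  forall e, 0 < e -> exists d, 0 < d /\ forall a b, 0 < a < d -> / d < b -> Rabs (RInt f a b - l) < e.

Lemma is_integral_integral M f : continuous_pos f -> dominated M f -> is_integral f (integral f).
Proof.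
  move=> C Dm e He. have M0 := dominated_nonneg _ _ Dm.
  have Hd : 0 < Rmin 1 (e / (2 * (M + 1))).
  { apply: Rmin_pos; first lra. apply: Rdiv_lt_0_compat; lra. }
  exists (Rmin 1 (e / (2 * (M + 1)))). split=> // a b [Ha1 Ha2] Hb.
  have R1 := Rmin_l 1 (e / (2 * (M + 1))). have R2 := Rmin_r 1 (e / (2 * (M + 1))).
  set d := Rmin _ _ in Hd Ha2 Hb R1 R2.
  have D1 : 1 <= / d by rewrite -{1}Rinv_1; apply: Rinv_le_contravar.
  have Hib : / b < d.
  { rewrite -(Rinv_inv d). apply: Rinv_lt_contravar => //. apply: Rmult_lt_0_compat; lra. }
  rewrite Rabs_minus_sym.
  apply: (Rle_lt_trans _ _ _ (integral_approx M f a b C Dm _)); first by lra.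
  have : d * (2 * (M + 1)) <= e by apply/Rle_div_r; lra.
  nra.
Qed.

Lemma is_integral_unique f l : is_integral f l -> integral f = l.
Proof.
  move=> H. have HL : is_lim_seq (cutoff_integral f) l.
  { apply/is_lim_seq_spec => eps. have [d [Hd K]] := H eps (cond_pos eps).
    have [N HN] := inv_INR_small d Hd. exists N => n Hn. have [A B] := HN n Hn.
    apply: K => //. have := cutoff_bounds n. lra. }
  by rewrite /integral (is_lim_seq_unique _ _ HL).
Qed.

Lemma integral_ext f g : (forall z, 0 < z -> f z = g z) -> integral f = integral g.
Proof.
  move=> H. rewrite /integral. congr real. apply: Lim_seq_ext => n. apply: RInt_ext => z [Hz _].
  apply: H. have [A B] := cutoff_bounds n. rewrite Rmin_left in Hz; lra.
Qed.

Lemma integral_plus Mf Mg f g : continuous_pos f -> continuous_pos g -> dominated Mf f -> dominated Mg g ->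
  integral (fun z => f z + g z) = integral f + integral g.
Proof.
  move=> Cf Cg Df Dg.
  have L := is_lim_seq_plus' _ _ _ _ (is_lim_cutoff_integral Mf f Cf Df) (is_lim_cutoff_integral Mg g Cg Dg).
  rewrite {1}/integral (Lim_seq_ext _ (fun n => cutoff_integral f n + cutoff_integral g n)).
  - by rewrite (is_lim_seq_unique _ _ L).
  - move=> n. have [A B] := cutoff_bounds n. apply: (RInt_plus f g); apply: ex_RInt_pos => //; lra.
Qed.

Lemma integral_scal c f : continuous_pos f -> integral (fun z => c * f z) = c * integral f.
Proof.
  move=> Cf.
  have E : forall n, cutoff_integral (fun z => c * f z) n = c * cutoff_integral f n.
  { move=> n. rewrite /cutoff_integral. have [A B] := cutoff_bounds n.
    apply: (RInt_scal f _ _ c). apply: ex_RInt_pos => //; lra. }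
  rewrite /integral (Lim_seq_ext _ _ E) Lim_seq_scal_l.
  case: (Lim_seq (cutoff_integral f)) => [l| |] //=; rewrite Rmult_0_r;
    by case: Rle_dec => // H; case: Rle_lt_or_eq_dec.
Qed.

Lemma dominated_lincomb c e Mf Mg f g : dominated Mf f -> dominated Mg g ->
  dominated (Rabs c * Mf + Rabs e * Mg) (fun z => c * f z + e * g z).
Proof.
  move=> Hf Hg z Hz. apply: (Rle_trans _ _ _ (Rabs_triang _ _)).
  rewrite !Rabs_mult /Rdiv Rmult_plus_distr_r !Rmult_assoc.
  apply: Rplus_le_compat; (apply: Rmult_le_compat_l; first exact: Rabs_pos); [exact: Hf|exact: Hg].
Qed.

Lemma dominated_scal c M f : dominated M f -> dominated (Rabs c * M) (fun z => c * f z).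
Proof. move=> H z Hz. rewrite Rabs_mult /Rdiv Rmult_assoc. apply: Rmult_le_compat_l; [exact: Rabs_pos|exact: H]. Qed.

Lemma integral_lincomb c e Mf Mg f g : continuous_pos f -> continuous_pos g -> dominated Mf f -> dominated Mg g ->
  integral (fun z => c * f z + e * g z) = c * integral f + e * integral g.
Proof.
  move=> Cf Cg Hf Hg.
  have Cs : forall k h, continuous_pos h -> continuous_pos (fun z => k * h z).
  { move=> k h Ch z Hz. apply: (continuous_mult (K := R_AbsRing)); [exact: continuous_const|exact: Ch]. }
  rewrite (integral_plus (Rabs c * Mf) (Rabs e * Mg)) ?integral_scal //; try exact: Cs; exact: dominated_scal.
Qed.

Lemma integral_bound M f : continuous_pos f -> dominated M f -> Rabs (integral f) <= 2 * M.
Proof.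
  move=> C Dm. have := integral_approx M f 1 1 C Dm ltac:(lra).
  rewrite RInt_point /zero /= Rminus_0_r Rinv_1. lra.
Qed.

(** Integrations by parts are applications of this lemma to exact derivatives. *)
Lemma integral_derive H h l0 l1 :
  (forall z, 0 < z -> is_derive H z (h z)) -> continuous_pos h ->
  (forall e, 0 < e -> exists d, 0 < d /\ forall a, 0 < a < d -> Rabs (H a - l0) < e) ->
  (forall e, 0 < e -> exists d, 0 < d /\ forall b, / d < b -> Rabs (H b - l1) < e) ->
  integral h = l1 - l0.
Proof.
  move=> HH C H0 H1. apply: is_integral_unique => e He.
  have He2 : 0 < e / 2 by lra.
  have [d0 [Hd0 K0]] := H0 _ He2. have [d1 [Hd1 K1]] := H1 _ He2.
  have Hd : 0 < Rmin d0 d1 by exact: Rmin_pos.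
  exists (Rmin d0 d1). split=> // a b [Ha1 Ha2] Hb.
  have L0 := Rmin_l d0 d1. have L1 := Rmin_r d0 d1.
  have K2 : / d1 <= / Rmin d0 d1 by apply: Rinv_le_contravar.
  have Hb0 : 0 < b by have := Rinv_0_lt_compat _ Hd; lra.
  have Hm := Rmin_pos a b Ha1 Hb0.
  have E : is_RInt h a b (minus (H b) (H a)).
  { apply: is_RInt_derive => z [Hz _]; [apply: HH|apply: C]; lra. }
  rewrite (is_RInt_unique _ _ _ _ E) /minus /plus /opp /=.
  have -> : H b + - H a - (l1 - l0) = (H b - l1) - (H a - l0) by ring.
  apply: (Rle_lt_trans _ _ _ (Rabs_triang _ _)). rewrite Rabs_Ropp.
  have := K0 a ltac:(lra). have := K1 b ltac:(lra). lra.
Qed.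

(** Compactness of a segment, in the form of an induction on intervals: a property that holds for
    short intervals and can be concatenated holds for all.  The proof follows the supremum of the
    right ends that are reached. *)
Lemma interval_induction (P : R -> R -> Prop) (a b : R) : a <= b ->
  (forall x y z, x <= y <= z -> P x y -> P y z -> P x z) ->
  (forall x, a <= x <= b -> exists d, 0 < d /\
     forall u v, a <= u <= v -> v <= b -> x - d < u -> v < x + d -> P u v) ->
  P a b.
Proof.
  move=> Hab Hcat Hloc.
  pose E c := a <= c <= b /\ P a c.
  have Ea : E a.
  { split; first lra. have [d [Hd H]] := Hloc a ltac:(lra). apply: H; lra. }
  have [s [Hs1 Hs2]] : {s | is_lub E s}.
  { apply: completeness; first by exists b => c [H _]; lra. by exists a. }
  have Hsa : a <= s by apply: Hs1.
  have Hsb : s <= b by apply: Hs2 => c [H _]; lra.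
  have [d [Hd H]] := Hloc s (conj Hsa Hsb).
  have [c [[Ec1 Ec2] Hc]] : exists c, E c /\ s - d < c.
  { apply: NNPP => n. have : s <= s - d; last by lra.
    apply: Hs2 => c Ec. apply: Rnot_lt_le => K. apply: n. by exists c. }
  have Hcs : c <= s by apply: Hs1.
  pose v := Rmin b (s + d / 2).
  have Hv1 : v <= b by exact: Rmin_l.
  have Hv2 : v <= s + d / 2 by exact: Rmin_r.
  have Hv3 : s <= v by apply: Rmin_glb; lra.
  have Pv : P a v by apply: (Hcat a c v) => //; [lra|apply: H; lra].
  have Hvs : v <= s by apply: Hs1; split=> //; lra.
  have Hvb : v = b by move: Hvs; rewrite /v /Rmin; case: Rle_dec; lra.
  by rewrite -Hvb.
Qed.

(** Dominated convergence along a filter.  Continuous convergence makes the convergence uniform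
    on compact intervals, and domination controls the two ends. *)
Lemma filterlim_integral {T : Type} (F : (T -> Prop) -> Prop) {FF : Filter F} (f : T -> R -> R) (f0 : R -> R) M :
  F (fun p => continuous_pos (f p) /\ dominated M (f p)) ->
  continuous_pos f0 -> dominated M f0 ->
  (forall z0, 0 < z0 ->
     filterlim (fun q : T * R => f (fst q) (snd q)) (filter_prod F (locally z0)) (locally (f0 z0))) ->
  filterlim (fun p => integral (f p)) F (locally (integral f0)).
Proof.
  move=> HF C0 D0 Hj. have M0 := dominated_nonneg _ _ D0.
  have U : forall a b e, 0 < a <= b -> 0 < e ->
     F (fun p => forall z, a <= z <= b -> Rabs (f p z - f0 z) <= e).
  { move=> a b e [Ha Hb] He.
    apply: (interval_induction (fun u v => F (fun p => forall z, u <= z <= v -> Rabs (f p z - f0 z) <= e))) => //.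
    - move=> x y z Hxyz H1 H2. apply: filter_imp (filter_and _ _ H1 H2) => p [A B] w Hw.
      case: (Rle_dec w y) => K; [apply: A|apply: B]; lra.
    - move=> x Hx. have Hx0 : 0 < x by lra.
      have He2 : 0 < e / 2 by lra.
      have [Q1 Q2 HQ1 HQ2 HQ] := filterlim_R_eps _ _ _ (Hj x Hx0) _ He2.
      have HC := filterlim_R_eps _ _ _ (C0 x Hx0) _ He2.
      have [d Hd] := filter_and _ _ HQ2 HC.
      exists d. split; first exact: cond_pos. move=> u v Huv Hv Hu Hv2.
      apply: filter_imp HQ1 => p Hp z Hz.
      have Hb' : ball x d z by apply: Rabs_def1; rewrite /minus /plus /opp /=; lra.
      have [A B] := Hd z Hb'. have K := HQ p z Hp A. rewrite /= in K.
      have -> : f p z - f0 z = (f p z - f0 x) - (f0 z - f0 x) by ring.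
      apply: (Rle_trans _ _ _ (Rabs_triang _ _)). rewrite Rabs_Ropp. lra. }
  apply: filterlim_R => e He.
  pose a := Rmin 1 (e / (8 * (M + 1))).
  have Ha : 0 < a by apply: Rmin_pos; [lra|apply: Rdiv_lt_0_compat; lra].
  have Ha1 : a <= 1 by exact: Rmin_l.
  have HaM : a * (8 * (M + 1)) <= e by apply/Rle_div_r; [lra|exact: Rmin_r].
  have Hia : 1 <= / a by rewrite -{1}Rinv_1; apply: Rinv_le_contravar.
  have Hab : 0 < a <= / a by lra.
  have He3 : 0 < e * a / 4 by nra.
  have HU := U a (/ a) (e * a / 4) Hab He3.
  apply: filter_imp (filter_and _ _ HF HU) => p [[Cp Dp] Hp].
  have A1 := integral_approx M (f p) a (/ a) Cp Dp Hab.
  have A2 := integral_approx M f0 a (/ a) C0 D0 Hab.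
  rewrite Rinv_inv in A1 A2.
  have A3 : Rabs (RInt (f p) a (/ a) - RInt f0 a (/ a)) <= (/ a - a) * (e * a / 4).
  { have E1 := ex_RInt_pos (f p) a (/ a) Cp Ha ltac:(lra). have E2 := ex_RInt_pos f0 a (/ a) C0 Ha ltac:(lra).
    have -> : RInt (f p) a (/ a) - RInt f0 a (/ a) = RInt (fun z => f p z - f0 z) a (/ a)
      by rewrite (RInt_minus (f p) f0).
    apply: abs_RInt_le_const; [lra| |move=> t Ht; exact: Hp].
    exact: (ex_RInt_minus (f p) f0). }
  have E : (/ a - a) * (e * a / 4) <= e / 4.
  { have -> : (/ a - a) * (e * a / 4) = (1 - a * a) * (e / 4) by field; lra. nra. }
  have -> : integral (f p) - integral f0 = (integral (f p) - RInt (f p) a (/ a)) +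
    (RInt (f p) a (/ a) - RInt f0 a (/ a)) - (integral f0 - RInt f0 a (/ a)) by ring.
  apply: (Rle_lt_trans _ _ _ (Rabs_triang _ _)). rewrite Rabs_Ropp.
  have := Rabs_triang (integral (f p) - RInt (f p) a (/ a)) (RInt (f p) a (/ a) - RInt f0 a (/ a)).
  nra.
Qed.

Lemma mvt_slope (D : R -> Prop) (f f' : R -> R) (x y : R) :
  (forall u v w, D u -> D v -> u <= w <= v -> D w) ->
  (forall y, D y -> is_derive f y (f' y)) -> D x -> D y ->
  exists c, D c /\ Rabs (c - x) <= Rabs (y - x) /\ slope f (f' x) x y = f' c.
Proof.
  move=> Hc Hd Dx Dy. rewrite /slope. case: (Req_dec_T y x) => [E|n].
  { exists x. rewrite Rminus_diag Rabs_R0. split=> //. split=> //. exact: Rabs_pos. }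
  have Dw : forall w, Rmin x y <= w <= Rmax x y -> D w.
  { move=> w. rewrite /Rmin /Rmax. case: Rle_dec => K Hw; [exact: (Hc x y)|exact: (Hc y x)]. }
  have [c [Hcc E]] : exists c, Rmin x y <= c <= Rmax x y /\ f y - f x = f' c * (y - x).
  { apply: MVT_gen => w Hw.
    - apply: Hd. apply: Dw. lra.
    - apply/continuity_pt_filterlim. apply: (ex_derive_continuous f). exists (f' w). apply: Hd. exact: Dw. }
  exists c. split; first exact: Dw. split.
  - move: Hcc; rewrite /Rmin /Rmax; case: Rle_dec => K Hw.
    + rewrite !Rabs_pos_eq; lra.
    + rewrite !Rabs_left1; lra.
  - rewrite E. field. lra.
Qed.

Lemma continuous_section {T : UniformSpace} (F : T * R -> R) (p : T) (z : R) :
  continuous F (p, z) -> continuous (fun z => F (p, z)) z.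
Proof.
  move=> H P HP. have [d Hd] := H P HP. exists d => w Hw. apply: Hd. split=> //=. exact: ball_center.
Qed.

(** Differentiation under the integral sign: the difference quotients are values of the
    derivative, hence dominated. *)
Lemma is_derive_on_integral (D : R -> Prop) (f f' : R -> R -> R) (x M : R) :
  D x -> (forall u v w, D u -> D v -> u <= w <= v -> D w) ->
  (forall y z, D y -> 0 < z -> is_derive (fun y => f y z) y (f' y z)) ->
  (forall y, D y -> continuous_pos (f y) /\ exists M0, dominated M0 (f y)) ->
  locally x (fun y => D y -> dominated M (f' y)) ->
  (forall z0, 0 < z0 -> continuous (fun q : R * R => f' (fst q) (snd q)) (x, z0)) ->
  is_derive_on D (fun y => integral (f y)) x (integral (f' x)).
Proof.
  move=> Dx Hconv Hder Hf Hdom Hjoint.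
  apply/is_derive_on_caratheodory => //.
  have C' : continuous_pos (f' x).
  { move=> z Hz. exact: (continuous_section (fun q : R * R => f' (fst q) (snd q)) x z (Hjoint z Hz)). }
  have D' : dominated M (f' x) by apply: (locally_singleton _ _ Hdom).
  pose q y := integral (fun z => slope (fun y => f y z) (f' x z) x y).
  have Cs : forall y, D y -> continuous_pos (fun z => slope (fun y => f y z) (f' x z) x y).
  { move=> y Dy. rewrite /slope. case: (Req_dec_T y x) => // n z Hz.
    have [C1 _] := Hf y Dy. have [C2 _] := Hf x Dx.
    apply: (continuous_mult (K := R_AbsRing)); last exact: continuous_const.
    apply: (continuous_minus (V := R_NormedModule)); [exact: C1|exact: C2]. }
  exists q. split; [|split].
  - move=> y Dy. rewrite /q.
    have [C1 [M1 D1]] := Hf y Dy. have [C2 [M2 D2]] := Hf x Dx.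
    case: (Req_dec_T y x) => [->|n]; first by ring.
    have -> : integral (f y) = integral (fun z => f x z + (y - x) * slope (fun y => f y z) (f' x z) x y).
    { apply: integral_ext => z Hz. rewrite Rmult_comm -(slope_eq (fun y => f y z)). ring. }
    have Ds : dominated ((M1 + M2) / Rabs (y - x)) (fun z => slope (fun y => f y z) (f' x z) x y).
    { move=> z Hz. rewrite /slope. case: (Req_dec_T y x) => // _.
      have Hp : 0 < Rabs (y - x) by apply: Rabs_pos_lt; lra.
      rewrite Rabs_div; last by lra.
      have -> : (M1 + M2) / Rabs (y - x) / (1 + z ^ 2) = (M1 / (1 + z ^ 2) + M2 / (1 + z ^ 2)) / Rabs (y - x)
        by field; split; nra.
      apply: Rmult_le_compat_r; first by apply: Rlt_le; apply: Rinv_0_lt_compat.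
      apply: (Rle_trans _ _ _ (Rabs_triang _ _)). rewrite Rabs_Ropp.
      have := D1 z Hz. have := D2 z Hz. lra. }
    rewrite (integral_plus M2 (Rabs (y - x) * ((M1 + M2) / Rabs (y - x)))) //; [|move=> z Hz|exact: dominated_scal].
    + rewrite integral_scal; [ring|exact: Cs].
    + apply: (continuous_mult (K := R_AbsRing)); [exact: continuous_const|exact: Cs].
  - rewrite /q. apply: integral_ext => z Hz. rewrite /slope. by case: (Req_dec_T x x).
  - have HW : Filter (within D (locally x)) by apply: within_filter.
    apply: (filterlim_integral _ _ _ M) => //.
    + have [d Hd] := Hdom. exists d => y Hy Dy. split; first exact: Cs.
      move=> z Hz.
      have [c [Dc [Hc ->]]] := mvt_slope D (fun y => f y z) (fun y => f' y z) x y Hconv (fun y Dy => Hder y z Dy Hz) Dx Dy.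
      apply: Hd => //. apply: (Rle_lt_trans _ _ _ Hc). exact: Hy.
    + move=> z0 Hz0. apply: filterlim_R => e He.
      have [d Hd] := filterlim_R_eps _ _ _ (Hjoint z0 Hz0) e He.
      apply: (Filter_prod _ _ _ (fun y => D y /\ Rabs (y - x) < d) (fun z => 0 < z /\ Rabs (z - z0) < d)).
      * exists d => y Hy Dy. split=> //. 
      * have Hm : 0 < Rmin d z0 by apply: Rmin_pos => //; exact: cond_pos.
        exists (mkposreal _ Hm) => z Hz.
        have Hz' : Rabs (z - z0) < Rmin d z0 by exact: Hz.
        have A := Rmin_l d z0. have B := Rmin_r d z0.
        have := Rabs_def2 _ _ Hz'. split; lra.
      * move=> y z [Dy Hy] [Hz Hz'] /=.
        have [c [Dc [Hc ->]]] := mvt_slope D (fun y => f y z) (fun y => f' y z) x y Hconv (fun y Dy => Hder y z Dy Hz) Dx Dy.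
        apply: (Hd (c, z)). split=> //=. apply: (Rle_lt_trans _ _ _ Hc). exact: Hy.
Qed.

Lemma continuous2_on_integral (D : R -> R -> Prop) (f : R -> R -> R -> R) :
  (forall a b, D a b -> exists M, locally (a, b) (fun p : R * R => D (fst p) (snd p) -> dominated M (f (fst p) (snd p)))) ->
  (forall a b z, D a b -> 0 < z ->
     continuous (fun q : (R * R) * R => f (fst (fst q)) (snd (fst q)) (snd q)) ((a, b), z)) ->
  continuous2_on D (fun a b => integral (f a b)).
Proof.
  move=> Hdom Hj.
  have Cz : forall a b, D a b -> continuous_pos (f a b).
  { move=> a b Dab z Hz.
    exact: (continuous_section (fun q : (R * R) * R => f (fst (fst q)) (snd (fst q)) (snd q)) (a, b) z (Hj a b z Dab Hz)). }
  move=> [a b] Dab /=.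
  have HW : Filter (within (fun p : R * R => D (fst p) (snd p)) (locally (a, b))) by apply: within_filter.
  have [M HM] := Hdom a b Dab.
  apply: (filterlim_integral _ (fun p : R * R => f (fst p) (snd p)) (f a b) M).
  - apply: (within_imp _ _ _ _ _ HM) => [[x y]] /= Dxy H. split; [exact: Cz|exact: H].
  - exact: Cz.
  - exact: (locally_singleton _ _ HM).
  - move=> z0 Hz0 P HP. have [d Hd] := Hj a b z0 Dab Hz0 P HP.
    apply: (Filter_prod _ _ _ (ball (a, b) d) (ball z0 d)).
    + by exists d.
    + by exists d.
    + move=> p z Hp Hz. apply: (Hd (p, z)). by split.
Qed.

(** * Changes of variables, continuity, Gaussian bounds *)

Lemma integral_scale M a f : 0 < a -> continuous_pos f -> dominated M f ->
  integral (fun z => a * f (a * z)) = integral f.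
Proof.
  move=> Ha C Dm. apply: is_integral_unique => e He.
  have [d [Hd H]] := is_integral_integral M f C Dm e He.
  have Hia := Rinv_0_lt_compat _ Ha.
  have Hp : 0 < Rmin (d / a) (d * a) by apply: Rmin_pos; [apply: Rdiv_lt_0_compat|nra].
  exists (Rmin (d / a) (d * a)). split=> // x y [Hx1 Hx2] Hy.
  have L1 := Rmin_l (d / a) (d * a). have L2 := Rmin_r (d / a) (d * a).
  have Hy0 : 0 < y by have := Rinv_0_lt_compat _ Hp; lra.
  have -> : RInt (fun z => a * f (a * z)) x y = RInt f (a * x) (a * y).
  { rewrite -(RInt_comp f (fun z => a * z) (fun _ => a)) //.
    - move=> z [Hz _]. apply: C. have := Rmin_pos _ _ Hx1 Hy0. nra.
    - move=> z _. split; last exact: continuous_const. auto_derive => //. ring. }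
  apply: H.
  - split; first nra. have : x < d / a by lra. move=> /(Rmult_lt_compat_l _ _ _ Ha).
    have -> : a * (d / a) = d by field; lra. lra.
  - have K : / (d * a) <= / Rmin (d / a) (d * a) by apply: Rinv_le_contravar.
    have K2 : / (d * a) < y by lra.
    move: (Rmult_lt_compat_l _ _ _ Ha K2). have -> : a * / (d * a) = / d by field; lra. lra.
Qed.

Lemma integral_inversion M a f : 0 < a -> continuous_pos f -> dominated M f ->
  integral (fun z => a / z ^ 2 * f (a / z)) = integral f.
Proof.
  move=> Ha C Dm. apply: is_integral_unique => e He.
  have [d [Hd H]] := is_integral_integral M f C Dm e He.
  have Hia := Rinv_0_lt_compat _ Ha.
  have Hp : 0 < Rmin (d / a) (d * a) by apply: Rmin_pos; [apply: Rdiv_lt_0_compat|nra].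
  exists (Rmin (d / a) (d * a)). split=> // x y [Hx1 Hx2] Hy.
  have L1 := Rmin_l (d / a) (d * a). have L2 := Rmin_r (d / a) (d * a).
  have Hy0 : 0 < y by have := Rinv_0_lt_compat _ Hp; lra.
  have Hm := Rmin_pos _ _ Hx1 Hy0.
  have -> : RInt (fun z => a / z ^ 2 * f (a / z)) x y = RInt f (a / y) (a / x).
  { rewrite -(opp_RInt_swap f (a / x) (a / y)); last first.
    { apply: ex_RInt_pos => //; apply: Rdiv_lt_0_compat; lra. }
    rewrite -(RInt_comp f (fun z => a / z) (fun z => - (a / z ^ 2))).
    - rewrite -RInt_opp.
      + apply: RInt_ext => z [Hz _]. rewrite /opp /scal /= /mult /=. ring.
      + apply: (ex_RInt_continuous (V := R_CompleteNormedModule)) => z [Hz _].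
        have Hz0 : 0 < z by lra.
        apply: (continuous_scal (V := R_NormedModule)).
        * apply: (ex_derive_continuous (V := R_NormedModule)). auto_derive. nra.
        * apply: continuous_comp; last by apply: C; apply: Rdiv_lt_0_compat.
          apply: (ex_derive_continuous (V := R_NormedModule)). auto_derive. lra.
    - move=> z [Hz _]. apply: C. apply: Rdiv_lt_0_compat; lra.
    - move=> z [Hz _]. split; first by auto_derive; [lra|field; lra].
      apply: (ex_derive_continuous (V := R_NormedModule)). auto_derive. nra. }
  apply: H.
  - split; first by apply: Rdiv_lt_0_compat; lra.
    have K : / (d / a) <= / Rmin (d / a) (d * a) by apply: Rinv_le_contravar.
    have K2 : / (d / a) < y by lra.
    apply/Rlt_div_l => //. move: (Rmult_lt_compat_l _ _ _ Hd K2).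
    have -> : d * / (d / a) = a by field; lra. lra.
  - have Hxd : x < d * a by lra.
    apply/Rlt_div_r => //. apply: (Rmult_lt_reg_l d) => //.
    have -> : d * (/ d * x) = x by field; lra. lra.
Qed.

Lemma inv_nonneg x : 0 < x -> 0 <= / x.
Proof. move=> H. apply: Rlt_le. exact: Rinv_0_lt_compat. Qed.

Section Continuity.

Variable U : UniformSpace.

Lemma cont_plus (f g : U -> R) x : continuous f x -> continuous g x -> continuous (fun y => f y + g y) x.
Proof. exact: (continuous_plus (V := R_NormedModule)). Qed.

Lemma cont_opp (f : U -> R) x : continuous f x -> continuous (fun y => - f y) x.
Proof. exact: (continuous_opp (V := R_NormedModule)). Qed.

Lemma cont_minus (f g : U -> R) x : continuous f x -> continuous g x -> continuous (fun y => f y - g y) x.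
Proof. exact: (continuous_minus (V := R_NormedModule)). Qed.

Lemma cont_mult (f g : U -> R) x : continuous f x -> continuous g x -> continuous (fun y => f y * g y) x.
Proof. exact: (continuous_mult (K := R_AbsRing)). Qed.

Lemma cont_comp (h : R -> R) (f : U -> R) x : continuous h (f x) -> continuous f x -> continuous (fun y => h (f y)) x.
Proof. move=> H1 H2. exact: (continuous_comp f h). Qed.

Lemma cont_inv (f : U -> R) x : f x <> 0 -> continuous f x -> continuous (fun y => / f y) x.
Proof.
  move=> H1 H2. apply: (continuous_comp f Rinv) => //. exact: continuous_Rinv.
Qed.

Lemma cont_div (f g : U -> R) x : g x <> 0 -> continuous f x -> continuous g x -> continuous (fun y => f y / g y) x.
Proof. move=> H1 H2 H3. apply: cont_mult => //. exact: cont_inv. Qed.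

Lemma cont_pow (f : U -> R) n x : continuous f x -> continuous (fun y => f y ^ n) x.
Proof.
  move=> H. elim: n => [|n IH] /=; [exact: continuous_const|exact: cont_mult].
Qed.

Lemma cont_exp (f : U -> R) x : continuous f x -> continuous (fun y => exp (f y)) x.
Proof. move=> H. apply: (continuous_comp f exp) => //. exact: continuous_exp. Qed.

End Continuity.

Lemma cont_fst_comp {U V W : UniformSpace} (f : U -> V * W) x :
  continuous f x -> continuous (fun y => fst (f y)) x.
Proof. move=> H. apply: (continuous_comp f fst) => //. exact: continuous_fst. Qed.

Lemma cont_snd_comp {U V W : UniformSpace} (f : U -> V * W) x :
  continuous f x -> continuous (fun y => snd (f y)) x.
Proof. move=> H. apply: (continuous_comp f snd) => //. exact: continuous_snd. Qed.

(** Follows the syntax of an expression in several real variables; the continuity of named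
    functions of one variable and the non-vanishing of denominators remain as goals. *)
Ltac cont :=
  lazymatch goal with
  | |- filterlim ?f (locally ?x) _ => change (continuous f x); cont
  | |- continuous (fun _ => ?c) _ => apply: continuous_const
  | |- continuous (fun q => q) _ => apply: continuous_id
  | |- continuous (fun q => fst (@?f q)) _ => apply: (cont_fst_comp f); cont
  | |- continuous (fun q => snd (@?f q)) _ => apply: (cont_snd_comp f); cont
  | |- continuous (fun q => Rplus (@?f q) (@?g q)) _ => apply: (cont_plus _ f g); cont
  | |- continuous (fun q => Rminus (@?f q) (@?g q)) _ => apply: (cont_minus _ f g); cont
  | |- continuous (fun q => Rmult (@?f q) (@?g q)) _ => apply: (cont_mult _ f g); cont
  | |- continuous (fun q => Rdiv (@?f q) (@?g q)) _ => apply: (cont_div _ f g); [idtac|cont|cont]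
  | |- continuous (fun q => Rinv (@?f q)) _ => apply: (cont_inv _ f); [idtac|cont]
  | |- continuous (fun q => Ropp (@?f q)) _ => apply: (cont_opp _ f); cont
  | |- continuous (fun q => pow (@?f q) ?n) _ => apply: (cont_pow _ f n); cont
  | |- continuous (fun q => exp (@?f q)) _ => apply: (cont_exp _ f); cont
  | |- continuous (fun q => ?h (@?f q)) _ => first [apply: (cont_comp _ h f); [idtac|cont] | idtac]
  | |- _ => idtac
  end.

Lemma exp_mono x y : x <= y -> exp x <= exp y.
Proof. by case=> [H|->]; [apply: Rlt_le; exact: exp_increasing|exact: Rle_refl]. Qed.

Lemma pow_le_fact_exp n x : 0 <= x -> x ^ n <= INR (Factorial.fact n) * exp x.
Proof.
  elim: n x => [|n IH] x Hx.
  - rewrite /= Rmult_1_l. have := exp_ineq1_le x. lra.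
  - pose f y := INR (Factorial.fact (S n)) * exp y - y ^ (S n).
    have [c [Hc E]] : exists c, Rmin 0 x <= c <= Rmax 0 x /\
        f x - f 0 = (INR (Factorial.fact (S n)) * exp c - INR (S n) * c ^ n) * (x - 0).
    { apply: MVT_gen => y _.
      - rewrite /f. auto_derive => //. rewrite -/(pow y n) /=. ring.
      - apply/continuity_pt_filterlim. rewrite /f. cont. }
    rewrite Rmin_left // Rmax_right // in Hc.
    have H0 : 0 <= f 0.
    { rewrite /f exp_0 /= Rmult_0_l. have := pos_INR (Factorial.fact (S n)). rewrite /=. lra. }
    have H1 : 0 <= INR (Factorial.fact (S n)) * exp c - INR (S n) * c ^ n.
    { have -> : Factorial.fact (S n) = (S n * Factorial.fact n)%nat by []. rewrite mult_INR.
      have := IH c ltac:(lra). have := pos_INR (S n). nra. }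
    rewrite /f in E H0. nra.
Qed.

Definition gauss (z : R) : R := exp (- z ^ 2 / 2).

Lemma gauss_pos z : 0 < gauss z.
Proof. exact: exp_pos. Qed.

Lemma gauss_0 : gauss 0 = 1.
Proof. rewrite /gauss -exp_0. congr exp. field. Qed.

(** Completing the square, [gauss z <= exp (1 / 2) * exp (- z)], and the exponential dominates powers. *)
Lemma pow_gauss_le n : exists B, forall z, 0 <= z -> z ^ n * gauss z <= B.
Proof.
  exists (INR (Factorial.fact n) * exp (1 / 2)) => z Hz.
  have H : gauss z <= exp (1 / 2) * exp (- z).
  { rewrite -exp_plus. apply: exp_mono. have := pow2_ge_0 (z - 1). rewrite /= . lra. }
  have H2 := pow_le_fact_exp n z Hz.
  have H3 : exp z * exp (- z) = 1 by rewrite -exp_plus Rplus_opp_r exp_0.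
  have := exp_pos z. have := exp_pos (- z). have := exp_pos (1 / 2) => P1 P2 P3.
  have P4 := pow_le z n Hz. have P5 := gauss_pos z.
  apply: (Rle_trans _ (INR (Factorial.fact n) * exp z * (exp (1 / 2) * exp (- z)))).
  - apply: Rmult_le_compat; lra.
  - apply: Req_le. have -> : INR (Factorial.fact n) * exp z * (exp (1 / 2) * exp (- z)) =
     INR (Factorial.fact n) * exp (1 / 2) * (exp z * exp (- z)) by ring. rewrite H3. ring.
Qed.

Lemma pow_gauss_dominated n : exists B, 0 < B /\ forall z, 0 <= z -> z ^ n * gauss z <= B / (1 + z ^ 2).
Proof.
  have [B1 H1] := pow_gauss_le n. have [B2 H2] := pow_gauss_le (n + 2).
  exists (Rmax 1 (B1 + B2)). split; first by have := Rmax_l 1 (B1 + B2); lra.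
  move=> z Hz. apply: (proj1 (Rle_div_r _ _ _ _)); first nra.
  apply: Rle_trans (Rmax_r 1 _). have := H1 z Hz. have := H2 z Hz. rewrite pow_add. nra.
Qed.

Lemma is_derive_gauss z : is_derive gauss z (- z * gauss z).
Proof. rewrite /gauss. auto_derive => //. have -> : exp (- z ^ 2 * / 2) = exp (- z ^ 2 / 2) by []. field. Qed.

Lemma continuous_gauss z : continuous gauss z.
Proof. rewrite /gauss. cont. lra. Qed.

Lemma continuous_pos_gauss : continuous_pos gauss.
Proof. move=> z _. exact: continuous_gauss. Qed.

Lemma gauss_small e : 0 < e -> exists d, 0 < d /\ forall b, / d < b -> gauss b < e.
Proof.
  move=> He. have [B H] := pow_gauss_le 1.
  exists (e / (Rabs B + 1)).
  have HB := Rabs_pos B.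
  have Hp : 0 < e / (Rabs B + 1) by apply: Rdiv_lt_0_compat; lra.
  split=> // b Hb.
  have Hb0 : 0 < b by have := Rinv_0_lt_compat _ Hp; lra.
  have := H b ltac:(lra). rewrite pow_1 => K.
  apply: (Rmult_lt_reg_l b) => //. apply: (Rle_lt_trans _ _ _ K).
  move: Hb. have -> : / (e / (Rabs B + 1)) = (Rabs B + 1) / e by field; lra.
  move=> /(Rmult_lt_compat_r _ _ _ He). have -> : (Rabs B + 1) / e * e = Rabs B + 1 by field; lra.
  have := Rle_abs B. lra.
Qed.

(** Every kernel below is normalized by this constant, so that its value cancels. *)
Lemma integral_gauss_pos : 0 < integral gauss.
Proof.
  have [B [HB H]] := pow_gauss_dominated 0.
  have Dm : dominated B gauss.
  { move=> z Hz. rewrite Rabs_pos_eq; last by have := gauss_pos z; lra.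
    have := H z ltac:(lra). by rewrite /= Rmult_1_l. }
  have C := continuous_pos_gauss.
  have HL := is_lim_cutoff_integral B gauss C Dm.
  have P : 0 < RInt gauss 1 2.
  { apply: RInt_gt_0; [lra|move=> z _; exact: gauss_pos|move=> z _; exact: continuous_gauss]. }
  apply: (Rlt_le_trans _ _ _ P).
  apply: (is_lim_seq_le_loc (fun _ => RInt gauss 1 2) (cutoff_integral gauss) (RInt gauss 1 2) (integral gauss) _ (is_lim_seq_const _) HL).
  exists 1%nat => n Hn. rewrite /cutoff_integral.
  have [[A1 A2] A3] := cutoff_bounds n. have := le_INR _ _ Hn. rewrite /= => A4.
  have E : forall x y, 0 < x -> 0 < y -> ex_RInt gauss x y by move=> x y; exact: ex_RInt_pos.
  have P0 : forall x y, 0 < x <= y -> 0 <= RInt gauss x y.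
  { move=> x y Hxy. apply: RInt_ge_0; [lra|apply: E; lra|]. move=> z _. have := gauss_pos z; lra. }
  rewrite -(RInt_Chasles gauss (/ (INR n + 1)) 1 (INR n + 1)); [|apply: E; lra|apply: E; lra].
  rewrite -(RInt_Chasles gauss 1 2 (INR n + 1)); [|apply: E; lra|apply: E; lra].
  have K1 : 0 < 2 <= INR n + 1 by lra. have K2 : 0 < / (INR n + 1) <= 1 by lra.
  have := P0 _ _ K1. have := P0 _ _ K2 => L2 L1.
  change (RInt gauss 1 2 <= RInt gauss (/ (INR n + 1)) 1 + (RInt gauss 1 2 + RInt gauss 2 (INR n + 1))). lra.
Qed.

(** A smooth function with bounded derivatives, given as the sequence of these derivatives: no
    choice of derivatives is then needed in formulas. *)
Definition bounded_jet (F : nat -> R -> R) : Prop :=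
  (forall k x, is_derive (F k) x (F (S k) x)) /\
  (forall k, exists M, forall x, Rabs (F k x) <= M).

Lemma jet_continuous F k x : bounded_jet F -> continuous (F k) x.
Proof. move=> [H _]. apply: (ex_derive_continuous (F k)). exists (F (S k) x). exact: H. Qed.

Lemma jet_bound F k : bounded_jet F -> exists M, 0 < M /\ forall x, Rabs (F k x) <= M.
Proof.
  move=> [_ /(_ k) [M H]]. exists (Rabs M + 1). have := Rabs_pos M. split; first lra.
  move=> x. have := H x. have := Rle_abs M. lra.
Qed.

(** * Borel's lemma and the extension of smooth functions *)

(** The [j]-th derivative of [x ^ m * exp (- (mu * x) ^ 2)].  The Gaussian factor replaces the usual
    compactly supported cutoff of Borel's lemma.  It disturbs the Taylor coefficients of order
    above [m], but these are corrected by later terms. *)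
Fixpoint damped_monomial (j m : nat) (mu x : R) : R :=
  match j with
  | O => x ^ m * exp (- (mu * x) ^ 2)
  | S i => INR m * damped_monomial i (pred m) mu x - 2 * mu ^ 2 * damped_monomial i (S m) mu x
  end.

Lemma is_derive_damped_monomial j m mu x :
  is_derive (damped_monomial j m mu) x (damped_monomial (S j) m mu x).
Proof.
  elim: j m => [|j IH] m.
  - rewrite [damped_monomial 0 _ _]/damped_monomial /=. auto_derive => //.
    rewrite /=. ring.
  - change (is_derive (fun x => INR m * damped_monomial j (pred m) mu x - 2 * mu ^ 2 * damped_monomial j (S m) mu x) x
      (INR m * damped_monomial (S j) (pred m) mu x - 2 * mu ^ 2 * damped_monomial (S j) (S m) mu x)).
    apply: (is_derive_minus (V := R_NormedModule)); apply: is_derive_scal; exact: IH.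
Qed.

Lemma damped_monomial_zero j m mu : (j < m)%nat -> damped_monomial j m mu 0 = 0.
Proof.
  elim: j m => [|j IH] m H /=; first by rewrite pow_i //; ring.
  rewrite !IH; try lia. ring.
Qed.

Lemma damped_monomial_diag m mu : damped_monomial m m mu 0 = INR (Factorial.fact m).
Proof.
  elim: m => [|m IH].
  - rewrite /= Rmult_0_r /= Rmult_0_l Ropp_0 exp_0. ring.
  - change (INR (S m) * damped_monomial m m mu 0 - 2 * mu ^ 2 * damped_monomial m (S (S m)) mu 0 = INR (Factorial.fact (S m))).
    rewrite (damped_monomial_zero m (S (S m))); last by lia.
    rewrite IH. have -> : Factorial.fact (S m) = (S m * Factorial.fact m)%nat by []. rewrite mult_INR. ring.
Qed.

(** In the variable [mu * x] the [j]-th derivative scales like [mu ^ j / mu ^ m]; the powers of [mu]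
    are kept on both sides to avoid negative exponents. *)
Lemma damped_monomial_bound j m : exists C, 0 <= C /\ forall mu x, 0 < mu ->
  mu ^ m * Rabs (damped_monomial j m mu x) <= C * mu ^ j.
Proof.
  elim: j m => [|j IH] m.
  - have [B HB] := pow_gauss_le m. exists B. split.
    { have := HB 0 (Rle_refl 0). have := gauss_pos 0. have := pow_le 0 m (Rle_refl 0). nra. }
    move=> mu x Hmu. change (mu ^ m * Rabs (x ^ m * exp (- (mu * x) ^ 2)) <= B * 1).
    rewrite Rmult_1_r Rabs_mult -RPow_abs (Rabs_pos_eq (exp _)); last by apply: Rlt_le; exact: exp_pos.
    rewrite -Rmult_assoc -Rpow_mult_distr.
    have H := HB (mu * Rabs x) ltac:(have := Rabs_pos x; nra).
    apply: Rle_trans H. apply: Rmult_le_compat_l; first by apply: pow_le; have := Rabs_pos x; nra.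
    apply: exp_mono.
    have -> : (mu * Rabs x) ^ 2 = (mu * x) ^ 2 by rewrite !Rpow_mult_distr pow2_abs.
    have := pow2_ge_0 (mu * x). lra.
  - have [C1 [P1 H1]] := IH (pred m). have [C2 [P2 H2]] := IH (S m).
    exists (INR m * C1 + 2 * C2). split; first by have := pos_INR m; nra.
    move=> mu x Hmu. rewrite [damped_monomial _ _ _ _]/=.
    have K1 := H1 mu x Hmu. have K2 := H2 mu x Hmu.
    have Hmj := pow_lt mu j Hmu. have Hmm := pow_lt mu m Hmu. have Hm := pos_INR m.
    apply: (Rle_trans _ (mu ^ m * (INR m * Rabs (damped_monomial j (pred m) mu x) +
        2 * mu ^ 2 * Rabs (damped_monomial j (S m) mu x)))).
    { apply: Rmult_le_compat_l; first lra. apply: (Rle_trans _ _ _ (Rabs_triang _ _)).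
      rewrite Rabs_Ropp (Rabs_mult (INR m)) (Rabs_mult (2 * mu ^ 2)) (Rabs_pos_eq (INR m)) // (Rabs_pos_eq (2 * mu ^ 2)); nra. }
    have E1 : mu ^ m * (INR m * Rabs (damped_monomial j (pred m) mu x)) <= INR m * C1 * mu ^ S j.
    { case: m K1 {H1 H2 K2 Hmm Hm} => [|m] K1; first by rewrite /=; lra.
      rewrite /= in K1 |- *.
      have := pos_INR (S m). rewrite -/(INR (S m)). move=> Hm.
      have : INR (S m) * mu * (mu ^ m * Rabs (damped_monomial j m mu x)) <= INR (S m) * mu * (C1 * mu ^ j).
      { apply: Rmult_le_compat_l => //. nra. }
      lra. }
    have E2 : mu ^ m * (2 * mu ^ 2 * Rabs (damped_monomial j (S m) mu x)) <= 2 * C2 * mu ^ S j.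
    { rewrite /= in K2 |- *.
      have : 2 * mu * (mu * mu ^ m * Rabs (damped_monomial j (S m) mu x)) <= 2 * mu * (C2 * mu ^ j).
      { apply: Rmult_le_compat_l => //. nra. }
      lra. }
    rewrite Rmult_plus_distr_l. lra.
Qed.

Lemma damped_monomial_small m : exists K, 0 <= K /\ forall j mu x, (j < m)%nat -> 1 <= mu ->
  Rabs (damped_monomial j m mu x) <= K / mu.
Proof.
  have : forall n, (n <= m)%nat -> exists K, 0 <= K /\ forall j mu x, (j < n)%nat -> 1 <= mu ->
    Rabs (damped_monomial j m mu x) <= K / mu.
  { elim=> [|n IH] Hn; first by exists 0; split; [lra|move=> j mu x; lia].
    have [K [K0 HK]] := IH ltac:(lia). have [C [C0 HC]] := damped_monomial_bound n m.
    exists (K + C). split; first lra. move=> j mu x Hj Hmu.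
    have Himu : 0 < / mu by apply: Rinv_0_lt_compat; lra.
    case: (Nat.eq_dec j n) => [->|n0]; last first.
    { have := HK j mu x ltac:(lia) Hmu. rewrite /Rdiv. nra. }
    have H := HC mu x ltac:(lra).
    apply: (Rle_trans _ (C / mu)); last by rewrite /Rdiv; nra.
    apply: (proj1 (Rle_div_r _ _ _ _)); first lra.
    have Hp : 0 < mu ^ n by apply: pow_lt; lra.
    apply: (Rmult_le_reg_l (mu ^ n)) => //.
    have L : mu ^ n * mu <= mu ^ m.
    { have -> : mu ^ n * mu = mu ^ (S n) by rewrite /=; ring. apply: Rle_pow => //. }
    have := Rabs_pos (damped_monomial n m mu x). nra. }
  by move=> /(_ m (le_n m)).
Qed.

Section Borel.

Variable a : nat -> R.

Definition small_const (m : nat) : R := proj1_sig (constructive_indefinite_description _ (damped_monomial_small m)).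

(** The [m]-th term corrects the [m]-th Taylor coefficient and leaves the previous ones alone.  Its
    damping is chosen so that its derivatives of order below [m] are at most [2 ^ (- m)]. *)
Fixpoint borel_sum (n : nat) : nat -> R -> R :=
  match n with
  | O => fun _ _ => 0
  | S m => fun j x =>
      let b := (a m - borel_sum m m 0) / INR (Factorial.fact m) in
      borel_sum m j x + b * damped_monomial j m (1 + Rabs b * small_const m * 2 ^ m) x
  end.

Definition borel_limit (j : nat) (x : R) : R := real (Lim_seq (fun n => borel_sum n j x)).

Lemma borel_sum_derive n j x : is_derive (borel_sum n j) x (borel_sum n (S j) x).
Proof.
  elim: n => [|n IH] /=; first exact: is_derive_const.
  apply: (is_derive_plus (V := R_NormedModule)) => //. apply: is_derive_scal. exact: is_derive_damped_monomial.
Qed.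

Lemma borel_sum_step n j x : (j < n)%nat -> Rabs (borel_sum (S n) j x - borel_sum n j x) <= (/ 2) ^ n.
Proof.
  move=> H /=. set b := (_ / _).
  have -> : forall u v : R, u + v - u = v by move=> u v; ring.
  rewrite /small_const. case: constructive_indefinite_description => K [K0 HK] /=.
  have Hb := Rabs_pos b. have H2 : 0 < 2 ^ n by apply: pow_lt; lra.
  have Hmu : 0 <= Rabs b * K * 2 ^ n by apply: Rmult_le_pos; [nra|lra].
  rewrite Rabs_mult. have := HK j (1 + Rabs b * K * 2 ^ n) x H ltac:(lra) => L.
  apply: (Rle_trans _ (Rabs b * (K / (1 + Rabs b * K * 2 ^ n)))); first exact: Rmult_le_compat_l.
  rewrite pow_inv. 
  apply: (Rmult_le_reg_r (2 ^ n)) => //. rewrite Rinv_l; last lra.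
  have -> : Rabs b * (K / (1 + Rabs b * K * 2 ^ n)) * 2 ^ n = (Rabs b * K * 2 ^ n) / (1 + Rabs b * K * 2 ^ n)
    by field; lra.
  apply: (proj2 (Rle_div_l _ _ _ _)); lra.
Qed.

Lemma borel_sum_cauchy n p j x : (j < n)%nat -> Rabs (borel_sum (n + p) j x - borel_sum n j x) <= 2 * (/ 2) ^ n.
Proof.
  move=> H. have Hn : 0 < (/ 2) ^ n by apply: pow_lt; lra.
  suff : Rabs (borel_sum (n + p) j x - borel_sum n j x) <= 2 * (/ 2) ^ n - 2 * (/ 2) ^ (n + p).
  { have : 0 < (/ 2) ^ (n + p) by apply: pow_lt; lra. lra. }
  elim: p => [|p IH]; first by rewrite Nat.add_0_r Rminus_diag Rabs_R0; lra.
  rewrite Nat.add_succ_r.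
  have -> : borel_sum (S (n + p)) j x - borel_sum n j x =
     (borel_sum (S (n + p)) j x - borel_sum (n + p) j x) + (borel_sum (n + p) j x - borel_sum n j x) by ring.
  apply: (Rle_trans _ _ _ (Rabs_triang _ _)).
  have := borel_sum_step (n + p) j x ltac:(lia).
  have -> : (/ 2) ^ S (n + p) = / 2 * (/ 2) ^ (n + p) by []. lra.
Qed.

Lemma pow_half_small e : 0 < e -> exists N, forall n, (N <= n)%nat -> 2 * (/ 2) ^ n < e.
Proof.
  move=> He. have [N HN] := pow_lt_1_zero (/ 2) ltac:(rewrite Rabs_pos_eq; lra) (e / 2) ltac:(lra).
  exists N => n Hn. have := HN n Hn. rewrite Rabs_pos_eq; first lra. apply: pow_le; lra.
Qed.

Lemma borel_sum_lim j x : is_lim_seq (fun n => borel_sum n j x) (borel_limit j x).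
Proof.
  have [l Hl] : ex_finite_lim_seq (fun n => borel_sum n j x).
  { apply/ex_lim_seq_cauchy_corr => eps.
    have [N HN] := pow_half_small (eps / 2) ltac:(have := cond_pos eps; lra).
    exists (S (N + j)) => n m Hn Hm.
    have H := HN (S (N + j)) ltac:(lia).
    have aux : forall k, (S (N + j) <= k)%nat -> Rabs (borel_sum k j x - borel_sum (S (N + j)) j x) < eps / 2.
    { move=> k Hk. have -> : k = (S (N + j) + (k - S (N + j)))%nat by lia.
      apply: Rle_lt_trans H. apply: borel_sum_cauchy. lia. }
    have -> : borel_sum n j x - borel_sum m j x = (borel_sum n j x - borel_sum (S (N + j)) j x) -
      (borel_sum m j x - borel_sum (S (N + j)) j x) by ring.
    apply: (Rle_lt_trans _ _ _ (Rabs_triang _ _)). rewrite Rabs_Ropp.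
    have := aux n Hn. have := aux m Hm. lra. }
  rewrite /borel_limit (is_lim_seq_unique _ _ Hl). exact: Hl.
Qed.

Lemma borel_limit_approx n j x : (j < n)%nat -> Rabs (borel_limit j x - borel_sum n j x) <= 2 * (/ 2) ^ n.
Proof.
  move=> H.
  have HL : is_lim_seq (fun m => Rabs (borel_sum m j x - borel_sum n j x)) (Rabs (borel_limit j x - borel_sum n j x)).
  { apply: (is_lim_seq_abs _ (Finite (borel_limit j x - borel_sum n j x))).
    apply: is_lim_seq_minus'; [exact: borel_sum_lim|exact: is_lim_seq_const]. }
  have K := is_lim_seq_le_loc _ (fun _ => 2 * (/ 2) ^ n) _ (2 * (/ 2) ^ n) _ HL (is_lim_seq_const _).
  apply: K. exists n => m Hm. have -> : m = (n + (m - n))%nat by lia. exact: borel_sum_cauchy.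
Qed.

Lemma borel_limit_CVU j c (r : posreal) : CVU (fun n => borel_sum (S j + n) j) (borel_limit j) c r.
Proof.
  move=> e He. have [N HN] := pow_half_small e He. exists N => n y Hn _.
  apply: (Rle_lt_trans _ _ _ (borel_limit_approx (S j + n) j y _)); first lia.
  apply: HN. lia.
Qed.

Lemma borel_limit_derive j x : is_derive (borel_limit j) x (borel_limit (S j) x).
Proof.
  apply/is_derive_Reals.
  apply: (CVU_derivable (fun n => borel_sum (S (S j) + n) j) (fun n => borel_sum (S (S j) + n) (S j)) _ _ x (mkposreal 1 Rlt_0_1)).
  - exact: borel_limit_CVU.
  - move=> y _. apply/is_lim_seq_Reals.
    have := proj1 (is_lim_seq_incr_n (fun n => borel_sum n j y) (S (S j)) _) (borel_sum_lim j y).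
    apply: is_lim_seq_ext => n. by rewrite Nat.add_comm.
  - move=> n y _. apply/is_derive_Reals. exact: borel_sum_derive.
  - rewrite /Boule Rminus_diag Rabs_R0. exact: Rlt_0_1.
Qed.

Lemma borel_sum_bounded n j : exists M, forall x, Rabs (borel_sum n j x) <= M.
Proof.
  elim: n => [|n [M IH]]; first by exists 0 => x /=; rewrite Rabs_R0; lra.
  rewrite /=. set b := (_ / _). set mu := (1 + _).
  have Hmu : 0 < mu.
  { rewrite /mu /small_const. case: constructive_indefinite_description => K [K0 _] /=.
    have := Rabs_pos b. have : 0 < 2 ^ n by apply: pow_lt; lra. 
    move=> A B. have : 0 <= Rabs b * K * 2 ^ n by apply: Rmult_le_pos; [nra|lra]. lra. }
  have [C [C0 HC]] := damped_monomial_bound j n.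
  exists (M + Rabs b * (C * mu ^ j / mu ^ n)) => x.
  apply: (Rle_trans _ _ _ (Rabs_triang _ _)). apply: Rplus_le_compat; first exact: IH.
  rewrite Rabs_mult. apply: Rmult_le_compat_l; first exact: Rabs_pos.
  apply: (proj1 (Rle_div_r _ _ _ _)); first exact: pow_lt. rewrite Rmult_comm. exact: HC.
Qed.

Lemma borel_sum_taylor n j : (j < n)%nat -> borel_sum n j 0 = a j.
Proof.
  elim: n => [|n IH] H; first lia.
  rewrite /=. set mu := (1 + _).
  case: (Nat.eq_dec j n) => [->|n0].
  - rewrite damped_monomial_diag. field. apply: not_0_INR. exact: Factorial.fact_neq_0.
  - rewrite damped_monomial_zero; last lia. rewrite IH; last lia. ring.
Qed.

(** Borel's lemma.  For each order of differentiation the series converges uniformly, and at [0] the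
    coefficient of order [k] does not change after the [k]-th term. *)
Lemma borel : exists F, bounded_jet F /\ forall k, F k 0 = a k.
Proof.
  exists borel_limit. split; [split|].
  - move=> k x. exact: borel_limit_derive.
  - move=> k. have [M HM] := borel_sum_bounded (S k) k. exists (M + 2 * (/ 2) ^ (S k)) => x.
    have H1 := borel_limit_approx (S k) k x ltac:(lia). have H2 := HM x.
    have -> : borel_limit k x = borel_sum (S k) k x + (borel_limit k x - borel_sum (S k) k x) by ring.
    apply: (Rle_trans _ _ _ (Rabs_triang _ _)). lra.
  - move=> k.
    have H : is_lim_seq (fun n => borel_sum (n + S k) k 0) (a k).
    { apply: (is_lim_seq_ext (fun _ => a k)); last exact: is_lim_seq_const.
      move=> n. rewrite borel_sum_taylor //. lia. }
    have H' := proj1 (is_lim_seq_incr_n (fun n => borel_sum n k 0) (S k) _) (borel_sum_lim k 0).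
    have := is_lim_seq_unique _ _ H. rewrite (is_lim_seq_unique _ _ H'). by case.
Qed.

End Borel.

Lemma non_isolated_half_line x : half_line x -> non_isolated half_line x.
Proof.
  rewrite /half_line => Hx d Hd. exists (x + d / 2). rewrite /half_line.
  have -> : x + d / 2 - x = d / 2 by ring. rewrite Rabs_pos_eq; lra.
Qed.

Lemma smooth_on_half_line_derive f k x : smooth_on half_line f -> half_line x ->
  is_derive_on half_line (Derive_n_on half_line f k) x (Derive_n_on half_line f (S k) x).
Proof. move=> H Hx. apply: Derive_on_correct => //; [exact: non_isolated_half_line|exact: H]. Qed.

Lemma is_derive_piecewise (g h : R -> R) (l : R) :
  is_derive_on half_line g 0 l -> is_derive h 0 l -> g 0 = h 0 ->
  is_derive (fun x => if Rle_dec 0 x then g x else h x) 0 l.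
Proof.
  move=> Hg Hh E. have H0 : half_line 0 by apply: Rle_refl.
  pose T (x : R) := True.
  apply: (is_derive_of_is_derive_on T); first by exists (mkposreal 1 Rlt_0_1).
  have Hh' : is_derive_on T h 0 l by apply: is_derive_on_of_is_derive.
  move: Hg Hh' => /(is_derive_on_caratheodory half_line _ _ _ H0) [q1 [H1 [E1 L1]]].
  move=> /(is_derive_on_caratheodory T _ _ _ I) [q2 [H2 [E2 L2]]].
  apply/(is_derive_on_caratheodory T _ _ _ I).
  exists (fun x => if Rle_dec 0 x then q1 x else q2 x). split; [|split].
  - move=> y _. case: (Rle_dec 0 0) => [_|n]; last lra.
    case: (Rle_dec 0 y) => Hy; first exact: H1. rewrite E. exact: H2.
  - by case: (Rle_dec 0 0).
  - have HW : Filter (within T (locally 0)) by apply: within_filter.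
    apply: filterlim_R => e He.
    have A := filterlim_R_eps _ _ _ L1 e He. have B := filterlim_R_eps _ _ _ L2 e He.
    rewrite /within in A B |- *. apply: filter_imp (filter_and _ _ A B) => x [A' B'] _.
    case: (Rle_dec 0 x) => Hx; [exact: A'|exact: B'].
Qed.

(** The gluing at [0] serves twice: to extend [phi] by a Borel function, and to extend flat boundary
    data by [0] to negative times. *)
Lemma bounded_jet_piecewise (g B : nat -> R -> R) :
  (forall k x, 0 <= x -> is_derive_on half_line (g k) x (g (S k) x)) ->
  (forall k, exists M, forall x, 0 <= x -> Rabs (g k x) <= M) ->
  bounded_jet B -> (forall k, g k 0 = B k 0) ->
  bounded_jet (fun k x => if Rle_dec 0 x then g k x else B k x).
Proof.
  move=> Hg Mg [HB MB] E. split.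
  - move=> k x. case: (Rtotal_order x 0) => [Hx|[->|Hx]].
    + apply: (is_derive_ext_loc (B k)).
      { exists (mkposreal (- x) ltac:(lra)) => y Hy. have {}Hy := ball_R _ _ _ Hy. rewrite /= in Hy. case: (Rle_dec 0 y) => // Hy'. lra. }
      case: (Rle_dec 0 x) => [Hx'|_]; first lra. exact: HB.
    + case: (Rle_dec 0 0) => [_|n]; last lra.
      apply: is_derive_piecewise => //; [apply: Hg; lra|rewrite E; exact: HB].
    + apply: (is_derive_ext_loc (g k)).
      { exists (mkposreal x Hx) => y Hy. have {}Hy := ball_R _ _ _ Hy. rewrite /= in Hy. case: (Rle_dec 0 y) => // Hy'. lra. }
      case: (Rle_dec 0 x) => [_|Hx']; last lra.
      apply: (is_derive_of_is_derive_on half_line); [exact: locally_half_line|apply: Hg; lra].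
  - move=> k. have [M1 H1] := Mg k. have [M2 H2] := MB k. exists (Rmax M1 M2) => x.
    case: (Rle_dec 0 x) => Hx.
    + apply: (Rle_trans _ M1); [exact: H1|exact: Rmax_l].
    + apply: (Rle_trans _ M2); [exact: H2|exact: Rmax_r].
Qed.

Lemma Derive_n_on_vanishes f k x : 0 < x ->
  locally x (fun y => half_line y -> f y = 0) ->
  locally x (fun y => half_line y -> Derive_n_on half_line f k y = 0).
Proof.
  move=> Hx H. elim: k => [|k IH] //=.
  have HH : locally x (fun y => locally y (fun w => half_line w -> Derive_n_on half_line f k w = 0) /\ half_line y).
  { apply: filter_and; [exact: locally_locally|exact: locally_half_line]. }
  apply: filter_imp HH => y [Hy Hy0] _.
  apply: Derive_on_eq => //; first exact: non_isolated_half_line.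
  apply: (is_derive_on_local half_line half_line (fun _ => 0)) => //.
  - apply: filter_imp Hy => w Hw Hw'. split=> //. exact: Hw.
  - apply: is_derive_on_of_is_derive => //. exact: is_derive_const.
Qed.

(** Outside the support all derivatives vanish; on the unit interval they are continuous. *)
Lemma Derive_n_on_bounded f k : smooth_on half_line f -> (forall x, support f x -> 0 <= x < 1) ->
  exists M, forall x, 0 <= x -> Rabs (Derive_n_on half_line f k x) <= M.
Proof.
  move=> Sf Hs. set g := Derive_n_on half_line f k.
  have Z : forall x, 1 <= x -> g x = 0.
  { move=> x Hx. have Hx0 : half_line x by rewrite /half_line; lra.
    have Hl : locally x (fun y => half_line y -> f y = 0).
    { apply: NNPP => n. have := Hs x (conj Hx0 n). lra. }
    have Hx1 : 0 < x by lra.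
    exact: (locally_singleton _ _ (Derive_n_on_vanishes f k x Hx1 Hl) Hx0). }
  have [M HM] : exists M, forall x, 0 <= x <= 1 -> Rabs (g x) <= M.
  { apply: (interval_induction (fun u v => exists M, forall x, u <= x <= v -> Rabs (g x) <= M)); first lra.
    - move=> x y z Hxyz [M1 H1] [M2 H2]. exists (Rmax M1 M2) => w Hw.
      case: (Rle_dec w y) => K.
      + apply: (Rle_trans _ M1); [apply: H1; lra|exact: Rmax_l].
      + apply: (Rle_trans _ M2); [apply: H2; lra|exact: Rmax_r].
    - move=> x Hx. have Hx0 : half_line x by case: Hx.
      have C := is_derive_on_continuous _ _ _ _ Hx0 (smooth_on_half_line_derive f k x Sf Hx0).
      have [d Hd] := filterlim_R_eps _ _ _ C 1 Rlt_0_1.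
      exists d. split; first exact: cond_pos. move=> u v Huv Hv Hu Hv'.
      exists (Rabs (g x) + 1) => w Hw.
      have Hb : ball x d w by apply: Rabs_def1; rewrite /minus /plus /opp /=; lra.
      have := Hd w Hb ltac:(rewrite /half_line; lra). rewrite -/g => K.
      have -> : g w = g x + (g w - g x) by ring.
      apply: (Rle_trans _ _ _ (Rabs_triang _ _)). lra. }
  exists (Rmax M 0) => x Hx. case: (Rle_dec x 1) => K.
  - apply: (Rle_trans _ M); [apply: HM; lra|exact: Rmax_l].
  - rewrite Z; last lra. rewrite Rabs_R0. exact: Rmax_r.
Qed.

Lemma smooth_extension f : smooth_on half_line f -> (forall x, support f x -> 0 <= x < 1) ->
  exists F, bounded_jet F /\ forall k x, 0 <= x -> F k x = Derive_n_on half_line f k x.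
Proof.
  move=> Sf Hs. have [B [HB EB]] := borel (fun k => Derive_n_on half_line f k 0).
  exists (fun k x => if Rle_dec 0 x then Derive_n_on half_line f k x else B k x). split.
  - apply: bounded_jet_piecewise => //.
    + move=> k x Hx. exact: smooth_on_half_line_derive.
    + move=> k. exact: Derive_n_on_bounded.
  - move=> k x Hx. by case: (Rle_dec 0 x).
Qed.

(** * The solution on the line with smooth initial data *)

(** Sets relative to which derivatives and continuity are the usual ones. *)
Definition whole (x : R) : Prop := True.
Definition plane (x y : R) : Prop := True.

Lemma is_derive_of_whole f x l : is_derive_on whole f x l -> is_derive f x l.
Proof. apply: is_derive_of_is_derive_on. by exists (mkposreal 1 Rlt_0_1). Qed.

Lemma locally_true {T : UniformSpace} (x : T) (P : T -> Prop) : (forall y, P y) -> locally x P.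
Proof. move=> H. by exists (mkposreal 1 Rlt_0_1). Qed.

(** With [a = 0] and both signs of [tau], the mean of [f (x + tau * Z)] for a normal variable [Z], up
    to normalization.  The powers of [z] come from differentiation in [tau]. *)
Definition moment_integrand (f : R -> R) (a : nat) (tau x z : R) : R := z ^ a * gauss z * f (x + tau * z).

Definition moment (f : R -> R) (a : nat) (tau x : R) : R := integral (moment_integrand f a tau x).

Section Moments.

Variable F : nat -> R -> R.
Hypothesis HF : bounded_jet F.

Lemma moment_dominated a k : exists M, 0 < M /\ forall tau x, dominated M (moment_integrand (F k) a tau x).
Proof.
  have [M [HM H]] := jet_bound F k HF. have [B [HB H']] := pow_gauss_dominated a.
  exists (M * B). split; first nra. move=> tau x z Hz. rewrite /moment_integrand.
  have P : 0 <= z ^ a * gauss z.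
  { apply: Rmult_le_pos; [apply: pow_le; lra|apply: Rlt_le; exact: gauss_pos]. }
  rewrite Rabs_mult (Rabs_pos_eq _ P).
  have -> : M * B / (1 + z ^ 2) = B / (1 + z ^ 2) * M by field; nra.
  apply: Rmult_le_compat => //; [exact: Rabs_pos|apply: H'; lra].
Qed.

Lemma continuous_moment_integrand a k p (z : R) :
  continuous (fun q : (R * R) * R => moment_integrand (F k) a (fst (fst q)) (snd (fst q)) (snd q)) (p, z).
Proof.
  rewrite /moment_integrand. cont; [exact: continuous_gauss|exact: jet_continuous].
Qed.

Lemma continuous_pos_moment_integrand a k tau x : continuous_pos (moment_integrand (F k) a tau x).
Proof. move=> z _. rewrite /moment_integrand. cont; [exact: continuous_gauss|exact: jet_continuous]. Qed.

Lemma continuous_moment a k p : continuous (fun q : R * R => moment (F k) a (fst q) (snd q)) p.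
Proof.
  have [M [_ HM]] := moment_dominated a k. case: p => tau x.
  have H := continuous2_on_integral plane (moment_integrand (F k) a).
  move=> P HP. have := H _ _ (tau, x) I P HP. rewrite /filtermap /within.
  move=> H'. apply: filter_imp (H' _ _) => //.
  - by move=> y Hy; apply: Hy.
  - move=> u v _. exists M. apply: locally_true => y _. exact: HM.
  - move=> u v z _ _. exact: continuous_moment_integrand.
Qed.

Lemma is_derive_moment_x a k tau x : is_derive (moment (F k) a tau) x (moment (F (S k)) a tau x).
Proof.
  apply: is_derive_of_whole.
  have [M [_ HM]] := moment_dominated a (S k). have [M0 [_ HM0]] := moment_dominated a k.
  apply: (is_derive_on_integral whole (moment_integrand (F k) a tau) (moment_integrand (F (S k)) a tau) x M) => //.
  - move=> y z _ _. rewrite /moment_integrand. apply: is_derive_scal.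
    have -> : F (S k) (y + tau * z) = scal 1 (F (S k) (y + tau * z)) by rewrite /scal /= /mult /= Rmult_1_l.
    apply: (is_derive_comp (F k) (fun y => y + tau * z)); first by apply: (proj1 HF).
    auto_derive => //.
  - move=> y _. split; [exact: continuous_pos_moment_integrand|by exists M0; exact: HM0].
  - apply: locally_true => y _. exact: HM.
  - move=> z0 _. rewrite /moment_integrand. cont; [exact: continuous_gauss|exact: jet_continuous].
Qed.

Lemma is_derive_moment_tau a k tau x : is_derive (fun t => moment (F k) a t x) tau (moment (F (S k)) (S a) tau x).
Proof.
  apply: is_derive_of_whole.
  have [M [_ HM]] := moment_dominated (S a) (S k). have [M0 [_ HM0]] := moment_dominated a k.
  apply: (is_derive_on_integral whole (fun t => moment_integrand (F k) a t x) (fun t => moment_integrand (F (S k)) (S a) t x) tau M) => //.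
  - move=> t z _ _. rewrite /moment_integrand.
    have -> : z ^ S a * gauss z * F (S k) (x + t * z) = z ^ a * gauss z * scal z (F (S k) (x + t * z))
      by rewrite /scal /= /mult /=; ring.
    apply: is_derive_scal. apply: (is_derive_comp (F k) (fun t => x + t * z)); first by apply: (proj1 HF).
    auto_derive => //. ring.
  - move=> y _. split; [exact: continuous_pos_moment_integrand|by exists M0; exact: HM0].
  - apply: locally_true => y _. exact: HM.
  - move=> z0 _. rewrite /moment_integrand. cont; [exact: continuous_gauss|exact: jet_continuous].
Qed.

(** The factor [z * gauss z] is an exact derivative.  This trades one differentiation in [tau] for
    one in [x] and a factor [tau], which is how the heat equation arises. *)
Lemma moment_by_parts k tau x : moment (F k) 1 tau x = F k x + tau * moment (F (S k)) 0 tau x.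
Proof.
  have [M1 [_ H1]] := moment_dominated 1 k. have [M0 [_ H0]] := moment_dominated 0 (S k).
  have E : integral (fun z => 1 * moment_integrand (F k) 1 tau x z + - tau * moment_integrand (F (S k)) 0 tau x z) = 0 - - F k x.
  { apply: (integral_derive (fun z => - (gauss z * F k (x + tau * z)))).
    - move=> z _. rewrite /moment_integrand.
      have D : is_derive (fun z => gauss z * F k (x + tau * z)) z
         (- z * gauss z * F k (x + tau * z) + gauss z * (tau * F (S k) (x + tau * z))).
      { apply: (is_derive_mult gauss (fun z => F k (x + tau * z)) z); [exact: is_derive_gauss| |by move=> n m; exact: Rmult_comm].
        apply: (is_derive_comp (F k) (fun z => x + tau * z)); first by apply: (proj1 HF).
        auto_derive => //. ring. }
      have := is_derive_opp _ _ _ D. rewrite /opp /=.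
      have -> : - (- z * gauss z * F k (x + tau * z) + gauss z * (tau * F (S k) (x + tau * z))) =
        1 * (z * 1 * gauss z * F k (x + tau * z)) + - tau * (1 * gauss z * F (S k) (x + tau * z)) by ring. by [].
    - move=> z Hz. cont; exact: continuous_pos_moment_integrand.
    - move=> e He.
      have C : continuous (fun z => - (gauss z * F k (x + tau * z))) 0.
      { cont; [exact: continuous_gauss|exact: jet_continuous]. }
      have [d Hd] := filterlim_R_eps _ _ _ C e He.
      exists d. split; first exact: cond_pos. move=> a Ha.
      have := Hd a ltac:(by apply: Rabs_def1; rewrite /minus /plus /opp /=; lra).
      rewrite gauss_0. by rewrite Rmult_0_r Rplus_0_r Rmult_1_l.
    - move=> e He. have [M [HM HB]] := jet_bound F k HF.
      have [d [Hd K]] := gauss_small (e / M) ltac:(exact: Rdiv_lt_0_compat).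
      exists d. split=> // b Hb. rewrite Rminus_0_r Rabs_Ropp Rabs_mult Rabs_pos_eq; last by apply: Rlt_le; exact: gauss_pos.
      have G := K b Hb. have P := gauss_pos b. have Q := HB (x + tau * b).
      apply: (Rle_lt_trans _ (gauss b * M)); first by apply: Rmult_le_compat_l; lra.
      move: (Rmult_lt_compat_r _ _ _ HM G). have -> : e / M * M = e by field; lra. by []. }
  have C := continuous_pos_moment_integrand.
  rewrite (integral_lincomb 1 (- tau) M1 M0 _ _ (C _ _ _ _) (C _ _ _ _) (H1 _ _) (H0 _ _)) in E.
  rewrite /moment. lra.
Qed.

Lemma moment_zero k x : moment (F k) 0 0 x = integral gauss * F k x.
Proof.
  rewrite /moment Rmult_comm -integral_scal; last exact: continuous_pos_gauss.
  apply: integral_ext => z _. rewrite /moment_integrand Rmult_0_l Rplus_0_r /=. ring.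
Qed.

(** The mean of [F k (x + Z)] for a centred normal variable [Z] of variance [2 * t], that is, the heat
    evolution of [F k]. *)
Definition line_solution (k : nat) (t x : R) : R :=
  / (2 * integral gauss) * (moment (F k) 0 (sqrt (2 * t)) x + moment (F k) 0 (- sqrt (2 * t)) x).

Lemma line_solution_initial k x : line_solution k 0 x = F k x.
Proof.
  rewrite /line_solution Rmult_0_r sqrt_0 Ropp_0 moment_zero. field. have := integral_gauss_pos. lra.
Qed.

Lemma continuous_line_solution k p : continuous (fun q : R * R => line_solution k (fst q) (snd q)) p.
Proof.
  rewrite /line_solution. apply: cont_mult; first exact: continuous_const.
  apply: cont_plus.
  - apply: (continuous_comp_2 (fun q : R * R => sqrt (2 * fst q)) snd (moment (F k) 0)); last exact: continuous_moment.
    + cont. exact: continuous_sqrt.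
    + exact: continuous_snd.
  - apply: (continuous_comp_2 (fun q : R * R => - sqrt (2 * fst q)) snd (moment (F k) 0)); last exact: continuous_moment.
    + cont. exact: continuous_sqrt.
    + exact: continuous_snd.
Qed.

Lemma is_derive_line_solution_x k t x : is_derive (line_solution k t) x (line_solution (S k) t x).
Proof.
  apply: is_derive_scal. apply: (is_derive_plus (V := R_NormedModule)); exact: is_derive_moment_x.
Qed.

(** The boundary terms of the two integrations by parts cancel, and so does the factor
    [sqrt (2 * t)] with the derivative of [sqrt (2 * t)]. *)
Lemma is_derive_line_solution_t k t x : 0 < t ->
  is_derive (fun t => line_solution k t x) t (line_solution (S (S k)) t x).
Proof.
  move=> Ht. have Hs : 0 < sqrt (2 * t) by apply: sqrt_lt_R0; lra.
  have D : is_derive (fun t => sqrt (2 * t)) t (/ sqrt (2 * t)).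
  { auto_derive; first lra. field. lra. }
  have E : line_solution (S (S k)) t x = / (2 * integral gauss) *
    (/ sqrt (2 * t) * moment (F (S k)) 1 (sqrt (2 * t)) x + - / sqrt (2 * t) * moment (F (S k)) 1 (- sqrt (2 * t)) x).
  { rewrite /line_solution !moment_by_parts. field. have := integral_gauss_pos. lra. }
  rewrite E. apply: is_derive_scal. apply: (is_derive_plus (V := R_NormedModule)).
  - apply: (is_derive_comp (fun s => moment (F k) 0 s x) (fun t => sqrt (2 * t))) => //. exact: is_derive_moment_tau.
  - apply: (is_derive_comp (fun s => moment (F k) 0 s x) (fun t => - sqrt (2 * t))); first exact: is_derive_moment_tau.
    exact: (is_derive_opp (V := R_NormedModule)).
Qed.

Lemma is_derive_on_line_solution_t k t x : 0 <= t ->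
  is_derive_on half_line (fun t => line_solution k t x) t (line_solution (S (S k)) t x).
Proof.
  have C : forall j t, filterlim (fun t => line_solution j t x) (within half_line (locally t)) (locally (line_solution j t x)).
  { move=> j s. apply: filterlim_within.
    apply: (continuous_comp_2 (fun t => t) (fun _ => x) (line_solution j) s).
    - exact: continuous_id.
    - exact: continuous_const.
    - exact: continuous_line_solution. }
  move=> [Ht|<-].
  - apply: is_derive_on_of_is_derive; [exact: Rlt_le|exact: is_derive_line_solution_t].
  - apply: (is_derive_on_half_line_zero (fun t => line_solution k t x) (fun t => line_solution (S (S k)) t x)) => //.
    move=> c Hc. exact: is_derive_line_solution_t.
Qed.

Lemma Ck_line_solution k n : Ck quarter n (line_solution k).
Proof.
  elim: n k => [|n IH] k; (split; first by move=> p _; apply: filterlim_within; exact: continuous_line_solution) => //.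
  exists (line_solution (S (S k))), (line_solution (S k)). split; last by split; exact: IH.
  move=> a b [Ha Hb]. split.
  - apply: (is_derive_on_local _ half_line (fun a => line_solution k a b)) => //; last exact: is_derive_on_line_solution_t.
    apply: locally_true => y [Hy _]. by split.
  - apply: is_derive_on_of_is_derive => //. exact: is_derive_line_solution_x.
Qed.

Lemma line_solution_bounded k : exists M, forall t x, Rabs (line_solution k t x) <= M.
Proof.
  have [M [HM H]] := moment_dominated 0 k.
  have P := integral_gauss_pos.
  exists (/ (2 * integral gauss) * (4 * M)) => t x. rewrite /line_solution Rabs_mult Rabs_pos_eq; last first.
  { apply: inv_nonneg. lra. }
  apply: Rmult_le_compat_l; first by apply: inv_nonneg; lra.
  apply: (Rle_trans _ _ _ (Rabs_triang _ _)).
  have B : forall tau, Rabs (moment (F k) 0 tau x) <= 2 * M.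
  { move=> tau. apply: integral_bound; [exact: continuous_pos_moment_integrand|exact: H]. }
  have := B (sqrt (2 * t)). have := B (- sqrt (2 * t)). lra.
Qed.

End Moments.

(** * The solution with flat boundary data and zero initial data *)

Section BoundaryPotentials.

Variable H : nat -> R -> R.
Hypothesis HH : bounded_jet H.
Hypothesis H_past : forall k t, t <= 0 -> H k t = 0.

(** The heat potential of the double layer [H k] on the side [x = 0], after the substitution that
    makes its kernel Gaussian, and that of the single layer, in the variable for which its
    integrand stays bounded as [x] tends to [0].  They are exchanged by [z = x / p]. *)
Definition dirichlet_integrand (k : nat) (t x z : R) : R := gauss z * H k (t - x ^ 2 / (2 * z ^ 2)).
Definition neumann_integrand (k : nat) (t x p : R) : R := gauss (x / p) * H k (t - p ^ 2 / 2).

Definition dirichlet (k : nat) (t x : R) : R := / integral gauss * integral (dirichlet_integrand k t x).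
Definition neumann (k : nat) (t x : R) : R := / integral gauss * integral (neumann_integrand k t x).

Lemma gauss_le_one z : gauss z <= 1.
Proof. rewrite /gauss -exp_0. apply: exp_mono. have := pow2_ge_0 z. lra. Qed.

Lemma dirichlet_dominated k : exists M, 0 < M /\ forall t x, dominated M (dirichlet_integrand k t x).
Proof.
  have [M [HM HB]] := jet_bound H k HH. have [B [HB0 H']] := pow_gauss_dominated 0.
  exists (M * B). split; first nra. move=> t x z Hz. rewrite /dirichlet_integrand.
  have P := gauss_pos z.
  rewrite Rabs_mult (Rabs_pos_eq (gauss z)); last lra.
  have -> : M * B / (1 + z ^ 2) = B / (1 + z ^ 2) * M by field; nra.
  apply: Rmult_le_compat => //; [lra|exact: Rabs_pos|].
  have := H' z ltac:(lra). by rewrite /= Rmult_1_l.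
Qed.

Lemma square_pos z : 0 < z -> 0 < z ^ 2.
Proof. move=> Hz. exact: pow_lt. Qed.

Lemma continuous_dirichlet_integrand k p (z : R) : 0 < z ->
  continuous (fun q : (R * R) * R => dirichlet_integrand k (fst (fst q)) (snd (fst q)) (snd q)) (p, z).
Proof.
  move=> Hz. have := square_pos z Hz => Hz2. rewrite /dirichlet_integrand.
  cont; [exact: continuous_gauss|exact: jet_continuous|rewrite /=; lra].
Qed.

Lemma continuous_pos_dirichlet_integrand k t x : continuous_pos (dirichlet_integrand k t x).
Proof.
  move=> z Hz. have := square_pos z Hz => Hz2. rewrite /dirichlet_integrand.
  cont; [exact: continuous_gauss|exact: jet_continuous|lra].
Qed.

(** Vanishing of [H] in the past confines the integrands to a bounded interval. *)
Lemma supported_dominated (M C t : R) (f : R -> R) :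
  0 <= C -> (forall p, 0 < p -> Rabs (f p) <= C) -> (forall p, 0 < p -> t <= p ^ 2 / 2 -> f p = 0) ->
  t <= M -> 0 <= M -> dominated (C * (1 + 2 * M)) f.
Proof.
  move=> HC Hb Hs HtM HM p Hp. have Hp2 := square_pos p Hp.
  have P : 0 <= C * (1 + 2 * M) by nra.
  apply: (proj1 (Rle_div_r _ _ _ _)); first lra.
  case: (Rle_dec t (p ^ 2 / 2)) => K.
  - rewrite Hs // Rabs_R0. lra.
  - apply: Rmult_le_compat; [exact: Rabs_pos|lra|exact: Hb|lra].
Qed.

Lemma neumann_dominated k T : exists M, 0 < M /\ forall t x, t <= T -> dominated M (neumann_integrand k t x).
Proof.
  have [M [HM HB]] := jet_bound H k HH.
  exists (M * (1 + 2 * Rabs T)). split; first by have := Rabs_pos T; nra.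
  move=> t x Ht. apply: (supported_dominated (Rabs T) M t) => //; try lra.
  - move=> p Hp. rewrite /neumann_integrand Rabs_mult (Rabs_pos_eq (gauss _)); last by apply: Rlt_le; exact: gauss_pos.
    have := HB (t - p ^ 2 / 2). have := gauss_le_one (x / p). have := gauss_pos (x / p).
    have := Rabs_pos (H k (t - p ^ 2 / 2)). nra.
  - move=> p Hp K. rewrite /neumann_integrand H_past; lra.
  - have := Rle_abs T. lra.
  - exact: Rabs_pos.
Qed.

Lemma continuous_neumann_integrand k p (z : R) : 0 < z ->
  continuous (fun q : (R * R) * R => neumann_integrand k (fst (fst q)) (snd (fst q)) (snd q)) (p, z).
Proof.
  move=> Hz. rewrite /neumann_integrand.
  cont; [exact: continuous_gauss|rewrite /=; lra|exact: jet_continuous|lra].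
Qed.

Lemma continuous_pos_neumann_integrand k t x : continuous_pos (neumann_integrand k t x).
Proof.
  move=> z Hz. rewrite /neumann_integrand. cont; [exact: continuous_gauss|lra|exact: jet_continuous|lra].
Qed.

Lemma continuous_of_plane (f : R -> R -> R) p : continuous2_on plane f -> continuous (fun q : R * R => f (fst q) (snd q)) p.
Proof.
  move=> C P HP. have H1 := C p I P HP. rewrite /filtermap /within in H1 |- *.
  by apply: filter_imp H1 => y Hy; apply: Hy.
Qed.

Lemma locally_prod_lt (t x T : R) : t < T -> locally (t, x) (fun p : R * R => fst p < T).
Proof.
  move=> Ht. exists (mkposreal (T - t) ltac:(lra)) => [[u v]] [Hu _]. rewrite /=.
  have := Rabs_def2 _ _ Hu. rewrite /minus /plus /opp /=. lra.
Qed.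

Lemma continuous_dirichlet k p : continuous (fun q : R * R => dirichlet k (fst q) (snd q)) p.
Proof.
  rewrite /dirichlet. apply: cont_mult; first exact: continuous_const.
  apply: (continuous_of_plane (fun t x => integral (dirichlet_integrand k t x))).
  apply: continuous2_on_integral.
  - move=> t x _. have [M [_ HM]] := dirichlet_dominated k. exists M. apply: locally_true => y _. exact: HM.
  - move=> t x z _ Hz. exact: continuous_dirichlet_integrand.
Qed.

Lemma continuous_neumann k p : continuous (fun q : R * R => neumann k (fst q) (snd q)) p.
Proof.
  rewrite /neumann. apply: cont_mult; first exact: continuous_const.
  apply: (continuous_of_plane (fun t x => integral (neumann_integrand k t x))).
  apply: continuous2_on_integral.
  - move=> t x _. have [M [_ HM]] := neumann_dominated k (t + 1). exists M.
    have Hl : locally (t, x) (fun p : R * R => fst p < t + 1) by apply: locally_prod_lt; lra.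
    apply: filter_imp Hl => y Hy _. apply: HM. lra.
  - move=> t x z _ Hz. exact: continuous_neumann_integrand.
Qed.

Lemma locally_lt (t T : R) : t < T -> locally t (fun s => s < T).
Proof.
  move=> Ht. exists (mkposreal (T - t) ltac:(lra)) => u Hu. have := ball_R _ _ _ Hu. rewrite /=. lra.
Qed.

Lemma locally_gt (t T : R) : T < t -> locally t (fun s => T < s).
Proof.
  move=> Ht. exists (mkposreal (t - T) ltac:(lra)) => u Hu. have := ball_R _ _ _ Hu. rewrite /=. lra.
Qed.

Lemma is_derive_dirichlet_t k t x : is_derive (fun t => dirichlet k t x) t (dirichlet (S k) t x).
Proof.
  apply: is_derive_scal. apply: is_derive_of_whole.
  have [M [_ HM]] := dirichlet_dominated (S k). have [M0 [_ HM0]] := dirichlet_dominated k.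
  apply: (is_derive_on_integral whole (fun t => dirichlet_integrand k t x) (fun t => dirichlet_integrand (S k) t x) t M) => //.
  - move=> y z _ Hz. rewrite /dirichlet_integrand. apply: is_derive_scal.
    rewrite -[H (S k) _]Rmult_1_l.
    apply: (is_derive_comp (H k) (fun y => y - x ^ 2 / (2 * z ^ 2))); first by apply: (proj1 HH).
    auto_derive => //.
  - move=> y _. split; [exact: continuous_pos_dirichlet_integrand|by exists M0; exact: HM0].
  - apply: locally_true => y _. exact: HM.
  - move=> z0 Hz. have Hz2 := square_pos z0 Hz. rewrite /dirichlet_integrand.
    cont; [exact: continuous_gauss|exact: jet_continuous|rewrite /=; lra].
Qed.

Lemma is_derive_neumann_t k t x : is_derive (fun t => neumann k t x) t (neumann (S k) t x).
Proof.
  apply: is_derive_scal. apply: is_derive_of_whole.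
  have [M [_ HM]] := neumann_dominated (S k) (t + 1).
  apply: (is_derive_on_integral whole (fun t => neumann_integrand k t x) (fun t => neumann_integrand (S k) t x) t M) => //.
  - move=> y z _ Hz. rewrite /neumann_integrand. apply: is_derive_scal.
    rewrite -[H (S k) _]Rmult_1_l.
    apply: (is_derive_comp (H k) (fun y => y - z ^ 2 / 2)); first by apply: (proj1 HH).
    auto_derive => //.
  - move=> y _. split; first exact: continuous_pos_neumann_integrand.
    have [M0 [_ HM0]] := neumann_dominated k y. exists M0. apply: HM0. exact: Rle_refl.
  - have Hl : locally t (fun s => s < t + 1) by apply: locally_lt; lra.
    apply: filter_imp Hl => y Hy _. apply: HM. lra.
  - move=> z0 Hz. rewrite /neumann_integrand. cont; [exact: continuous_gauss|rewrite /=; lra|exact: jet_continuous|lra].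
Qed.

(** Differentiating the Gaussian factor produces exactly the Jacobian of the inversion [z = x / p]. *)
Lemma is_derive_neumann_x k t x : 0 < x -> is_derive (neumann k t) x (- dirichlet k t x).
Proof.
  move=> Hx.
  pose D y := x / 2 < y.
  have HD : D x by rewrite /D; lra.
  pose f' y p := - (y / p ^ 2) * neumann_integrand k t y p.
  have E : - dirichlet k t x = / integral gauss * integral (f' x).
  { rewrite /dirichlet. have [M [_ HM]] := dirichlet_dominated k.
    rewrite -(integral_inversion M x (dirichlet_integrand k t x) Hx); [|exact: continuous_pos_dirichlet_integrand|exact: HM].
    have -> : integral (f' x) = -1 * integral (fun z => x / z ^ 2 * dirichlet_integrand k t x (x / z)); last by ring.
    rewrite -integral_scal.
    - apply: integral_ext => z Hz. rewrite /f' /neumann_integrand /dirichlet_integrand.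
      have -> : x ^ 2 / (2 * (x / z) ^ 2) = z ^ 2 / 2 by field; lra. ring.
    - move=> z Hz. have Hz2 := square_pos z Hz. have Hxz : 0 < x / z by apply: Rdiv_lt_0_compat.
      apply: cont_mult; first by cont; lra.
      apply: (cont_comp _ (dirichlet_integrand k t x) (fun z => x / z)); first exact: continuous_pos_dirichlet_integrand.
      cont. lra. }
  rewrite E. apply: is_derive_scal.
  apply: (is_derive_of_is_derive_on D); first by apply: locally_gt; lra.
  have [M1 [HM1 HB1]] := jet_bound H k HH. have [B HB'] := pow_gauss_le 2.
  apply: (is_derive_on_integral D (neumann_integrand k t) f' x (M1 * (B / (x / 2)) * (1 + 2 * Rabs t))) => //.
  - rewrite /D => u v w. lra.
  - rewrite /D => y z Hy Hz. rewrite /neumann_integrand.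
    apply: (is_derive_ext (fun y => H k (t - z ^ 2 / 2) * gauss (y / z))); first by move=> s; exact: Rmult_comm.
    have -> : f' y z = H k (t - z ^ 2 / 2) * (/ z * (- (y / z) * gauss (y / z))).
    { rewrite /f' /neumann_integrand. field. lra. }
    apply: is_derive_scal. apply: (is_derive_comp gauss (fun y => y / z)); first exact: is_derive_gauss.
    auto_derive => //. ring.
  - move=> y _. split; first exact: continuous_pos_neumann_integrand.
    have [M0 [_ HM0]] := neumann_dominated k t. exists M0. apply: HM0. exact: Rle_refl.
  - apply: locally_true => y Hy. apply: (supported_dominated (Rabs t) _ t).
    + apply: Rmult_le_pos; first lra. apply: Rmult_le_pos; last by apply: inv_nonneg; lra.
      have := HB' 0 (Rle_refl 0). have := gauss_pos 0. rewrite /=. lra.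
    + move=> p Hp. rewrite /D in Hy. have Hy0 : 0 < y by lra.
      rewrite /f' /neumann_integrand -Rmult_assoc Rabs_mult.
      have Hxp : 0 < y / p by apply: Rdiv_lt_0_compat.
      rewrite Rmult_comm. apply: Rmult_le_compat; [exact: Rabs_pos|exact: Rabs_pos|exact: HB1|].
      have K := HB' (y / p) ltac:(lra). have G := gauss_pos (y / p).
      have -> : - (y / p ^ 2) * gauss (y / p) = - ((y / p) ^ 2 * gauss (y / p) / y) by field; lra.
      have P2 := square_pos _ Hxp. have Hiy := Rinv_0_lt_compat _ Hy0.
      rewrite Rabs_Ropp Rabs_pos_eq; last by apply: Rmult_le_pos; nra.
      have Hi : / y <= / (x / 2) by apply: Rinv_le_contravar; lra.
      apply: Rmult_le_compat => //; nra.
    + move=> p Hp K. rewrite /f' /neumann_integrand H_past; first ring. lra.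
    + exact: Rle_abs.
    + exact: Rabs_pos.
  - move=> z0 Hz. have Hz2 := square_pos z0 Hz. rewrite /f' /neumann_integrand.
    cont; [rewrite /=; lra|exact: continuous_gauss|rewrite /=; lra|exact: jet_continuous|lra].
Qed.

(** The factor [x / z ^ 2] is singular at [z = 0] but bounded where [H] does not vanish; it is the
    Jacobian of the inversion [p = x / z]. *)
Lemma is_derive_dirichlet_x k t x : 0 < x -> is_derive (dirichlet k t) x (- neumann (S k) t x).
Proof.
  move=> Hx.
  pose D y := x / 2 < y.
  have HD : D x by rewrite /D; lra.
  pose f' y z := - (y / z ^ 2) * dirichlet_integrand (S k) t y z.
  have Dom : forall y, D y -> forall C, 0 <= C -> 2 * Rabs t / (x / 2) <= C ->
     forall M, dominated M (dirichlet_integrand (S k) t y) -> dominated (C * M) (f' y).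
  { rewrite /D => y Hy C C0 HC M HM z Hz. have Hz2 := square_pos z Hz. rewrite /f' Rabs_mult.
    have HMz := HM z Hz.
    case: (Rle_dec t (y ^ 2 / (2 * z ^ 2))) => K.
    - rewrite /dirichlet_integrand H_past; last lra. rewrite Rmult_0_r Rabs_R0 Rmult_0_r.
      have M0 := dominated_nonneg _ _ HM. apply: Rmult_le_pos; first nra.
      apply: inv_nonneg. lra.
    - have Hyz : y / z ^ 2 <= C.
      { apply: Rle_trans HC.
        have Hy2 : 0 < y ^ 2 by apply: square_pos; lra.
        have K' : y ^ 2 < t * (2 * z ^ 2) by apply: (proj1 (Rlt_div_l _ _ _ _)); lra.
        have Ht := Rle_abs t.
        apply: (proj1 (Rle_div_r _ _ _ _)); first lra.
        have -> : y / z ^ 2 * (x / 2) = y * (x / 2) / z ^ 2 by field; lra.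
        apply: (proj2 (Rle_div_l _ _ _ _)); nra. }
      have Hyz0 : 0 <= y / z ^ 2 by apply: Rmult_le_pos; [lra|apply: inv_nonneg].
      have -> : C * M / (1 + z ^ 2) = C * (M / (1 + z ^ 2)) by field; lra.
      rewrite Rabs_Ropp Rabs_pos_eq //. apply: Rmult_le_compat => //. exact: Rabs_pos. }
  have C0 : 0 <= 2 * Rabs t / (x / 2).
  { apply: Rmult_le_pos; [have := Rabs_pos t; lra|apply: inv_nonneg; lra]. }
  have [M [_ HM]] := dirichlet_dominated (S k).
  have Cf : continuous_pos (f' x).
  { move=> z Hz. have Hz2 := square_pos z Hz. rewrite /f'.
    apply: cont_mult; [by cont; lra|exact: continuous_pos_dirichlet_integrand]. }
  have E : - neumann (S k) t x = / integral gauss * integral (f' x).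
  { rewrite /neumann. have [M1 [_ HM1]] := neumann_dominated (S k) t.
    rewrite -(integral_inversion M1 x (neumann_integrand (S k) t x) Hx); [|exact: continuous_pos_neumann_integrand|by apply: HM1; exact: Rle_refl].
    have -> : integral (fun z => x / z ^ 2 * neumann_integrand (S k) t x (x / z)) = - 1 * integral (f' x).
    { rewrite -integral_scal //.
      apply: integral_ext => z Hz. rewrite /f' /neumann_integrand /dirichlet_integrand.
      have -> : (x / z) ^ 2 / 2 = x ^ 2 / (2 * z ^ 2) by field; lra.
      have -> : x / (x / z) = z by field; lra. ring. }
    ring. }
  rewrite E. apply: is_derive_scal.
  apply: (is_derive_of_is_derive_on D); first by apply: locally_gt; lra.
  apply: (is_derive_on_integral D (dirichlet_integrand k t) f' x (2 * Rabs t / (x / 2) * M)) => //.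
  - rewrite /D => u v w. lra.
  - rewrite /D => y z Hy Hz. have Hz2 := square_pos z Hz. rewrite /dirichlet_integrand.
    have -> : f' y z = gauss z * (- (y / z ^ 2) * H (S k) (t - y ^ 2 / (2 * z ^ 2))).
    { rewrite /f' /dirichlet_integrand. ring. }
    apply: is_derive_scal. apply: (is_derive_comp (H k) (fun y => t - y ^ 2 / (2 * z ^ 2))); first by apply: (proj1 HH).
    auto_derive => //. field. lra.
  - move=> y _. split; first exact: continuous_pos_dirichlet_integrand.
    have [M0 [_ HM0]] := dirichlet_dominated k. exists M0. exact: HM0.
  - apply: locally_true => y Hy. apply: Dom => //; exact: Rle_refl.
  - move=> z0 Hz. have Hz2 := square_pos z0 Hz. rewrite /f' /dirichlet_integrand.
    cont; [rewrite /=; lra|exact: continuous_gauss|exact: jet_continuous|rewrite /=; lra].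
Qed.

Lemma is_derive_on_half_line_continuous (f df : R -> R) (x : R) :
  (forall y, continuous f y) -> (forall y, continuous df y) ->
  (forall c, 0 < c -> is_derive f c (df c)) -> 0 <= x -> is_derive_on half_line f x (df x).
Proof.
  move=> Cf Cdf D [Hx|<-].
  - apply: is_derive_on_of_is_derive; [exact: Rlt_le|exact: D].
  - apply: is_derive_on_half_line_zero => //; apply: filterlim_within; [exact: Cf|exact: Cdf].
Qed.

Lemma Ck_opp D n f : Ck D n f -> Ck D n (fun a b => - f a b).
Proof.
  move=> H1. apply: (Ck_ext _ _ (fun a b => -1 * f a b)); last exact: Ck_scal.
  move=> a b _. ring.
Qed.

(** The two potentials are smooth together: differentiation in [x] exchanges them, and both are
    continuous up to [x = 0]. *)
Lemma Ck_potentials n k : Ck quarter n (dirichlet k) /\ Ck quarter n (neumann k).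
Proof.
  elim: n k => [|n IH] k.
  - split; split=> // p _; apply: filterlim_within; [exact: continuous_dirichlet|exact: continuous_neumann].
  - split; (split; first by move=> p _; apply: filterlim_within; [exact: continuous_dirichlet||exact: continuous_neumann]).
    + exists (dirichlet (S k)), (fun a b => - neumann (S k) a b).
      split; last by split; [exact: (proj1 (IH (S k)))|apply: Ck_opp; exact: (proj2 (IH (S k)))].
      move=> a b [Ha Hb]. split; first by apply: is_derive_on_of_is_derive => //; exact: is_derive_dirichlet_t.
      apply: (is_derive_on_local _ half_line (dirichlet k a)) => //.
      * apply: locally_true => y [_ Hy]. by split.
      * apply: (is_derive_on_half_line_continuous (dirichlet k a) (fun b => - neumann (S k) a b)) => //.
        -- move=> y. exact: (continuous_section (fun q => dirichlet k (fst q) (snd q)) a y (continuous_dirichlet _ _)).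
        -- move=> y. apply: cont_opp. exact: (continuous_section (fun q => neumann (S k) (fst q) (snd q)) a y (continuous_neumann _ _)).
        -- move=> c Hc. exact: is_derive_dirichlet_x.
    + exists (neumann (S k)), (fun a b => - dirichlet k a b).
      split; last by split; [exact: (proj2 (IH (S k)))|apply: Ck_opp; exact: (proj1 (IH k))].
      move=> a b [Ha Hb]. split; first by apply: is_derive_on_of_is_derive => //; exact: is_derive_neumann_t.
      apply: (is_derive_on_local _ half_line (neumann k a)) => //.
      * apply: locally_true => y [_ Hy]. by split.
      * apply: (is_derive_on_half_line_continuous (neumann k a) (fun b => - dirichlet k a b)) => //.
        -- move=> y. exact: (continuous_section (fun q => neumann k (fst q) (snd q)) a y (continuous_neumann _ _)).
        -- move=> y. apply: cont_opp. exact: (continuous_section (fun q => dirichlet k (fst q) (snd q)) a y (continuous_dirichlet _ _)).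
        -- move=> c Hc. exact: is_derive_neumann_x.
Qed.

Lemma dirichlet_boundary k t : dirichlet k t 0 = H k t.
Proof.
  have -> : dirichlet k t 0 = / integral gauss * (H k t * integral gauss).
  { rewrite /dirichlet. congr (_ * _). rewrite -integral_scal; last exact: continuous_pos_gauss.
    apply: integral_ext => z Hz. have Hz2 := square_pos z Hz. rewrite /dirichlet_integrand.
    have -> : t - 0 ^ 2 / (2 * z ^ 2) = t by field; lra. ring. }
  field. have := integral_gauss_pos. lra.
Qed.

Lemma dirichlet_initial k x : dirichlet k 0 x = 0.
Proof.
  have -> : dirichlet k 0 x = / integral gauss * (0 * integral (dirichlet_integrand k 0 x)); last by ring.
  rewrite /dirichlet -(integral_scal 0); last exact: continuous_pos_dirichlet_integrand.
  congr (_ * _). apply: integral_ext => z Hz. rewrite /dirichlet_integrand H_past; first ring.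
  have : 0 <= x ^ 2 / (2 * z ^ 2); last lra.
  apply: Rmult_le_pos; first exact: pow2_ge_0. apply: inv_nonneg. have := square_pos z Hz. lra.
Qed.

Lemma dirichlet_bounded k : exists M, forall t x, Rabs (dirichlet k t x) <= M.
Proof.
  have [M [HM HB]] := dirichlet_dominated k. have P := integral_gauss_pos.
  have Pi := Rinv_0_lt_compat _ P.
  exists (/ integral gauss * (2 * M)) => t x. rewrite /dirichlet Rabs_mult Rabs_pos_eq; last lra.
  apply: Rmult_le_compat_l; first lra. apply: integral_bound; [exact: continuous_pos_dirichlet_integrand|exact: HB].
Qed.

End BoundaryPotentials.

(** * The corner layer *)

(** For [m = 0] the profile of the heat kernel in the variable [s], which stands for time divided by
    squared distance; its derivatives are combinations of these functions. *)
Definition flat_exp (m : nat) (s : R) : R :=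
  if Rlt_dec 0 s then exp (- / (4 * s)) / (s ^ m * sqrt s) else 0.

Lemma flat_exp_pos m s : 0 < s -> flat_exp m s = exp (- / (4 * s)) / (s ^ m * sqrt s).
Proof. by rewrite /flat_exp; case: (Rlt_dec 0 s). Qed.

Lemma flat_exp_nonpos m s : s <= 0 -> flat_exp m s = 0.
Proof. rewrite /flat_exp; case: (Rlt_dec 0 s) => //; lra. Qed.

Lemma flat_exp_nonneg m s : 0 <= flat_exp m s.
Proof.
  case: (Rlt_dec 0 s) => Hs; last by rewrite flat_exp_nonpos; lra.
  rewrite flat_exp_pos //. apply: Rlt_le. apply: Rdiv_lt_0_compat; first exact: exp_pos.
  apply: Rmult_lt_0_compat; [exact: pow_lt|exact: sqrt_lt_R0].
Qed.

Lemma flat_exp_small m N : exists C, 0 < C /\ forall s, 0 < s -> flat_exp m s <= C * s ^ N.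
Proof.
  pose M := (m + N)%nat.
  exists (INR (Factorial.fact M) * 4 ^ M + INR (Factorial.fact (S M)) * 4 ^ (S M)).
  have P4 : forall k, 0 < 4 ^ k by move=> k; apply: pow_lt; lra.
  split.
  { have := P4 M. have := P4 (S M). have := INR_fact_lt_0 M. have := INR_fact_lt_0 (S M). nra. }
  move=> s Hs. rewrite flat_exp_pos //.
  have His := Rinv_0_lt_compat _ Hs.
  have Hsq := sqrt_lt_R0 _ Hs.
  have Hss : sqrt s * sqrt s = s by apply: sqrt_sqrt; lra.
  have HM := pow_lt s M Hs. have HN := pow_lt s N Hs. have Hm := pow_lt s m Hs.
  set A := / (4 * s). have HA : 0 < A by apply: Rinv_0_lt_compat; lra.
  have E : forall k, exp (- A) * (/ s) ^ k <= INR (Factorial.fact k) * 4 ^ k.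
  { move=> k. have H := pow_le_fact_exp k A ltac:(lra).
    have -> : / s = 4 * A by rewrite /A; field; lra.
    rewrite Rpow_mult_distr.
    have H1 : exp A * exp (- A) = 1 by rewrite -exp_plus Rplus_opp_r exp_0.
    have := P4 k. have := exp_pos (- A). move=> P1 P2.
    have : A ^ k * exp (- A) <= INR (Factorial.fact k) * (exp A * exp (- A)) by nra.
    rewrite H1. nra. }
  have Hsqi : / sqrt s <= 1 + / s.
  { rewrite -{2}Hss Rinv_mult. have : 0 < / sqrt s by apply: Rinv_0_lt_compat. nra. }
  have -> : exp (- A) / (s ^ m * sqrt s) = exp (- A) * (/ s) ^ M * / sqrt s * s ^ N.
  { rewrite /M pow_inv pow_add. field. lra. }
  apply: Rmult_le_compat_r; first lra.
  have PM : 0 < (/ s) ^ M by apply: pow_lt.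
  have Pe := exp_pos (- A).
  apply: (Rle_trans _ (exp (- A) * (/ s) ^ M * (1 + / s))); first by apply: Rmult_le_compat_l; nra.
  have -> : exp (- A) * (/ s) ^ M * (1 + / s) = exp (- A) * (/ s) ^ M + exp (- A) * (/ s) ^ (S M) by rewrite /=; ring.
  have := E M. have := E (S M). lra.
Qed.

Definition flat_exp' (m : nat) (s : R) : R := - (INR m + / 2) * flat_exp (S m) s + / 4 * flat_exp (S (S m)) s.

Lemma flat_exp_S m s : flat_exp (S m) s = flat_exp m s / s.
Proof.
  case: (Rlt_dec 0 s) => Hs; last by rewrite !flat_exp_nonpos /Rdiv; lra.
  rewrite !flat_exp_pos //. have := pow_lt s m Hs. have := sqrt_lt_R0 s Hs => H1 H2.
  have -> : s ^ S m = s * s ^ m by []. field. lra.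
Qed.

Lemma is_derive_flat_exp_pos m s : 0 < s -> is_derive (flat_exp m) s (flat_exp' m s).
Proof.
  move=> Hs. elim: m => [|m IH].
  - apply: (is_derive_ext_loc (fun s => exp (- / (4 * s)) * / sqrt s)).
    { apply: filter_imp (locally_gt s 0 Hs) => y Hy. rewrite flat_exp_pos //. by rewrite /= Rmult_1_l. }
    have Hsq := sqrt_lt_R0 _ Hs. have Hss : sqrt s * sqrt s = s by apply: sqrt_sqrt; lra.
    have -> : flat_exp' 0 s = exp (- / (4 * s)) * / (4 * s ^ 2) * / sqrt s + exp (- / (4 * s)) * - / (2 * (s * sqrt s)).
    { rewrite /flat_exp' !flat_exp_S flat_exp_pos //=. field. lra. }
    apply: (is_derive_mult (fun s => exp (- / (4 * s))) (fun s => / sqrt s)); last by move=> n k; exact: Rmult_comm.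
    + auto_derive; first lra. field. lra.
    + have -> : / (2 * (s * sqrt s)) = / (2 * (sqrt s * sqrt s * sqrt s)) by rewrite Hss.
      auto_derive; first lra. field. lra.
  - apply: (is_derive_ext (fun s => flat_exp m s * / s)); first by move=> y; rewrite flat_exp_S.
    have -> : flat_exp' (S m) s = flat_exp' m s * / s + flat_exp m s * - / s ^ 2.
    { rewrite /flat_exp' !flat_exp_S S_INR. field. lra. }
    apply: (is_derive_mult (flat_exp m) (fun s => / s)) => //; last by move=> n k; exact: Rmult_comm.
    auto_derive; first lra. field. lra.
Qed.

Lemma is_derive_flat_exp m s : is_derive (flat_exp m) s (flat_exp' m s).
Proof.
  case: (Rtotal_order s 0) => [Hs|[->|Hs]].
  - rewrite /flat_exp' !flat_exp_nonpos; try lra. have -> : - (INR m + / 2) * 0 + / 4 * 0 = 0 by ring.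
    apply: (is_derive_ext_loc (fun _ => 0)); last exact: is_derive_const.
    apply: filter_imp (locally_lt s 0 Hs) => y Hy. rewrite flat_exp_nonpos //; lra.
  - rewrite /flat_exp' !flat_exp_nonpos; try lra. have -> : - (INR m + / 2) * 0 + / 4 * 0 = 0 by ring.
    apply: is_derive_of_whole. apply/(is_derive_on_caratheodory whole) => //.
    exists (slope (flat_exp m) 0 0). split; [|split].
    + move=> y _. rewrite -slope_eq. ring.
    + rewrite /slope. by case: (Req_dec_T 0 0).
    + have HW : Filter (within whole (locally 0)) by apply: within_filter.
      apply: filterlim_R => e He. have [C [HC HB]] := flat_exp_small m 2.
      have Hd : 0 < e / C by exact: Rdiv_lt_0_compat.
      exists (mkposreal _ (Rmin_pos 1 (e / C) Rlt_0_1 Hd)) => y Hy _. rewrite /slope.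
      have {}Hy : Rabs (y - 0) < Rmin 1 (e / C) by exact: Hy.
      case: (Req_dec_T y 0) => n; first by rewrite Rminus_diag Rabs_R0.
      rewrite !Rminus_0_r (flat_exp_nonpos m 0); last lra. rewrite Rminus_0_r.
      case: (Rlt_dec 0 y) => Hy0; last by rewrite flat_exp_nonpos; [rewrite /Rdiv Rmult_0_l Rabs_R0|lra].
      rewrite Rminus_0_r Rabs_pos_eq in Hy; last lra.
      have H1 := Rmin_l 1 (e / C). have H2 := Rmin_r 1 (e / C).
      rewrite Rabs_pos_eq; last by apply: Rmult_le_pos; [exact: flat_exp_nonneg|apply: inv_nonneg].
      apply: (proj2 (Rlt_div_l _ _ _ _)); first lra.
      apply: (Rle_lt_trans _ _ _ (HB y Hy0)).
      have : y * C < e by apply: (proj2 (Rlt_div_r _ _ _ _)); lra. rewrite /=. nra.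
  - exact: is_derive_flat_exp_pos.
Qed.

Lemma continuous_flat_exp m s : continuous (flat_exp m) s.
Proof. apply: (ex_derive_continuous (flat_exp m)). exists (flat_exp' m s). exact: is_derive_flat_exp. Qed.

Section CornerLayer.

Variable D : nat -> R -> R.
Hypothesis HD : bounded_jet D.

(** Up to normalization, the evolution of a datum equal to [D 0 (- x)] for [x < 0] and to [0] for
    [x > 0]: in the coordinates [tau], [s] when [j = a = b = 0], and in the coordinates [T], [y]
    when [j = a = m = 0] and [b = 1].  The other indices make the two families closed under
    differentiation. *)
Definition inner_layer_integrand (j a b : nat) (tau s r : R) : R :=
  r ^ a * (r + s) ^ b * gauss (r + s) * D j (tau * r).
Definition inner_layer (j a b : nat) (tau s : R) : R := integral (inner_layer_integrand j a b tau s).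

Definition outer_layer_integrand (j a b m : nat) (T y q : R) : R :=
  q ^ a * / (1 + q) ^ b * flat_exp m (T / (1 + q) ^ 2) * D j (y * q).
Definition outer_layer (j a b m : nat) (T y : R) : R := integral (outer_layer_integrand j a b m T y).

Lemma inner_layer_dominated j a b : exists M, 0 < M /\ forall tau s, 0 <= s -> dominated M (inner_layer_integrand j a b tau s).
Proof.
  have [M [HM H]] := jet_bound D j HD. have [B [HB H']] := pow_gauss_dominated (a + b).
  exists (B * M). split; first nra. move=> tau s Hs r Hr. rewrite /inner_layer_integrand.
  have G := gauss_pos (r + s). have Pa := pow_lt r a Hr. have Pb : 0 < (r + s) ^ b by apply: pow_lt; lra.
  rewrite Rabs_mult Rabs_pos_eq; last by apply: Rmult_le_pos; nra.
  have -> : B * M / (1 + r ^ 2) = B / (1 + r ^ 2) * M by field; nra.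
  apply: Rmult_le_compat => //; [apply: Rmult_le_pos; nra|exact: Rabs_pos|].
  apply: (Rle_trans _ ((r + s) ^ (a + b) * gauss (r + s))).
  { rewrite pow_add. apply: Rmult_le_compat_r; first lra. apply: Rmult_le_compat_r; first lra. apply: pow_incr; lra. }
  apply: (Rle_trans _ _ _ (H' (r + s) ltac:(lra))).
  apply: Rmult_le_compat_l; first lra. apply: Rinv_le_contravar; nra.
Qed.

Lemma continuous_inner_layer_integrand j a b p (z : R) :
  continuous (fun q : (R * R) * R => inner_layer_integrand j a b (fst (fst q)) (snd (fst q)) (snd q)) (p, z).
Proof. rewrite /inner_layer_integrand. cont; [exact: continuous_gauss|exact: jet_continuous]. Qed.

Lemma continuous_pos_inner_layer_integrand j a b tau s : continuous_pos (inner_layer_integrand j a b tau s).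
Proof. move=> z _. rewrite /inner_layer_integrand. cont; [exact: continuous_gauss|exact: jet_continuous]. Qed.

Lemma continuous2_on_inner_layer j a b : continuous2_on quarter (inner_layer j a b).
Proof.
  apply: continuous2_on_integral.
  - move=> t s _. have [M [_ HM]] := inner_layer_dominated j a b. exists M. apply: locally_true => y [_ Hy]. exact: HM.
  - move=> t s z _ _. exact: continuous_inner_layer_integrand.
Qed.

Lemma is_derive_inner_layer_tau j a b tau s : 0 <= s ->
  is_derive (fun tau => inner_layer j a b tau s) tau (inner_layer (S j) (S a) b tau s).
Proof.
  move=> Hs. apply: is_derive_of_whole.
  have [M [_ HM]] := inner_layer_dominated (S j) (S a) b. have [M0 [_ HM0]] := inner_layer_dominated j a b.
  apply: (is_derive_on_integral whole (fun t => inner_layer_integrand j a b t s) (fun t => inner_layer_integrand (S j) (S a) b t s) tau M) => //.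
  - move=> t z _ _. rewrite /inner_layer_integrand.
    have -> : z ^ S a * (z + s) ^ b * gauss (z + s) * D (S j) (t * z) =
      z ^ a * (z + s) ^ b * gauss (z + s) * scal z (D (S j) (t * z)) by rewrite /scal /= /mult /=; ring.
    apply: is_derive_scal. apply: (is_derive_comp (D j) (fun t => t * z)); first by apply: (proj1 HD).
    auto_derive => //. ring.
  - move=> y _. split; first exact: continuous_pos_inner_layer_integrand. exists M0. exact: HM0.
  - apply: locally_true => y _. exact: HM.
  - move=> z0 _. rewrite /inner_layer_integrand. cont; [exact: continuous_gauss|exact: jet_continuous].
Qed.

Lemma is_derive_on_inner_layer_s j a b tau s : 0 <= s ->
  is_derive_on half_line (inner_layer j a b tau) s (INR b * inner_layer j a (pred b) tau s - inner_layer j a (S b) tau s).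
Proof.
  move=> Hs.
  have [M1 [HM1 H1]] := inner_layer_dominated j a (pred b). have [M2 [HM2 H2]] := inner_layer_dominated j a (S b).
  have [M0 [_ HM0]] := inner_layer_dominated j a b.
  pose f' s r := INR b * inner_layer_integrand j a (pred b) tau s r + -1 * inner_layer_integrand j a (S b) tau s r.
  have C := continuous_pos_inner_layer_integrand.
  have E : INR b * inner_layer j a (pred b) tau s - inner_layer j a (S b) tau s = integral (f' s).
  { rewrite /f' (integral_lincomb _ _ M1 M2 _ _ (C _ _ _ _ _) (C _ _ _ _ _) (H1 _ _ Hs) (H2 _ _ Hs)) /inner_layer. ring. }
  rewrite E.
  apply: (is_derive_on_integral half_line (inner_layer_integrand j a b tau) f' s (Rabs (INR b) * M1 + Rabs (-1) * M2)) => //.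
  - rewrite /half_line => u v w. lra.
  - move=> y r _ _. rewrite /inner_layer_integrand.
    have -> : f' y r = r ^ a * D j (tau * r) * (INR b * (r + y) ^ pred b * gauss (r + y) + (r + y) ^ b * (- (r + y) * gauss (r + y))).
    { rewrite /f' /inner_layer_integrand /=. ring. }
    apply: (is_derive_ext (fun y => r ^ a * D j (tau * r) * ((r + y) ^ b * gauss (r + y)))); first by move=> t /=; ring.
    apply: is_derive_scal.
    apply: (is_derive_mult (fun y => (r + y) ^ b) (fun y => gauss (r + y))); last by move=> n k; exact: Rmult_comm.
    + auto_derive => //. ring.
    + rewrite -[X in is_derive _ _ X]Rmult_1_l.
      apply: (is_derive_comp gauss (fun y => r + y)); first exact: is_derive_gauss. auto_derive => //.
  - move=> y Hy. split; first exact: C. exists M0. exact: HM0.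
  - apply: locally_true => y Hy. apply: dominated_lincomb; [exact: H1|exact: H2].
  - move=> z0 _. rewrite /f' /inner_layer_integrand.
    cont; try exact: continuous_gauss; exact: jet_continuous.
Qed.

Lemma Ck_inner_layer n j a b : Ck quarter n (inner_layer j a b).
Proof.
  elim: n j a b => [|n IH] j a b; (split; first exact: continuous2_on_inner_layer) => //.
  exists (inner_layer (S j) (S a) b), (fun tau s => INR b * inner_layer j a (pred b) tau s + -1 * inner_layer j a (S b) tau s).
  split; last by split; [exact: IH|apply: Ck_plus; apply: Ck_scal; exact: IH].
  move=> tau s [Ht Hs]. split; first by apply: is_derive_on_of_is_derive => //; exact: is_derive_inner_layer_tau.
  apply: (is_derive_on_local _ half_line (inner_layer j a b tau)) => //.
  - apply: locally_true => y [_ Hy]. by split.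
  - have -> : forall u v, u + -1 * v = u - v by move=> u v; ring. exact: is_derive_on_inner_layer_s.
Qed.

(** The heat equation in the coordinates [tau], [s]: the integrands differ by the derivative of
    [r * D (tau * r) * gauss (r + s)]. *)
Lemma inner_layer_heat tau s : 0 <= s ->
  tau * inner_layer 1 1 0 tau s + s * inner_layer 0 0 1 tau s = inner_layer 0 0 2 tau s - inner_layer 0 0 0 tau s.
Proof.
  move=> Hs.
  have [M1 [HM1 H1]] := inner_layer_dominated 1 1 0. have [M2 [HM2 H2]] := inner_layer_dominated 0 0 1.
  have [M3 [HM3 H3]] := inner_layer_dominated 0 0 2. have [M4 [HM4 H4]] := inner_layer_dominated 0 0 0.
  have C := continuous_pos_inner_layer_integrand.
  have E : integral (fun r => 1 * (tau * inner_layer_integrand 1 1 0 tau s r + s * inner_layer_integrand 0 0 1 tau s r) +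
      -1 * (1 * inner_layer_integrand 0 0 2 tau s r + -1 * inner_layer_integrand 0 0 0 tau s r)) = 0 - 0.
  { apply: (integral_derive (fun r => r * gauss (r + s) * D 0 (tau * r))).
    - move=> r _.
      have DD : is_derive (fun r => r * gauss (r + s) * D 0 (tau * r)) r
        ((1 * gauss (r + s) + r * (1 * (- (r + s) * gauss (r + s)))) * D 0 (tau * r) + r * gauss (r + s) * (tau * D 1 (tau * r))).
      { apply: (is_derive_mult (fun r => r * gauss (r + s)) (fun r => D 0 (tau * r))); last by move=> n k; exact: Rmult_comm.
        - apply: (is_derive_mult (fun r => r) (fun r => gauss (r + s))); last by move=> n k; exact: Rmult_comm.
          + exact: is_derive_id.
          + apply: (is_derive_comp gauss (fun r => r + s)); first exact: is_derive_gauss. auto_derive => //.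
        - apply: (is_derive_comp (D 0) (fun r => tau * r)); first by apply: (proj1 HD). auto_derive => //. ring. }
      move: DD.
      have -> : (1 * gauss (r + s) + r * (1 * (- (r + s) * gauss (r + s)))) * D 0 (tau * r) + r * gauss (r + s) * (tau * D 1 (tau * r)) =
        1 * (tau * inner_layer_integrand 1 1 0 tau s r + s * inner_layer_integrand 0 0 1 tau s r) +
        -1 * (1 * inner_layer_integrand 0 0 2 tau s r + -1 * inner_layer_integrand 0 0 0 tau s r) by rewrite /inner_layer_integrand /=; ring.
      by [].
    - move=> r Hr. cont; exact: C.
    - move=> e He.
      have Cc : continuous (fun r => r * gauss (r + s) * D 0 (tau * r)) 0.
      { cont; [exact: continuous_gauss|exact: jet_continuous]. }
      have [d Hd] := filterlim_R_eps _ _ _ Cc e He.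
      exists d. split; first exact: cond_pos. move=> r Hr.
      have := Hd r ltac:(by apply: Rabs_def1; rewrite /minus /plus /opp /=; lra).
      by rewrite !Rmult_0_l.
    - move=> e He.
      have [M [HM HB]] := jet_bound D 0 HD. have [B HB'] := pow_gauss_le 2.
      have B0 : 0 <= B by have := HB' 0 (Rle_refl 0); have := gauss_pos 0; rewrite /=; lra.
      exists (e / ((B + 1) * M)).
      have HBM : 0 < (B + 1) * M by nra.
      have Hp : 0 < e / ((B + 1) * M) by exact: Rdiv_lt_0_compat.
      split=> // r Hr.
      have Hr0 : 0 < r by have := Rinv_0_lt_compat _ Hp; lra.
      rewrite Rminus_0_r Rabs_mult Rabs_pos_eq; last by apply: Rmult_le_pos; [lra|apply: Rlt_le; exact: gauss_pos].
      have K := HB' (r + s) ltac:(lra). have Q := HB (tau * r).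
      have G := gauss_pos (r + s).
      have Hr' : (B + 1) * M < r * e.
      { move: Hr. have -> : / (e / ((B + 1) * M)) = (B + 1) * M / e by field; lra.
        move=> Hr. exact: (proj1 (Rlt_div_l _ _ _ He) Hr). }
      apply: (Rmult_lt_reg_l r) => //.
      apply: Rle_lt_trans Hr'.
      have -> : r * (r * gauss (r + s) * Rabs (D 0 (tau * r))) = (r ^ 2 * gauss (r + s)) * Rabs (D 0 (tau * r)) by ring.
      apply: Rmult_le_compat => //; [apply: Rmult_le_pos; [exact: pow2_ge_0|lra]|exact: Rabs_pos|].
      apply: (Rle_trans _ ((r + s) ^ 2 * gauss (r + s))); last lra.
      apply: Rmult_le_compat_r; first lra. apply: pow_incr. lra. }
  rewrite (integral_lincomb 1 (-1) _ _ _ _ _ _ (dominated_lincomb tau s _ _ _ _ (H1 _ _ Hs) (H2 _ _ Hs))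
    (dominated_lincomb 1 (-1) _ _ _ _ (H3 _ _ Hs) (H4 _ _ Hs))) in E;
    [|by move=> z Hz; cont; exact: C|by move=> z Hz; cont; exact: C].
  rewrite (integral_lincomb tau s _ _ _ _ (C _ _ _ _ _) (C _ _ _ _ _) (H1 _ _ Hs) (H2 _ _ Hs)) in E.
  rewrite (integral_lincomb 1 (-1) _ _ _ _ (C _ _ _ _ _) (C _ _ _ _ _) (H3 _ _ Hs) (H4 _ _ Hs)) in E.
  rewrite /inner_layer. lra.
Qed.

Lemma inner_layer_at_zero tau : inner_layer 0 0 0 tau 0 = moment (D 0) 0 tau 0.
Proof.
  apply: integral_ext => z _. rewrite /inner_layer_integrand /moment_integrand Rplus_0_r Rplus_0_l /=. ring.
Qed.

(** The argument [t / (1 + q) ^ 2] of the flat function is small for large [q], which beats all powers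
    of [q]. *)
Lemma outer_layer_dominated j a b m T : exists M, 0 < M /\ forall t y, t <= T -> dominated M (outer_layer_integrand j a b m t y).
Proof.
  have [M [HM H]] := jet_bound D j HD. have [C [HC H']] := flat_exp_small m (S a).
  have PT : 0 < (Rabs T + 1) ^ S a by apply: pow_lt; have := Rabs_pos T; lra.
  exists (C * (Rabs T + 1) ^ S a * M). split; first by apply: Rmult_lt_0_compat => //; apply: Rmult_lt_0_compat.
  move=> t y Ht q Hq. rewrite /outer_layer_integrand.
  have Pa := pow_lt q a Hq. have Pb : 1 <= (1 + q) ^ b by apply: pow_R1_Rle; lra.
  have Hz : 0 < (1 + q) ^ 2 by apply: pow_lt; lra.
  have Pib : 0 < / (1 + q) ^ b <= 1.
  { split; first by apply: Rinv_0_lt_compat; lra. rewrite -{2}Rinv_1. apply: Rinv_le_contravar; lra. }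
  have F0 := flat_exp_nonneg m (t / (1 + q) ^ 2).
  rewrite Rabs_mult Rabs_pos_eq; last by apply: Rmult_le_pos => //; nra.
  have -> : C * (Rabs T + 1) ^ S a * M / (1 + q ^ 2) = C * (Rabs T + 1) ^ S a / (1 + q ^ 2) * M by field; nra.
  apply: Rmult_le_compat => //; [by apply: Rmult_le_pos => //; nra|exact: Rabs_pos|].
  case: (Rlt_dec 0 t) => Ht0; last first.
  { rewrite flat_exp_nonpos; last first.
    { have -> : t / (1 + q) ^ 2 = - ((- t) / (1 + q) ^ 2) by field; lra.
      have : 0 <= (- t) / (1 + q) ^ 2 by apply: Rmult_le_pos; [lra|apply: inv_nonneg]. lra. }
    rewrite Rmult_0_r. apply: Rmult_le_pos; first nra. apply: inv_nonneg. nra. }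
  have K := H' (t / (1 + q) ^ 2) ltac:(exact: Rdiv_lt_0_compat).
  have HTt : t <= Rabs T + 1 by have := Rle_abs T; lra.
  have Kt : t ^ S a <= (Rabs T + 1) ^ S a by apply: pow_incr; lra.
  apply: (Rle_trans _ ((1 + q) ^ a * (C * (t / (1 + q) ^ 2) ^ S a))).
  { apply: Rmult_le_compat => //; first nra.
    apply: (Rle_trans _ (q ^ a)); first nra. apply: pow_incr. lra. }
  have Pz := pow_lt (1 + q) a ltac:(lra). have Pt := pow_lt t (S a) Ht0.
  have -> : (1 + q) ^ a * (C * (t / (1 + q) ^ 2) ^ S a) = C * t ^ S a * / ((1 + q) ^ a * (1 + q) ^ 2).
  { rewrite /Rdiv Rpow_mult_distr pow_inv -pow_mult. have -> : (2 * S a = a + a + 2)%nat by lia.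
    rewrite !pow_add. field. lra. }
  apply: Rmult_le_compat; [nra| |nra|].
  - apply: inv_nonneg. nra.
  - apply: Rinv_le_contravar; first nra.
    have : 1 <= (1 + q) ^ a by apply: pow_R1_Rle; lra. nra.
Qed.

Lemma one_plus_pow_pos b z : 0 < z -> 0 < (1 + z) ^ b.
Proof. move=> Hz. apply: pow_lt. lra. Qed.

Lemma continuous_outer_layer_integrand j a b m p (z : R) : 0 < z ->
  continuous (fun q : (R * R) * R => outer_layer_integrand j a b m (fst (fst q)) (snd (fst q)) (snd q)) (p, z).
Proof.
  move=> Hz. have P2 := one_plus_pow_pos 2 z Hz. have Pb := one_plus_pow_pos b z Hz. rewrite /outer_layer_integrand.
  cont; [rewrite /=; lra|exact: continuous_flat_exp|rewrite /= in P2 *; lra|exact: jet_continuous].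
Qed.

Lemma continuous_pos_outer_layer_integrand j a b m T y : continuous_pos (outer_layer_integrand j a b m T y).
Proof.
  move=> z Hz. have P2 := one_plus_pow_pos 2 z Hz. have Pb := one_plus_pow_pos b z Hz. rewrite /outer_layer_integrand.
  cont; [lra|exact: continuous_flat_exp|lra|exact: jet_continuous].
Qed.

Lemma continuous_outer_layer j a b m p : continuous (fun q : R * R => outer_layer j a b m (fst q) (snd q)) p.
Proof.
  apply: (continuous_of_plane (outer_layer j a b m)).
  apply: continuous2_on_integral.
  - move=> t y _. have [M [_ HM]] := outer_layer_dominated j a b m (t + 1). exists M.
    have Hl : locally (t, y) (fun p : R * R => fst p < t + 1) by apply: locally_prod_lt; lra.
    apply: filter_imp Hl => z Hz _. apply: HM. lra.
  - move=> t s z _ Hz. exact: continuous_outer_layer_integrand.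
Qed.

Lemma is_derive_outer_layer_y j a b m T y : is_derive (outer_layer j a b m T) y (outer_layer (S j) (S a) b m T y).
Proof.
  apply: is_derive_of_whole.
  have [M [_ HM]] := outer_layer_dominated (S j) (S a) b m T. have [M0 [_ HM0]] := outer_layer_dominated j a b m T.
  apply: (is_derive_on_integral whole (outer_layer_integrand j a b m T) (outer_layer_integrand (S j) (S a) b m T) y M) => //.
  - move=> t z _ _. rewrite /outer_layer_integrand.
    have -> : z ^ S a * / (1 + z) ^ b * flat_exp m (T / (1 + z) ^ 2) * D (S j) (t * z) =
      z ^ a * / (1 + z) ^ b * flat_exp m (T / (1 + z) ^ 2) * scal z (D (S j) (t * z)) by rewrite /scal /= /mult /=; ring.
    apply: is_derive_scal. apply: (is_derive_comp (D j) (fun t => t * z)); first by apply: (proj1 HD).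
    auto_derive => //. ring.
  - move=> t _. split; first exact: continuous_pos_outer_layer_integrand. exists M0. apply: HM0. exact: Rle_refl.
  - apply: locally_true => t _. apply: HM. exact: Rle_refl.
  - move=> z Hz. have P2 := one_plus_pow_pos 2 z Hz. have Pb := one_plus_pow_pos b z Hz. rewrite /outer_layer_integrand.
    cont; [rewrite /=; lra|exact: continuous_flat_exp|rewrite /= in P2 *; lra|exact: jet_continuous].
Qed.

Lemma is_derive_outer_layer_T j a b m T y : is_derive (fun T => outer_layer j a b m T y) T
  (- (INR m + / 2) * outer_layer j a (b + 2) (S m) T y + / 4 * outer_layer j a (b + 2) (S (S m)) T y).
Proof.
  have [M1 [HM1 H1]] := outer_layer_dominated j a (b + 2) (S m) (T + 1).
  have [M2 [HM2 H2]] := outer_layer_dominated j a (b + 2) (S (S m)) (T + 1).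
  set c := - (INR m + / 2).
  pose f' T q := c * outer_layer_integrand j a (b + 2) (S m) T y q + / 4 * outer_layer_integrand j a (b + 2) (S (S m)) T y q.
  have C := continuous_pos_outer_layer_integrand.
  have E : c * outer_layer j a (b + 2) (S m) T y + / 4 * outer_layer j a (b + 2) (S (S m)) T y = integral (f' T).
  { have HT : T <= T + 1 by lra.
    by rewrite /f' (integral_lincomb _ _ M1 M2 _ _ (C _ _ _ _ _ _) (C _ _ _ _ _ _) (H1 _ _ HT) (H2 _ _ HT)). }
  rewrite E. apply: is_derive_of_whole.
  apply: (is_derive_on_integral whole (fun T => outer_layer_integrand j a b m T y) f' T (Rabs c * M1 + Rabs (/ 4) * M2)) => //.
  - move=> t z _ Hz. have P2 := one_plus_pow_pos 2 z Hz. have Pb := one_plus_pow_pos b z Hz.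
    have -> : f' t z = z ^ a * / (1 + z) ^ b * D j (y * z) * (/ (1 + z) ^ 2 * flat_exp' m (t / (1 + z) ^ 2)).
    { rewrite /f' /outer_layer_integrand /flat_exp' -/c pow_add. field. lra. }
    apply: (is_derive_ext (fun t => z ^ a * / (1 + z) ^ b * D j (y * z) * flat_exp m (t / (1 + z) ^ 2))).
    { move=> u. rewrite /outer_layer_integrand Rmult_assoc (Rmult_comm (D j (y * z))) -Rmult_assoc. reflexivity. }
    apply: is_derive_scal. apply: (is_derive_comp (flat_exp m) (fun t => t / (1 + z) ^ 2)); first exact: is_derive_flat_exp.
    auto_derive => //. rewrite /= in P2 *. field. lra.
  - move=> t _. split; first exact: C. have [M0 [_ HM0]] := outer_layer_dominated j a b m t. exists M0. apply: HM0. exact: Rle_refl.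
  - have Hl : locally T (fun t => t < T + 1) by apply: locally_lt; lra.
    apply: filter_imp Hl => t Ht _. apply: dominated_lincomb; [apply: H1; lra|apply: H2; lra].
  - move=> z Hz. have P2 := one_plus_pow_pos 2 z Hz. have Pb := one_plus_pow_pos (b + 2) z Hz. rewrite /f' /outer_layer_integrand.
    cont; try (rewrite /= in P2 *; lra); try exact: continuous_flat_exp; exact: jet_continuous.
Qed.

Lemma Ck_outer_layer n j a b m : Ck quarter n (outer_layer j a b m).
Proof.
  elim: n j a b m => [|n IH] j a b m; (split; first by move=> p _; apply: filterlim_within; exact: continuous_outer_layer) => //.
  exists (fun T y => - (INR m + / 2) * outer_layer j a (b + 2) (S m) T y + / 4 * outer_layer j a (b + 2) (S (S m)) T y), (outer_layer (S j) (S a) b m).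
  split; last by split; [apply: Ck_plus; apply: Ck_scal; exact: IH|exact: IH].
  move=> T y Hq. split; apply: is_derive_on_of_is_derive => //; [exact: is_derive_outer_layer_T|exact: is_derive_outer_layer_y].
Qed.

Lemma outer_layer_initial j a b m y : outer_layer j a b m 0 y = 0.
Proof.
  have -> : outer_layer j a b m 0 y = 0 * integral (outer_layer_integrand j a b m 0 y); last by ring.
  rewrite -integral_scal; last exact: continuous_pos_outer_layer_integrand.
  apply: integral_ext => z Hz. rewrite /outer_layer_integrand flat_exp_nonpos; first ring. rewrite /Rdiv Rmult_0_l. exact: Rle_refl.
Qed.

(** The substitution [q = sqrt (2 * T) * r], with [tau = y * sqrt (2 * T)] and [s = 1 / sqrt (2 * T)]. *)
Lemma inner_layer_eq_outer_layer T y : 0 < T ->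
  inner_layer 0 0 0 (y * sqrt (2 * T)) (/ sqrt (2 * T)) = / sqrt 2 * outer_layer 0 0 1 0 T y.
Proof.
  move=> HT. have [M [_ HM]] := outer_layer_dominated 0 0 1 0 T.
  have Hs : 0 < sqrt (2 * T) by apply: sqrt_lt_R0; lra.
  rewrite -integral_scal; last exact: continuous_pos_outer_layer_integrand.
  have Dm := dominated_scal (/ sqrt 2) _ _ (HM T y (Rle_refl T)).
  rewrite -(integral_scale _ (sqrt (2 * T)) _ Hs _ Dm); last first.
  { move=> z Hz. cont. exact: continuous_pos_outer_layer_integrand. }
  apply: integral_ext => z Hz.
  have Hzs : 0 < sqrt (2 * T) * z by exact: Rmult_lt_0_compat.
  have P2 := one_plus_pow_pos 2 _ Hzs.
  rewrite /inner_layer_integrand /outer_layer_integrand flat_exp_pos; last exact: Rdiv_lt_0_compat.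
  have H2 : 0 < sqrt 2 by apply: sqrt_lt_R0; lra.
  have HTs : 0 < sqrt T by apply: sqrt_lt_R0.
  have E1 : sqrt (2 * T) = sqrt 2 * sqrt T by rewrite sqrt_mult; lra.
  have E2 : sqrt (T / (1 + sqrt (2 * T) * z) ^ 2) = sqrt T / (1 + sqrt (2 * T) * z).
  { rewrite sqrt_div_alt // sqrt_pow2 //. lra. }
  rewrite E2.
  have -> : y * sqrt (2 * T) * z = y * (sqrt (2 * T) * z) by ring.
  have E3 : exp (- / (4 * (T / (1 + sqrt (2 * T) * z) ^ 2))) = gauss (z + / sqrt (2 * T)).
  { rewrite /gauss. congr exp.
    have -> : (z + / sqrt (2 * T)) ^ 2 = (1 + sqrt (2 * T) * z) ^ 2 / (sqrt (2 * T) * sqrt (2 * T)) by field; lra.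
    rewrite sqrt_sqrt; last lra. field. split; last lra. lra. }
  rewrite E3 E1 /=. rewrite E1 in Hzs. field. lra.
Qed.

End CornerLayer.

(** * Uniqueness *)

(** If no value were maximal, every point would have a neighbourhood on which [f] is exceeded at some
    point of the rectangle; two inductions on intervals would extend this to the whole
    rectangle. *)
Lemma maximum_on_rectangle (f : R -> R -> R) (S X : R) : continuous2_on quarter f -> 0 <= S -> 0 <= X ->
  exists t0 x0, 0 <= t0 <= S /\ 0 <= x0 <= X /\
    forall t x, 0 <= t <= S -> 0 <= x <= X -> f t x <= f t0 x0.
Proof.
  move=> C HS HX. apply: NNPP => n.
  have N : forall t0 x0, 0 <= t0 <= S -> 0 <= x0 <= X -> exists t x, 0 <= t <= S /\ 0 <= x <= X /\ f t0 x0 < f t x.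
  { move=> t0 x0 Ht Hx. apply: NNPP => n'. apply: n. exists t0, x0. split=> //. split=> // t x Ht' Hx'.
    apply: Rnot_lt_le => K. apply: n'. by exists t, x. }
  pose exceeded (u v d t : R) := exists tq xq, 0 <= tq <= S /\ 0 <= xq <= X /\
     forall t' x, 0 <= t' <= S -> Rabs (t' - t) < d -> u <= x <= v -> f t' x < f tq xq.
  have L1 : forall t, 0 <= t <= S -> exists d, 0 < d /\ exceeded 0 X d t.
  { move=> t Ht.
    apply: (interval_induction (fun u v => exists d, 0 < d /\ exceeded u v d t)) => //.
    - move=> x y z Hxyz [d1 [Hd1 [t1 [x1 [Ht1 [Hx1 H1]]]]]] [d2 [Hd2 [t2 [x2 [Ht2 [Hx2 H2]]]]]].
      exists (Rmin d1 d2). split; first exact: Rmin_pos.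
      have R1 := Rmin_l d1 d2. have R2 := Rmin_r d1 d2.
      case: (Rle_dec (f t1 x1) (f t2 x2)) => K; [exists t2, x2|exists t1, x1];
        (split=> //; split=> // t' w Ht' Hd Hw; case: (Rle_dec w y) => Kw;
         [have := H1 t' w Ht' ltac:(lra) ltac:(lra)|have := H2 t' w Ht' ltac:(lra) ltac:(lra)]; lra).
    - move=> x Hx. have [tq [xq [Htq [Hxq Hlt]]]] := N t x Ht Hx.
      have Q : quarter t x by split; lra.
      have [d Hd] := filterlim_R_eps _ _ _ (C (t, x) Q) (f tq xq - f t x) ltac:(lra).
      exists d. split; first exact: cond_pos. move=> u v Huv Hv Hu Hv2.
      exists d. split; first exact: cond_pos. exists tq, xq. split=> //. split=> // t' w Ht' Hdt Hw.
      have Hb : ball (t, x) d (t', w).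
      { split=> //=. apply: Rabs_def1; rewrite /minus /plus /opp /=; lra. }
      have := Hd (t', w) Hb ltac:(split; rewrite /=; lra). rewrite /=. move=> /Rabs_def2. lra. }
  have [tq [xq [Htq [Hxq H]]]] : exists tq xq, 0 <= tq <= S /\ 0 <= xq <= X /\
     forall t x, 0 <= t <= S -> 0 <= x <= X -> f t x < f tq xq.
  { apply: (interval_induction (fun u v => exists tq xq, 0 <= tq <= S /\ 0 <= xq <= X /\
       forall t x, u <= t <= v -> 0 <= x <= X -> f t x < f tq xq)) => //.
    - move=> x y z Hxyz [t1 [x1 [Ht1 [Hx1 H1]]]] [t2 [x2 [Ht2 [Hx2 H2]]]].
      case: (Rle_dec (f t1 x1) (f t2 x2)) => K; [exists t2, x2|exists t1, x1];
        (split=> //; split=> // t' w Ht' Hw; case: (Rle_dec t' y) => Kw;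
         [have := H1 t' w ltac:(lra) Hw|have := H2 t' w ltac:(lra) Hw]; lra).
    - move=> t Ht. have [d [Hd [tq [xq [Htq [Hxq H]]]]]] := L1 t Ht.
      exists d. split=> // u v Huv Hv Hu Hv2. exists tq, xq. split=> //. split=> // t' w Ht' Hw.
      apply: H => //; first lra. apply: Rabs_def1; lra. }
  have := H tq xq Htq Hxq. lra.
Qed.

Lemma is_derive_eps (g : R -> R) (t l e : R) : is_derive g t l -> 0 < e ->
  exists d, 0 < d /\ forall s, Rabs (s - t) < d -> Rabs (g s - g t - l * (s - t)) <= e * Rabs (s - t).
Proof.
  move=> [_ H] He. have Hl : is_filter_lim (locally t) t by [].
  have [d Hd] := H t Hl (mkposreal e He).
  exists d. split; first exact: cond_pos. move=> s Hs.
  have := Hd s Hs. rewrite /norm /= /abs /= /minus /plus /opp /scal /= /mult /=.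
  have -> : g s + - g t + - ((s + - t) * l) = g s - g t - l * (s - t) by ring. by [].
Qed.

Lemma is_derive_left_max (g : R -> R) (t l d : R) : is_derive g t l -> 0 < d ->
  (forall s, t - d < s < t -> g s <= g t) -> 0 <= l.
Proof.
  move=> Dg Hd Hm. apply: Rnot_lt_le => Hl.
  have [e [He H]] := is_derive_eps g t l (- l / 2) Dg ltac:(lra).
  have Hm0 : 0 < Rmin d e by exact: Rmin_pos.
  have R1 := Rmin_l d e. have R2 := Rmin_r d e.
  pose s := t - Rmin d e / 2.
  have Es : s - t = - (Rmin d e / 2) by rewrite /s; ring.
  have := H s. rewrite Es Rabs_Ropp Rabs_pos_eq; last lra. move=> /(_ ltac:(lra)) K.
  have := Rabs_le_between (g s - g t - l * - (Rmin d e / 2)) (- l / 2 * (Rmin d e / 2)).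
  move=> [/(_ K) [K1 K2] _].
  have := Hm s ltac:(rewrite /s; lra). nra.
Qed.

Lemma is_derive_right_max (g : R -> R) (t l d : R) : is_derive g t l -> 0 < d ->
  (forall s, t < s < t + d -> g s <= g t) -> l <= 0.
Proof.
  move=> Dg Hd Hm.
  have D' : is_derive (fun s => g (- s)) (- t) (- l).
  { have -> : - l = scal (-1) l by rewrite /scal /= /mult /=; ring.
    apply: (is_derive_comp g (fun s => - s)); first by rewrite Ropp_involutive. auto_derive => //. }
  have := is_derive_left_max _ _ _ d D' Hd. move=> H.
  have : 0 <= - l; last lra.
  apply: H => s Hs. rewrite Ropp_involutive. apply: Hm. lra.
Qed.

Lemma second_derivative_max (g dg : R -> R) (x l d : R) : 0 < d ->
  (forall y, Rabs (y - x) < d -> is_derive g y (dg y)) -> is_derive dg x l ->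
  (forall y, Rabs (y - x) < d -> g y <= g x) -> l <= 0.
Proof.
  move=> Hd Dg Ddg Hm.
  have Dx : is_derive g x (dg x) by apply: Dg; rewrite Rminus_diag Rabs_R0.
  have E0 : dg x = 0.
  { apply: Rle_antisym.
    - apply: (is_derive_right_max g x (dg x) d) => // s Hs. apply: Hm. apply: Rabs_def1; lra.
    - apply: (is_derive_left_max g x (dg x) d) => // s Hs. apply: Hm. apply: Rabs_def1; lra. }
  apply: Rnot_lt_le => Hl.
  have [e [He H]] := is_derive_eps dg x l (l / 2) Ddg ltac:(lra).
  have Hm0 : 0 < Rmin d e by exact: Rmin_pos.
  have R1 := Rmin_l d e. have R2 := Rmin_r d e.
  set r := Rmin d e / 2. have Hr : 0 < r by rewrite /r; lra. have Hr1 : r < d /\ r < e by rewrite /r; lra.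
  have P : forall y, x < y <= x + r -> 0 < dg y.
  { move=> y Hy. have := H y ltac:(apply: Rabs_def1; lra). rewrite E0 (Rabs_pos_eq (y - x)); last lra.
    move=> K. have := Rabs_le_between (dg y - 0 - l * (y - x)) (l / 2 * (y - x)). move=> [/(_ K) [K1 K2] _]. nra. }
  have [c [E Hc]] : exists c, g (x + r) - g x = dg c * (x + r - x) /\ x < c < x + r.
  { apply: MVT_cor2 => [|c Hc]; first lra. apply/is_derive_Reals. apply: Dg. apply: Rabs_def1; lra. }
  have := P c ltac:(lra). have := Hm (x + r) ltac:(apply: Rabs_def1; lra). nra.
Qed.

(** Supersolutions of the heat equation when [p' >= 4 * p ^ 2] and [q' >= 2 * p].  Heat kernels are of
    this form with equality in both conditions. *)
Definition barrier (p q : R -> R) (t x : R) : R := exp (p t * x ^ 2 + q t).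

Lemma is_derive_barrier_t (p q : R -> R) (t x p' q' : R) : is_derive p t p' -> is_derive q t q' ->
  is_derive (fun t => barrier p q t x) t ((p' * x ^ 2 + q') * barrier p q t x).
Proof.
  move=> Dp Dq. rewrite /barrier.
  apply: (is_derive_comp exp (fun t => p t * x ^ 2 + q t)); first exact: is_derive_exp.
  apply: (is_derive_plus (V := R_NormedModule)) => //.
  apply: (is_derive_ext (fun t => x ^ 2 * p t)); first by move=> s; exact: Rmult_comm.
  rewrite Rmult_comm. exact: is_derive_scal.
Qed.

Lemma is_derive_barrier_x (p q : R -> R) (t x : R) :
  is_derive (barrier p q t) x (2 * p t * x * barrier p q t x).
Proof. rewrite /barrier. auto_derive => //. have -> : x * (x * 1) = x ^ 2 by []. ring. Qed.

Lemma is_derive_barrier_xx (p q : R -> R) (t x : R) :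
  is_derive (fun x => 2 * p t * x * barrier p q t x) x ((2 * p t + 4 * p t ^ 2 * x ^ 2) * barrier p q t x).
Proof. rewrite /barrier. auto_derive => //. have -> : x * (x * 1) = x ^ 2 by []. ring. Qed.

Lemma barrier_pos p q t x : 0 < barrier p q t x.
Proof. exact: exp_pos. Qed.

(** For [t <= 1 / (16 * b)] the rate stays between [b] and [2 * b], so that both conditions on a
    supersolution are satisfied, the second one strictly. *)
Definition growth_rate (b t : R) : R := b * (1 + 16 * b * t).
Definition growth_shift (b t : R) : R := 5 * b * t.
(** The heat kernel started at time [- e ^ 2], normalized to be [1] at the origin at time [0]. *)
Definition corner_rate (e t : R) : R := - / (4 * (t + e ^ 2)).
Definition corner_shift (e t : R) : R := - / 2 * ln (1 + t / e ^ 2).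

Lemma continuous_barrier (p q : R -> R) (r : R * R) : continuous p (fst r) -> continuous q (fst r) ->
  continuous (fun r : R * R => barrier p q (fst r) (snd r)) r.
Proof. move=> Cp Cq. rewrite /barrier. cont; assumption. Qed.

Section ShortTime.

Variable d : R -> R -> R.
Hypothesis heat_d : heat_equation d.
Hypothesis continuous_d : continuous2_on quarter_punctured d.
Hypothesis initial_d : forall x, 0 < x -> d 0 x = 0.
Hypothesis boundary_d : forall t, 0 < t -> d t 0 = 0.
Variables A a S : R.
Hypothesis A_nonneg : 0 <= A.
Hypothesis a_nonneg : 0 <= a.
Hypothesis S_pos : 0 < S.
Hypothesis S_small : 16 * (a + 1) * S <= 1.
Hypothesis growth_d : forall t x, 0 < t <= S -> 0 < x -> d t x <= A * exp (a * x ^ 2).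

Let b := a + 1.

(** At an interior point where the difference of the two sides has a positive maximum, its time
    derivative is nonnegative and its second space derivative nonpositive, against the strict
    supersolution. *)
Lemma comparison e del X : 0 < e <= 1 -> 0 < del -> 1 <= X -> A <= del * exp (X ^ 2) ->
  forall t x, 0 < t <= S -> 0 < x <= X ->
  d t x <= A * exp (a + 1) * barrier (corner_rate e) (corner_shift e) t x +
           del * barrier (growth_rate b) (growth_shift b) t x.
Proof.
  move=> He Hdel HX HAX.
  set K := A * exp (a + 1). set h := barrier (corner_rate e) (corner_shift e).
  set B := barrier (growth_rate b) (growth_shift b).
  have K0 : 0 <= K by apply: Rmult_le_pos => //; apply: Rlt_le; exact: exp_pos.
  have Hb : 0 < b by rewrite /b; lra.
  have He2 : 0 < e ^ 2 by apply: pow_lt; lra.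
  pose v t x := d t x - K * h t x - del * B t x.
  have hp : forall t x, 0 < h t x by move=> t x; exact: barrier_pos.
  have Bp : forall t x, 0 < B t x by move=> t x; exact: barrier_pos.
  have d_le : forall t x, d t x <= 0 -> v t x <= 0.
  { move=> t x H1. rewrite /v. have := hp t x. have := Bp t x. nra. }
  (* near the origin the corner barrier dominates the bound for [d] *)
  have corner : forall t x, quarter_punctured t x -> t <= S -> t <= e ^ 2 -> x <= e -> v t x <= 0.
  { move=> t x [[Ht Hx] n] HtS Hte Hxe.
    case: (Rle_lt_or_eq_dec _ _ Ht) => [Ht0|E].
    - case: (Rle_lt_or_eq_dec _ _ Hx) => [Hx0|E].
      + have G := growth_d t x (conj Ht0 HtS) Hx0.
        have Hx2 : x ^ 2 <= e ^ 2 by apply: pow_incr; lra.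
        have Hh : exp (-1) <= h t x.
        { rewrite /h /barrier /corner_rate /corner_shift. apply: exp_mono.
          have L : ln (1 + t / e ^ 2) <= 1.
          { have Hte' : 0 <= t / e ^ 2 <= 1.
            { split; first by apply: Rmult_le_pos; [lra|apply: inv_nonneg].
              apply: (proj2 (Rle_div_l _ _ _ _)); lra. }
            apply: (Rle_trans _ (ln (exp 1))); last by rewrite ln_exp; exact: Rle_refl.
            apply: ln_le; first lra. have := exp_ineq1_le 1. lra. }
          have Q : / (4 * (t + e ^ 2)) * x ^ 2 <= / 4.
          { have Hp : 0 < t + e ^ 2 by lra.
            have -> : / (4 * (t + e ^ 2)) * x ^ 2 = x ^ 2 / (t + e ^ 2) * / 4 by field; lra.
            have : x ^ 2 / (t + e ^ 2) <= 1 by apply: (proj2 (Rle_div_l _ _ _ _)); lra. lra. }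
          lra. }
        have Hdb : d t x <= A * exp a.
        { apply: (Rle_trans _ _ _ G). apply: Rmult_le_compat_l => //. apply: exp_mono.
          have : x ^ 2 <= 1 by rewrite -(pow1 2); apply: pow_incr; lra. nra. }
        have KK : K * exp (-1) = A * exp a.
        { rewrite /K Rmult_assoc -exp_plus. congr (_ * exp _). ring. }
        rewrite /v. have := Bp t x. nra.
      + apply: d_le. rewrite -E boundary_d //. exact: Rle_refl.
    - apply: d_le. rewrite -E initial_d; [exact: Rle_refl|]. case: Hx => // Ex. by case: n. }
  have far : forall t, 0 <= t <= S -> v t X <= 0.
  { move=> t [Ht HtS]. case: (Rle_lt_or_eq_dec _ _ Ht) => [Ht0|E].
    - have G := growth_d t X (conj Ht0 HtS) ltac:(lra).
      have HB : exp (b * X ^ 2) <= B t X.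
      { rewrite /B /barrier /growth_rate /growth_shift. apply: exp_mono.
        have := pow2_ge_0 X => X2. have P1 : 0 <= 16 * b * b * t by apply: Rmult_le_pos; nra.
        have P2 : 0 <= 5 * b * t by nra. nra. }
      have E : exp (b * X ^ 2) = exp (X ^ 2) * exp (a * X ^ 2) by rewrite -exp_plus /b; congr exp; ring.
      rewrite E in HB. have Pe := exp_pos (a * X ^ 2).
      rewrite /v. have := hp t X.
      have : A * exp (a * X ^ 2) <= del * (exp (X ^ 2) * exp (a * X ^ 2)) by nra. nra.
    - apply: d_le. rewrite -E initial_d; lra. }
  have cont_v : continuous2_on quarter_punctured v.
  { have CK : continuous2_on quarter_punctured (fun t x => -1 * (K * h t x + del * B t x)).
    { move=> [t x] [[Ht Hx] _]. apply: filterlim_within. rewrite /= in Ht Hx |- *.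
      have Hte : 0 < t + e ^ 2 by lra.
      cont; apply: continuous_barrier; rewrite /=.
      - rewrite /corner_rate. cont. lra.
      - rewrite /corner_shift. cont; last lra.
        apply: (ex_derive_continuous ln). exists (/ (1 + t / e ^ 2)). apply: is_derive_ln.
        have : 0 <= t / e ^ 2 by apply: Rmult_le_pos => //; apply: inv_nonneg. lra.
      - rewrite /growth_rate. cont.
      - rewrite /growth_shift. cont. }
    apply: (continuous2_on_ext _ (fun t x => d t x + -1 * (K * h t x + del * B t x))).
    - move=> t x _. rewrite /v. ring.
    - exact: continuous2_on_plus. }
  (* the positive part of [v] vanishes near the origin, so it is continuous there *)
  pose z t x := if excluded_middle_informative (quarter_punctured t x) then Rmax (v t x) 0 else 0.
  have zE : forall t x, quarter_punctured t x -> z t x = Rmax (v t x) 0.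
  { move=> t x Q. by rewrite /z; case: excluded_middle_informative. }
  have z0 : forall t x, 0 <= z t x.
  { move=> t x. rewrite /z. case: excluded_middle_informative => _; [exact: Rmax_r|exact: Rle_refl]. }
  have cont_z : continuous2_on quarter z.
  { move=> [t x] Q. rewrite /= in Q.
    have HW : Filter (within (fun p : R * R => quarter (fst p) (snd p)) (locally (t, x))) by apply: within_filter.
    apply: filterlim_R => eps Heps /=.
    case: (classic (t = 0 /\ x = 0)) => [[-> ->]|n].
    - have Hm : 0 < Rmin S (Rmin (e ^ 2) e) by apply: Rmin_pos => //; apply: Rmin_pos; lra.
      exists (mkposreal _ Hm) => [[t' x']] [Ht' Hx'] Q'. rewrite /= in Q' |- *.
      have L1 := Rmin_l S (Rmin (e ^ 2) e). have L2 := Rmin_r S (Rmin (e ^ 2) e).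
      have L3 := Rmin_l (e ^ 2) e. have L4 := Rmin_r (e ^ 2) e.
      have {}Ht' : Rabs (t' - 0) < Rmin S (Rmin (e ^ 2) e) by exact: Ht'.
      have {}Hx' : Rabs (x' - 0) < Rmin S (Rmin (e ^ 2) e) by exact: Hx'.
      move: (Rabs_def2 _ _ Ht') (Rabs_def2 _ _ Hx') => T' X'.
      have -> : z 0 0 = 0.
      { rewrite /z. case: excluded_middle_informative => // [[_ n]]. by case: n. }
      have -> : z t' x' = 0; last by rewrite Rminus_diag Rabs_R0.
      rewrite /z. case: excluded_middle_informative => // QP. apply: Rmax_right. apply: corner => //; lra.
    - have QP : quarter_punctured t x by split.
      have H1 := filterlim_R_eps _ _ _ (cont_v (t, x) QP) eps Heps. rewrite /= in H1.
      have Hopen : locally (t, x) (fun p : R * R => ~ (fst p = 0 /\ snd p = 0)).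
      { have Hpos : 0 < Rmax t x.
        { case: Q => [[Ht|Et] [Hx|Ex]]; try (apply: Rlt_le_trans (Rmax_l _ _); assumption);
            try (apply: Rlt_le_trans (Rmax_r _ _); assumption). by case: n. }
        exists (mkposreal _ Hpos) => [[t' x']] [Ht' Hx'] [E1 E2]. rewrite /= in E1 E2. rewrite E1 in Ht'. rewrite E2 in Hx'.
        have {}Ht' : Rabs (0 - t) < Rmax t x by exact: Ht'.
        have {}Hx' : Rabs (0 - x) < Rmax t x by exact: Hx'.
        move: (Rabs_def2 _ _ Ht') (Rabs_def2 _ _ Hx') => T' X'.
        move: T' X'. rewrite /Rmax. case: Rle_dec => _; lra. }
      rewrite /within in H1 |- *. apply: filter_imp (filter_and _ _ H1 Hopen) => [[t' x']] /= [G G'] Q'.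
      have QP' : quarter_punctured t' x' by split.
      rewrite !zE //. have {}G := G QP'.
      apply: Rle_lt_trans G.
      have U1 := Rle_abs (v t' x' - v t x). have U2 := Rle_abs (- (v t' x' - v t x)). rewrite Rabs_Ropp in U2.
      apply: Rabs_le. rewrite /Rmax. case: Rle_dec => ?; case: Rle_dec => ?; lra. }
  have [t0 [x0 [Ht0 [Hx0 Hmax]]]] := maximum_on_rectangle z S X cont_z ltac:(lra) ltac:(lra).
  case: (Rle_lt_dec (z t0 x0) 0) => Hz.
  { move=> t x Ht Hx.
    have QP : quarter_punctured t x by split; [split; lra|lra].
    have := Hmax t x ltac:(lra) ltac:(lra). rewrite zE // => H1.
    have HV : v t x <= 0 by have := Rmax_l (v t x) 0; lra. move: HV. rewrite /v. lra. }
  exfalso.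
  have QP : quarter_punctured t0 x0.
  { move: Hz. rewrite /z. case: excluded_middle_informative => //; lra. }
  have zv : z t0 x0 = v t0 x0.
  { move: Hz. rewrite zE // /Rmax. case: Rle_dec => //; lra. }
  rewrite zv in Hz Hmax.
  have vmax : forall t x, 0 <= t <= S -> 0 <= x <= X -> quarter_punctured t x -> v t x <= v t0 x0.
  { move=> t x Ht Hx Q. apply: Rle_trans (Hmax t x Ht Hx). rewrite zE //. exact: Rmax_l. }
  have t0p : 0 < t0.
  { case: (proj1 Ht0) => // E. have x0p : 0 < x0.
    { case: (proj1 Hx0) => // E'. by case: (proj2 QP). }
    have := d_le t0 x0. rewrite -{1}E initial_d // => /(_ (Rle_refl 0)). lra. }
  have x0p : 0 < x0.
  { case: (proj1 Hx0) => // E. have := d_le t0 x0. rewrite -{1}E boundary_d // => /(_ (Rle_refl 0)). lra. }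
  have x0X : x0 < X.
  { case: (proj2 Hx0) => // E. have := far t0 Ht0. rewrite -E. lra. }
  have [D1 [D2 [D3 D4]]] := heat_d t0 x0 t0p x0p.
  have Hte : 0 < t0 + e ^ 2 by lra.
  have Dcr : is_derive (corner_rate e) t0 (/ (4 * (t0 + e ^ 2) ^ 2)).
  { rewrite /corner_rate. auto_derive; first lra. rewrite /= in He2 Hte. field. rewrite /=. lra. }
  have Dcs : is_derive (corner_shift e) t0 (- / (2 * (t0 + e ^ 2))).
  { have P1 : 0 <= t0 / e ^ 2 by apply: Rmult_le_pos; [lra|apply: inv_nonneg].
    rewrite /corner_shift. auto_derive; first by rewrite /= in P1 |- *; lra.
    rewrite /= in He2 Hte P1 |- *. field. lra. }
  have Dgr : is_derive (growth_rate b) t0 (16 * b ^ 2).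
  { rewrite /growth_rate. auto_derive => //. ring. }
  have Dgs : is_derive (growth_shift b) t0 (5 * b).
  { rewrite /growth_shift. auto_derive => //. ring. }
  set ht := (/ (4 * (t0 + e ^ 2) ^ 2) * x0 ^ 2 + - / (2 * (t0 + e ^ 2))) * h t0 x0.
  set Bt := (16 * b ^ 2 * x0 ^ 2 + 5 * b) * B t0 x0.
  set hxx := (2 * corner_rate e t0 + 4 * corner_rate e t0 ^ 2 * x0 ^ 2) * h t0 x0.
  set Bxx := (2 * growth_rate b t0 + 4 * growth_rate b t0 ^ 2 * x0 ^ 2) * B t0 x0.
  have Vt : is_derive (fun t => v t x0) t0 (Derive (fun t => d t x0) t0 - K * ht - del * Bt).
  { rewrite /v. apply: (is_derive_minus (V := R_NormedModule)).
    - apply: (is_derive_minus (V := R_NormedModule)); first exact: Derive_correct.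
      apply: is_derive_scal. exact: is_derive_barrier_t.
    - apply: is_derive_scal. exact: is_derive_barrier_t. }
  have Vt0 : 0 <= Derive (fun t => d t x0) t0 - K * ht - del * Bt.
  { apply: (is_derive_left_max _ _ _ t0 Vt t0p) => s Hs. apply: vmax; [lra|lra|]. split; [split|]; lra. }
  pose v1 x := Derive (d t0) x - K * (2 * corner_rate e t0 * x * h t0 x) - del * (2 * growth_rate b t0 * x * B t0 x).
  have Vx : forall x, 0 < x -> is_derive (v t0) x (v1 x).
  { move=> x Hx. have [_ [D2' _]] := heat_d t0 x t0p Hx. rewrite /v /v1.
    apply: (is_derive_minus (V := R_NormedModule)).
    - apply: (is_derive_minus (V := R_NormedModule)); first exact: Derive_correct.
      apply: is_derive_scal. exact: is_derive_barrier_x.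
    - apply: is_derive_scal. exact: is_derive_barrier_x. }
  have Vxx : is_derive v1 x0 (Derive (Derive (d t0)) x0 - K * hxx - del * Bxx).
  { rewrite /v1. apply: (is_derive_minus (V := R_NormedModule)).
    - apply: (is_derive_minus (V := R_NormedModule)); first exact: Derive_correct.
      apply: is_derive_scal. exact: is_derive_barrier_xx.
    - apply: is_derive_scal. exact: is_derive_barrier_xx. }
  have Vxx0 : Derive (Derive (d t0)) x0 - K * hxx - del * Bxx <= 0.
  { have Hr : 0 < Rmin x0 (X - x0) by apply: Rmin_pos; lra.
    have R1 := Rmin_l x0 (X - x0). have R2 := Rmin_r x0 (X - x0).
    apply: (second_derivative_max (v t0) v1 x0 _ _ Hr) => // y /Rabs_def2 Hy.
    - apply: Vx. lra.
    - apply: vmax; [lra|lra|]. split; [split|]; lra. }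
  have Hh : hxx = ht.
  { rewrite /hxx /ht /corner_rate. congr (_ * _). field. lra. }
  have HB : Bxx < Bt.
  { rewrite /Bxx /Bt. apply: Rmult_lt_compat_r; first exact: Bp.
    have Hg : b <= growth_rate b t0 <= 2 * b.
    { rewrite /growth_rate. have : 16 * b * t0 <= 1.
      { apply: Rle_trans S_small. rewrite -/b. apply: Rmult_le_compat_l; [lra|lra]. }
      have : 0 <= 16 * b * t0 by nra. nra. }
    have : growth_rate b t0 ^ 2 <= (2 * b) ^ 2 by apply: pow_incr; lra.
    have := pow2_ge_0 x0. nra. }
  rewrite Hh in Vxx0. nra.
Qed.

(** The far end [X] of the rectangle tends to infinity with [1 / del], and then [del] and [e] tend
    to [0]. *)
Lemma short_time_nonpos t x : 0 < t <= S -> 0 < x -> d t x <= 0.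
Proof.
  move=> Ht Hx. apply: Rnot_lt_le => Hd.
  set K := A * exp (a + 1).
  have K0 : 0 <= K by apply: Rmult_le_pos => //; apply: Rlt_le; exact: exp_pos.
  set Bv := barrier (growth_rate b) (growth_shift b) t x.
  have HB : 0 < Bv by exact: barrier_pos.
  set del := d t x / (4 * Bv).
  have Hdel : 0 < del by apply: Rdiv_lt_0_compat; lra.
  set eta := d t x / (4 * (K + 1)).
  have Heta : 0 < eta by apply: Rdiv_lt_0_compat; lra.
  set e := Rmin 1 (eta * sqrt t).
  have Hst : 0 < sqrt t by apply: sqrt_lt_R0; lra.
  have He : 0 < e <= 1 by split; [apply: Rmin_pos; nra|exact: Rmin_l].
  set X := 1 + x + A / del.
  have HAd : 0 <= A / del by apply: Rmult_le_pos => //; apply: inv_nonneg.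
  have HX : 1 <= X by rewrite /X; lra.
  have HAX : A <= del * exp (X ^ 2).
  { have L := exp_ineq1_le (X ^ 2).
    have : A / del <= exp (X ^ 2).
    { apply: (Rle_trans _ X); first by rewrite /X; lra. nra. }
    move=> L2. have := Rmult_le_compat_l del _ _ ltac:(lra) L2.
    have -> : del * (A / del) = A by field; lra. by []. }
  have HxX : 0 < x <= X by rewrite /X; lra.
  have := comparison e del X He Hdel HX HAX t x Ht HxX.
  rewrite -/K -/Bv.
  have -> : del * Bv = d t x / 4 by rewrite /del; field; lra.
  have Hh : barrier (corner_rate e) (corner_shift e) t x <= eta.
  { have He2 : 0 < e ^ 2 by apply: pow_lt; lra.
    have Hte : 0 < t / e ^ 2 by apply: Rdiv_lt_0_compat; lra.
    apply: (Rle_trans _ (exp (corner_shift e t))).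
    { apply: exp_mono. rewrite /corner_rate. have : 0 < / (4 * (t + e ^ 2)) by apply: Rinv_0_lt_compat; lra.
      have := pow2_ge_0 x. nra. }
    apply: Rsqr_incr_0; [|apply: Rlt_le; exact: exp_pos|lra].
    rewrite /Rsqr -exp_plus /corner_shift.
    have -> : - / 2 * ln (1 + t / e ^ 2) + - / 2 * ln (1 + t / e ^ 2) = - ln (1 + t / e ^ 2) by field.
    rewrite exp_Ropp exp_ln; last lra.
    have Hes : e ^ 2 <= eta * eta * t.
    { have -> : eta * eta * t = (eta * sqrt t) ^ 2.
      { have Hss : sqrt t * sqrt t = t by apply: sqrt_sqrt; lra. rewrite -{1}Hss. ring. }
      apply: pow_incr. split; [lra|exact: Rmin_r]. }
    apply: (Rle_trans _ (/ (t / e ^ 2))); first by apply: Rinv_le_contravar; lra.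
    have -> : / (t / e ^ 2) = e ^ 2 / t by field; lra.
    apply: (proj2 (Rle_div_l _ _ _ _)); lra. }
  have HKe : K * eta <= d t x / 4.
  { have -> : d t x / 4 = (K + 1) * eta by rewrite /eta; field; lra. nra. }
  nra.
Qed.

End ShortTime.

Lemma heat_equation_minus u v : heat_equation u -> heat_equation v -> heat_equation (fun t x => u t x - v t x).
Proof.
  move=> Hu Hv t x Ht Hx.
  have [A1 [A2 [A3 A4]]] := Hu t x Ht Hx. have [B1 [B2 [B3 B4]]] := Hv t x Ht Hx.
  have L : locally x (fun y => Derive (fun x => u t x - v t x) y = Derive (u t) y - Derive (v t) y).
  { apply: filter_imp (locally_gt x 0 Hx) => y Hy.
    have [_ [U _]] := Hu t y Ht Hy. have [_ [V _]] := Hv t y Ht Hy. exact: Derive_minus. }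
  have L' : locally x (fun y => Derive (u t) y - Derive (v t) y = Derive (fun x => u t x - v t x) y).
  { apply: filter_imp L => y. by []. }
  split; [|split; [|split]].
  - exact: (ex_derive_minus (V := R_NormedModule)).
  - exact: (ex_derive_minus (V := R_NormedModule)).
  - apply: (ex_derive_ext_loc _ _ _ L'). exact: (ex_derive_minus (V := R_NormedModule)).
  - rewrite (Derive_ext_loc _ _ _ L) !Derive_minus //. lra.
Qed.

Lemma heat_equation_zero : heat_equation (fun _ _ => 0).
Proof.
  move=> t x _ _.
  have E : Derive (fun _ => 0) = (fun _ => 0) by apply: functional_extensionality => y; exact: Derive_const.
  rewrite !E. split; [exact: ex_derive_const|split; [exact: ex_derive_const|split; [exact: ex_derive_const|ring]]].
Qed.

Lemma heat_equation_shift u t0 : 0 <= t0 -> heat_equation u -> heat_equation (fun t x => u (t0 + t) x).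
Proof.
  move=> Ht0 Hu t x Ht Hx.
  have [A1 [A2 [A3 A4]]] := Hu (t0 + t) x ltac:(lra) Hx.
  have D : is_derive (fun t => u (t0 + t) x) t (Derive (fun t => u t x) (t0 + t)).
  { rewrite -[X in is_derive _ _ X]Rmult_1_l.
    apply: (is_derive_comp (fun t => u t x) (fun t => t0 + t)); first exact: Derive_correct. auto_derive => //. }
  split; [by exists (Derive (fun t => u t x) (t0 + t))|split=> //; split=> //].
  by rewrite (is_derive_unique _ _ _ D).
Qed.

Lemma continuous2_on_shift u t0 : 0 <= t0 -> continuous2_on quarter_punctured u ->
  continuous2_on quarter_punctured (fun t x => u (t0 + t) x).
Proof.
  move=> Ht0 C [t x] Q P HP. rewrite /= in Q HP.
  have Q' : forall t x, quarter_punctured t x -> quarter_punctured (t0 + t) x.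
  { move=> t' x' [[H1 H2] n]. split; first by split; lra. move=> [E1 E2]. apply: n. split=> //. lra. }
  have [d Hd] := C (t0 + t, x) (Q' _ _ Q) P HP.
  exists d => [[t' x']] [H1 H2] QQ. apply: (Hd (t0 + t', x')); last exact: Q'.
  split=> //=. move: H1. rewrite /ball /= /AbsRing_ball /abs /= /minus /plus /opp /=.
  have -> : t0 + t' + - (t0 + t) = t' + - t by ring. by [].
Qed.

Lemma vanishing_solution d : heat_equation d -> continuous2_on quarter_punctured d ->
  (forall x, 0 < x -> d 0 x = 0) -> (forall t, 0 < t -> d t 0 = 0) -> moderate_growth d ->
  forall t x, 0 < t -> 0 < x -> d t x = 0.
Proof.
  move=> Hd Cd Id Bd Gd T x0 HT Hx0.
  have [A [a HAa]] := Gd T HT.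
  have G : forall t x, 0 < t <= T -> 0 < x -> Rabs (d t x) <= Rabs A * exp (Rabs a * x ^ 2).
  { move=> t x Ht Hx. apply: (Rle_trans _ _ _ (HAa t x Ht Hx)).
    apply: Rmult_le_compat; [| |exact: Rle_abs|].
    - have := Rabs_pos (d t x). have := HAa t x Ht Hx. have := exp_pos (a * x ^ 2). nra.
    - apply: Rlt_le. exact: exp_pos.
    - apply: exp_mono. apply: Rmult_le_compat_r; [exact: pow2_ge_0|exact: Rle_abs]. }
  set a' := Rabs a in G. have Ha' : 0 <= a' by exact: Rabs_pos.
  set S0 := / (16 * (a' + 1)).
  have HS0 : 0 < S0 by apply: Rinv_0_lt_compat; lra.
  (* the growth bound controls a time step of fixed length, whatever its starting time *)
  have Step : forall t0 t x, 0 <= t0 -> (forall x, 0 < x -> d t0 x = 0) -> 0 < t <= S0 -> t0 + t <= T -> 0 < x -> d (t0 + t) x = 0.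
  { move=> t0 t x Ht0 I0 Ht HtT Hx.
    have Hs : 16 * (a' + 1) * t <= 1.
    { have E : 16 * (a' + 1) * S0 = 1 by rewrite /S0; field; lra. apply: (Rle_trans _ (16 * (a' + 1) * S0)); last lra. apply: Rmult_le_compat_l; lra. }
    have H1 := heat_equation_shift d t0 Ht0 Hd. have C1 := continuous2_on_shift d t0 Ht0 Cd.
    have H2 := heat_equation_minus _ _ heat_equation_zero H1.
    have C2 : continuous2_on quarter_punctured (fun t x => 0 - d (t0 + t) x).
    { apply: (continuous2_on_ext _ (fun t x => 0 + -1 * d (t0 + t) x)); first by move=> u v _; ring.
      apply: continuous2_on_plus; first by move=> p _; exact: filterlim_const.
      apply: continuous2_on_mult => //. by move=> p _; exact: filterlim_const. }
    apply: Rle_antisym.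
    - apply: (short_time_nonpos (fun t x => d (t0 + t) x) H1 C1 _ _ (Rabs A) a' t (Rabs_pos A) Ha' (proj1 Ht) Hs _ t x) => //; try lra.
      + move=> y Hy. by rewrite Rplus_0_r I0.
      + move=> s Hs'. apply: Bd. lra.
      + move=> s y Hs' Hy. apply: (Rle_trans _ _ _ (Rle_abs _)). apply: G => //. lra.
    - have := short_time_nonpos (fun t x => 0 - d (t0 + t) x) H2 C2 _ _ (Rabs A) a' t (Rabs_pos A) Ha' (proj1 Ht) Hs _ t x.
      move=> K. have : 0 - d (t0 + t) x <= 0; last lra. apply: K => //; try lra.
      + move=> y Hy. by rewrite Rplus_0_r I0 // Rminus_0_r.
      + move=> s Hs'. rewrite Bd; lra.
      + move=> s y Hs' Hy. have := G (t0 + s) y ltac:(lra) Hy. have := Rle_abs (- d (t0 + s) y). rewrite Rabs_Ropp. lra. }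
  have All : forall n t, 0 < t <= T -> t <= INR n * S0 -> forall x, 0 < x -> d t x = 0.
  { elim=> [|n IH] t Ht Htn x Hx; first by rewrite /= in Htn; lra.
    rewrite S_INR in Htn.
    case: (Rle_dec t (INR n * S0)) => K; first exact: IH.
    have P0 : 0 <= INR n * S0 by apply: Rmult_le_pos; [exact: pos_INR|lra].
    have -> : t = INR n * S0 + (t - INR n * S0) by ring.
    apply: Step => //; try lra.
    move=> y Hy. case: P0 => P0.
    - apply: IH => //; lra.
    - rewrite -P0. exact: Id. }
  have [n Hn] := INR_unbounded (T / S0).
  apply: (All n) => //; first lra.
  apply: (proj1 (Rle_div_l _ _ _ _)); lra.
Qed.

Lemma moderate_solution_unique phi psi u v : moderate_solution phi psi u -> moderate_solution phi psi v ->
  eq2_on quarter_punctured v u.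
Proof.
  move=> [Hu [[Cu [Iu Bu]] Gu]] [Hv [[Cv [Iv Bv]] Gv]].
  have C : continuous2_on quarter_punctured (fun t x => v t x - u t x).
  { apply: (continuous2_on_ext _ (fun t x => v t x + -1 * u t x)); first by move=> t x _; ring.
    apply: continuous2_on_plus => //. apply: continuous2_on_mult => //. by move=> p _; exact: filterlim_const. }
  have Z : forall t x, 0 < t -> 0 < x -> v t x - u t x = 0.
  { apply: (vanishing_solution (fun t x => v t x - u t x)) => //.
    - exact: heat_equation_minus.
    - move=> x Hx. rewrite Iu // Iv //. ring.
    - move=> t Ht. rewrite Bu // Bv //. ring.
    - move=> T HT. have [A [a HA]] := Gu T HT. have [A' [a' HA']] := Gv T HT.
      exists (Rabs A' + Rabs A), (Rmax a' a) => t x Ht Hx.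
      apply: (Rle_trans _ _ _ (Rabs_triang _ _)). rewrite Rabs_Ropp Rmult_plus_distr_r.
      have Ex : forall B b, b <= Rmax a' a -> B * exp (b * x ^ 2) <= Rabs B * exp (Rmax a' a * x ^ 2).
      { move=> B b Hb. apply: (Rle_trans _ (Rabs B * exp (b * x ^ 2))).
        - apply: Rmult_le_compat_r; [apply: Rlt_le; exact: exp_pos|exact: Rle_abs].
        - apply: Rmult_le_compat_l; first exact: Rabs_pos. apply: exp_mono. apply: Rmult_le_compat_r => //. exact: pow2_ge_0. }
      apply: Rplus_le_compat.
      + apply: (Rle_trans _ _ _ (HA' t x Ht Hx)). apply: Ex. exact: Rmax_l.
      + apply: (Rle_trans _ _ _ (HA t x Ht Hx)). apply: Ex. exact: Rmax_r. }
  move=> t x [[Ht Hx] n].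
  case: Ht => [Ht|Et]; case: Hx => [Hx|Ex].
  - have := Z t x Ht Hx. lra.
  - by rewrite -Ex Bu // Bv.
  - by rewrite -Et Iu // Iv.
  - by case: n.
Qed.

(** * The charts of the blown-up quarter plane *)

Definition positive_time (t x : R) : Prop := 0 < t /\ 0 <= x.
Definition positive_space (t x : R) : Prop := 0 <= t /\ 0 < x.

Lemma non_isolated_right (P : R -> Prop) (x : R) : (forall y, x < y -> P y) -> non_isolated P x.
Proof.
  move=> H d Hd. exists (x + d / 2). split; first by apply: H; lra. split; first lra.
  have -> : x + d / 2 - x = d / 2 by ring. rewrite Rabs_pos_eq; lra.
Qed.

Lemma perfect2_quarter : perfect2 quarter.
Proof. move=> a b [Ha Hb]. split; apply: non_isolated_right => y Hy; split; lra. Qed.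

Lemma perfect2_positive_time : perfect2 positive_time.
Proof. move=> a b [Ha Hb]. split; apply: non_isolated_right => y Hy; split; lra. Qed.

Lemma perfect2_positive_space : perfect2 positive_space.
Proof. move=> a b [Ha Hb]. split; apply: non_isolated_right => y Hy; split; lra. Qed.

Lemma perfect2_quarter_punctured : perfect2 quarter_punctured.
Proof. move=> a b [[Ha Hb] n]. split; apply: non_isolated_right => y Hy; (split; [split|]; lra). Qed.

Lemma open_positive_time : open_in2 quarter_punctured positive_time.
Proof.
  move=> a b [Ha _]. exists (mkposreal a Ha) => [[x y]] [Hx _] [[_ Hy] _]. split=> //=.
  have {}Hx : Rabs (x - a) < a by exact: Hx. have := Rabs_def2 _ _ Hx. lra.
Qed.

Lemma open_positive_space : open_in2 quarter_punctured positive_space.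
Proof.
  move=> a b [_ Hb]. exists (mkposreal b Hb) => [[x y]] [_ Hy] [[Hx _] _]. split=> //=.
  have {}Hy : Rabs (y - b) < b by exact: Hy. have := Rabs_def2 _ _ Hy. lra.
Qed.

Lemma quarter_punctured_cases t x : quarter_punctured t x -> positive_time t x \/ positive_space t x.
Proof.
  move=> [[[Ht|Et] [Hx|Ex]] n]; [left|left|right|]; try (split; lra). by case: n.
Qed.

Lemma positive_time_punctured t x : positive_time t x -> quarter_punctured t x.
Proof. move=> [Ht Hx]. split; [split; lra|lra]. Qed.

Lemma positive_space_punctured t x : positive_space t x -> quarter_punctured t x.
Proof. move=> [Ht Hx]. split; [split; lra|lra]. Qed.

Lemma Ck_rsqrt n : Ck positive_time n (fun t _ => / sqrt (2 * t)).
Proof.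
  have Hs : forall t, 0 < t -> 0 < sqrt (2 * t) by move=> t Ht; apply: sqrt_lt_R0; lra.
  have C : continuous2_on positive_time (fun t _ => / sqrt (2 * t)).
  { move=> [t x] [Ht Hx]. apply: filterlim_within. rewrite /= in Ht |- *. have := Hs t Ht => Hst.
    cont; [rewrite /=; lra|exact: continuous_sqrt]. }
  elim: n => [|n IH]; split=> //.
  exists (fun t _ => -1 * (/ sqrt (2 * t) * (/ sqrt (2 * t) * / sqrt (2 * t)))), (fun _ _ => 0).
  split; last by split; [apply: Ck_scal; apply: Ck_mult => //; exact: Ck_mult|exact: Ck_const].
  move=> t x [Ht Hx]. split; apply: is_derive_on_of_is_derive => //; last exact: is_derive_const.
  have Hst := Hs t Ht. auto_derive; first by split; [lra|split=> //; lra]. field. lra.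
Qed.

Lemma Ck_inv n : Ck positive_space n (fun _ x => / x).
Proof.
  have C : continuous2_on positive_space (fun _ x => / x).
  { move=> [t x] [Ht Hx]. apply: filterlim_within. rewrite /= in Hx |- *. cont. rewrite /=; lra. }
  elim: n => [|n IH]; split=> //.
  exists (fun _ _ => 0), (fun _ x => -1 * (/ x * / x)).
  split; last by split; [exact: Ck_const|apply: Ck_scal; exact: Ck_mult].
  move=> t x [Ht Hx]. split; apply: is_derive_on_of_is_derive => //; first exact: is_derive_const.
  auto_derive; first lra. field. lra.
Qed.

(** Each chart is a smooth change of variables away from its exceptional side, and the two charts
    cover the quarter plane without the origin. *)
Lemma Ck_of_charts n (u v w : R -> R -> R) : Ck quarter n v -> Ck quarter n w ->
  (forall t x, positive_time t x -> u t x = v (sqrt (2 * t)) (x / sqrt (2 * t))) ->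
  (forall t x, positive_space t x -> u t x = w (t / x ^ 2) x) ->
  Ck quarter_punctured n u.
Proof.
  move=> Hv Hw Ev Ew.
  have Hs : forall t, 0 < t -> 0 < sqrt (2 * t) by move=> t Ht; apply: sqrt_lt_R0; lra.
  apply: (Ck_glue _ positive_time positive_space).
  - exact: perfect2_positive_time.
  - exact: perfect2_positive_space.
  - exact: open_positive_time.
  - exact: open_positive_space.
  - exact: positive_time_punctured.
  - exact: positive_space_punctured.
  - exact: quarter_punctured_cases.
  - apply: (Ck_ext _ _ (fun t x => v (sqrt (2 * t)) (x / sqrt (2 * t)))); first exact: Ev.
    apply: Ck_comp => //.
    + move=> t x [Ht Hx]. have := Hs t Ht => Hst. split; first lra.
      apply: Rmult_le_pos => //. exact: inv_nonneg.
    + apply: (Ck_ext _ _ (fun t _ => 2 * (t * / sqrt (2 * t)))).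
      * move=> t x [Ht Hx]. have Hst := Hs t Ht.
        have E : sqrt (2 * t) * sqrt (2 * t) = 2 * t by apply: sqrt_sqrt; lra.
        have -> : 2 * (t * / sqrt (2 * t)) = (sqrt (2 * t) * sqrt (2 * t)) * / sqrt (2 * t) by rewrite E; ring.
        field. lra.
      * apply: Ck_scal. apply: Ck_mult; [exact: Ck_coord1|exact: Ck_rsqrt].
    + apply: Ck_mult; [exact: Ck_coord2|exact: Ck_rsqrt].
  - apply: (Ck_ext _ _ (fun t x => w (t / x ^ 2) x)); first exact: Ew.
    apply: (Ck_comp _ _ w (fun t x => t / x ^ 2) (fun _ x => x)) => //.
    + move=> t x [Ht Hx]. split; last lra. apply: Rmult_le_pos => //. apply: inv_nonneg. exact: square_pos.
    + apply: (Ck_ext _ _ (fun t x => t * (/ x * / x))).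
      * move=> t x [Ht Hx]. field. lra.
      * apply: Ck_mult; [exact: Ck_coord1|apply: Ck_mult; exact: Ck_inv].
    + exact: Ck_coord2.
Qed.

Lemma smooth2_on_of_Ck D f : perfect2 D -> (forall n, Ck D n f) -> smooth2_on D f.
Proof. move=> P H n. exact: Ck2_on_of_Ck. Qed.

Lemma smooth2_on_ext D f g : perfect2 D -> eq2_on D g f -> smooth2_on D f -> smooth2_on D g.
Proof.
  move=> P E H. apply: smooth2_on_of_Ck => // n. apply: Ck_ext E _. exact: Ck_of_Ck2_on.
Qed.

Lemma smooth_Qh_ext u u' : eq2_on quarter_punctured u' u -> smooth_Qh u -> smooth_Qh u'.
Proof.
  move=> E [H [[v [Sv Ev]] [w [Sw Ew]]]]. split; [|split].
  - apply: smooth2_on_ext E H. exact: perfect2_quarter_punctured.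
  - exists v. split=> // tau s Htau Hs. rewrite Ev // E //. apply: positive_time_punctured.
    have := square_pos tau Htau. split; [lra|apply: Rmult_le_pos; lra].
  - exists w. split=> // T y HT Hy. rewrite Ew // E //. apply: positive_space_punctured.
    have := square_pos y Hy. split=> //. apply: Rmult_le_pos; lra.
Qed.

Lemma heat_equation_intro (u u1 u2 : R -> R -> R) :
  (forall t x, 0 < t -> 0 < x -> is_derive (fun t => u t x) t (u2 t x)) ->
  (forall t x, 0 < t -> 0 < x -> is_derive (u t) x (u1 t x)) ->
  (forall t x, 0 < t -> 0 < x -> is_derive (u1 t) x (u2 t x)) -> heat_equation u.
Proof.
  move=> H1 H2 H3 t x Ht Hx.
  have L : locally x (fun y => u1 t y = Derive (u t) y).
  { apply: filter_imp (locally_gt x 0 Hx) => y Hy. by rewrite (is_derive_unique _ _ _ (H2 t y Ht Hy)). }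
  have D2 : is_derive (Derive (u t)) x (u2 t x) by apply: (is_derive_ext_loc _ _ _ _ L); exact: H3.
  split; [by exists (u2 t x); exact: H1|split; [by exists (u1 t x); exact: H2|split; [by exists (u2 t x)|]]].
  rewrite (is_derive_unique _ _ _ (H1 t x Ht Hx)) (is_derive_unique _ _ _ D2). ring.
Qed.

(** * The corner layer as a solution *)

Section CornerSolution.

Variable D : nat -> R -> R.
Hypothesis HD : bounded_jet D.

Definition corner_solution (t x : R) : R :=
  if Rlt_dec 0 t then / (2 * integral gauss) * inner_layer D 0 0 0 (sqrt (2 * t)) (x / sqrt (2 * t)) else 0.

(** The derivatives in [x]; the second one is also the time derivative, by [inner_layer_heat]. *)
Definition corner_solution_x (t x : R) : R :=
  / (2 * integral gauss) * (/ sqrt (2 * t) * - inner_layer D 0 0 1 (sqrt (2 * t)) (x / sqrt (2 * t))).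

Definition corner_solution_xx (t x : R) : R :=
  / (2 * integral gauss) * (/ (2 * t) * (inner_layer D 0 0 2 (sqrt (2 * t)) (x / sqrt (2 * t)) -
    inner_layer D 0 0 0 (sqrt (2 * t)) (x / sqrt (2 * t)))).

Lemma corner_solution_pos t x : 0 < t -> corner_solution t x =
  / (2 * integral gauss) * inner_layer D 0 0 0 (sqrt (2 * t)) (x / sqrt (2 * t)).
Proof. by rewrite /corner_solution; case: (Rlt_dec 0 t). Qed.

Lemma corner_solution_initial x : corner_solution 0 x = 0.
Proof. rewrite /corner_solution. case: (Rlt_dec 0 0) => // H. lra. Qed.

Lemma is_derive_inner_layer_s b tau x k : 0 < tau -> 0 < x ->
  is_derive (fun x => k * inner_layer D 0 0 b tau (x / tau)) x
    (k * (/ tau * (INR b * inner_layer D 0 0 (pred b) tau (x / tau) - inner_layer D 0 0 (S b) tau (x / tau)))).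
Proof.
  move=> Ht Hx. have Hxt : 0 < x / tau by exact: Rdiv_lt_0_compat.
  apply: is_derive_scal.
  apply: (is_derive_comp (inner_layer D 0 0 b tau) (fun x => x / tau)).
  - apply: (is_derive_of_is_derive_on half_line); first exact: locally_half_line.
    apply: is_derive_on_inner_layer_s => //. lra.
  - auto_derive => //. ring.
Qed.

Lemma corner_solution_heat_x t x : 0 < t -> 0 < x -> is_derive (corner_solution t) x (corner_solution_x t x).
Proof.
  move=> Ht Hx. have Hs : 0 < sqrt (2 * t) by apply: sqrt_lt_R0; lra.
  apply: (is_derive_ext (fun x => / (2 * integral gauss) * inner_layer D 0 0 0 (sqrt (2 * t)) (x / sqrt (2 * t)))).
  { move=> y. by rewrite corner_solution_pos. }
  rewrite /corner_solution_x.
  have -> : forall z, - z = INR 0 * inner_layer D 0 0 (pred 0) (sqrt (2 * t)) (x / sqrt (2 * t)) - z by move=> z /=; ring.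
  exact: is_derive_inner_layer_s.
Qed.

Lemma corner_solution_heat_xx t x : 0 < t -> 0 < x -> is_derive (corner_solution_x t) x (corner_solution_xx t x).
Proof.
  move=> Ht Hx. have Hs : 0 < sqrt (2 * t) by apply: sqrt_lt_R0; lra.
  have E : sqrt (2 * t) * sqrt (2 * t) = 2 * t by apply: sqrt_sqrt; lra.
  apply: (is_derive_ext (fun x => - (/ (2 * integral gauss) * / sqrt (2 * t)) * inner_layer D 0 0 1 (sqrt (2 * t)) (x / sqrt (2 * t)))).
  { move=> y. rewrite /corner_solution_x. change (@eq R
      (- (/ (2 * integral gauss) * / sqrt (2 * t)) * inner_layer D 0 0 1 (sqrt (2 * t)) (y / sqrt (2 * t)))
      (/ (2 * integral gauss) * (/ sqrt (2 * t) * - inner_layer D 0 0 1 (sqrt (2 * t)) (y / sqrt (2 * t))))). ring. }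
  have -> : corner_solution_xx t x = - (/ (2 * integral gauss) * / sqrt (2 * t)) * (/ sqrt (2 * t) *
     (INR 1 * inner_layer D 0 0 (pred 1) (sqrt (2 * t)) (x / sqrt (2 * t)) - inner_layer D 0 0 2 (sqrt (2 * t)) (x / sqrt (2 * t)))).
  { rewrite /corner_solution_xx.
    have -> : / (2 * t) = / sqrt (2 * t) * / sqrt (2 * t) by rewrite -{1}E Rinv_mult.
    rewrite [pred 1]/= [INR 1]/=. ring. }
  exact: is_derive_inner_layer_s.
Qed.

Lemma corner_solution_heat_t t x : 0 < t -> 0 < x ->
  is_derive (fun t => corner_solution t x) t (corner_solution_xx t x).
Proof.
  move=> Ht Hx. have Hs : 0 < sqrt (2 * t) by apply: sqrt_lt_R0; lra.
  have E : sqrt (2 * t) * sqrt (2 * t) = 2 * t by apply: sqrt_sqrt; lra.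
  pose P t := 0 < t.
  have Lt : locally t P by exact: locally_gt.
  apply: (is_derive_ext_loc (fun t => / (2 * integral gauss) * inner_layer D 0 0 0 (sqrt (2 * t)) (x / sqrt (2 * t)))).
  { apply: filter_imp Lt => y Hy. by rewrite corner_solution_pos. }
  apply: is_derive_scal. apply: (is_derive_of_is_derive_on P) => //.
  set tau := sqrt (2 * t) in Hs E |- *.
  have Hxt : 0 <= x / tau by apply: Rlt_le; exact: Rdiv_lt_0_compat.
  have -> : / (2 * t) * (inner_layer D 0 0 2 tau (x / tau) - inner_layer D 0 0 0 tau (x / tau)) =
    inner_layer D 1 1 0 tau (x / tau) * / tau +
    (INR 0 * inner_layer D 0 0 (pred 0) tau (x / tau) - inner_layer D 0 0 1 tau (x / tau)) * - (x / (tau * tau * tau)).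
  { rewrite -(inner_layer_heat D HD tau _ Hxt) -E /=. field. lra. }
  apply: (is_derive_on_comp2 P (inner_layer D 0 0 0) (inner_layer D 1 1 0)
    (fun tau s => INR 0 * inner_layer D 0 0 (pred 0) tau s - inner_layer D 0 0 1 tau s)
    (fun t => sqrt (2 * t)) (fun t => x / sqrt (2 * t))) => //.
  - move=> p r [Hp Hr]. split.
    + apply: is_derive_on_of_is_derive => //. exact: is_derive_inner_layer_tau.
    + apply: (is_derive_on_local _ half_line (inner_layer D 0 0 0 p)) => //; last exact: is_derive_on_inner_layer_s.
      apply: locally_true => y [_ Hy]. by split.
  - exact: continuous2_on_inner_layer.
  - apply: (continuous2_on_ext _ (fun tau s => -1 * inner_layer D 0 0 1 tau s)); first by move=> p r _ /=; ring.
    apply: continuous2_on_mult; [by move=> p _; exact: filterlim_const|exact: continuous2_on_inner_layer].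
  - move=> y Hy. have Hsy : 0 < sqrt (2 * y) by apply: sqrt_lt_R0; rewrite /P in Hy; lra.
    split; first lra. apply: Rlt_le. exact: Rdiv_lt_0_compat.
  - apply: is_derive_on_of_is_derive => //. auto_derive; first lra. rewrite -/tau. field. lra.
  - apply: is_derive_on_of_is_derive => //. auto_derive; first by split; [lra|split=> //; rewrite -/tau; lra].
    rewrite -/tau. field. lra.
Qed.

Lemma corner_solution_bounded : exists M, forall t x, 0 <= x -> Rabs (corner_solution t x) <= M.
Proof.
  have [M [HM H]] := inner_layer_dominated D HD 0 0 0.
  have P := integral_gauss_pos. have Pi : 0 < / (2 * integral gauss) by apply: Rinv_0_lt_compat; lra.
  exists (/ (2 * integral gauss) * (2 * M)) => t x Hx.
  case: (Rlt_dec 0 t) => Ht; last first.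
  { rewrite /corner_solution. case: (Rlt_dec 0 t) => // _. rewrite Rabs_R0. apply: Rmult_le_pos; lra. }
  have Hs : 0 < sqrt (2 * t) by apply: sqrt_lt_R0; lra.
  rewrite corner_solution_pos // Rabs_mult Rabs_pos_eq; last lra.
  apply: Rmult_le_compat_l; first lra. apply: integral_bound; first exact: continuous_pos_inner_layer_integrand.
  apply: H. apply: Rmult_le_pos => //. exact: inv_nonneg.
Qed.

(** At [x = 0] only half of the line contributes, and the other half contributes the same if [D] is
    even. *)
Lemma corner_solution_boundary t : (forall x, D 0 (- x) = D 0 x) -> 0 < t ->
  corner_solution t 0 = / 2 * line_solution D 0 t 0.
Proof.
  move=> Even Ht. rewrite corner_solution_pos // /line_solution.
  have -> : 0 / sqrt (2 * t) = 0 by rewrite /Rdiv Rmult_0_l.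
  rewrite inner_layer_at_zero.
  have -> : moment (D 0) 0 (- sqrt (2 * t)) 0 = moment (D 0) 0 (sqrt (2 * t)) 0.
  { apply: integral_ext => z _. rewrite /moment_integrand !Rplus_0_l Ropp_mult_distr_l_reverse Even. by []. }
  field. have := integral_gauss_pos. lra.
Qed.

Lemma corner_solution_blowup tau s : 0 < tau ->
  corner_solution (tau ^ 2 / 2) (tau * s) = / (2 * integral gauss) * inner_layer D 0 0 0 tau s.
Proof.
  move=> Ht. have H2 := square_pos tau Ht. rewrite corner_solution_pos; last lra.
  have -> : sqrt (2 * (tau ^ 2 / 2)) = tau.
  { have -> : 2 * (tau ^ 2 / 2) = tau ^ 2 by field. rewrite sqrt_pow2 //. lra. }
  have -> : tau * s / tau = s by field; lra. by [].
Qed.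

Lemma corner_solution_side T y : 0 <= T -> 0 < y ->
  corner_solution (T * y ^ 2) y = / (2 * integral gauss * sqrt 2) * outer_layer D 0 0 1 0 T y.
Proof.
  move=> [HT|<-] Hy; last by rewrite Rmult_0_l corner_solution_initial (outer_layer_initial D HD); ring.
  have H2 := square_pos y Hy. have Hs : 0 < sqrt (2 * T) by apply: sqrt_lt_R0; lra.
  have P := integral_gauss_pos. have S2 : 0 < sqrt 2 by apply: sqrt_lt_R0; lra.
  rewrite corner_solution_pos; last exact: Rmult_lt_0_compat.
  have -> : sqrt (2 * (T * y ^ 2)) = y * sqrt (2 * T).
  { have -> : 2 * (T * y ^ 2) = (2 * T) * y ^ 2 by ring. rewrite sqrt_mult; [|lra|lra]. rewrite sqrt_pow2; [ring|lra]. }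
  have -> : y / (y * sqrt (2 * T)) = / sqrt (2 * T) by field; lra.
  rewrite inner_layer_eq_outer_layer //. field. lra.
Qed.

End CornerSolution.

(** * The solution *)

Section Solution.

Variables F D H : nat -> R -> R.
Hypothesis HF : bounded_jet F.
Hypothesis HD : bounded_jet D.
Hypothesis HH : bounded_jet H.
Hypothesis H_past : forall k t, t <= 0 -> H k t = 0.
Hypothesis D_even : forall x, D 0 (- x) = D 0 x.

Definition solution (t x : R) : R := line_solution F 0 t x + corner_solution D t x + dirichlet H 0 t x.

Lemma solution_heat : heat_equation solution.
Proof.
  apply: (heat_equation_intro solution
    (fun t x => line_solution F 1 t x + corner_solution_x D t x + - neumann H 1 t x)
    (fun t x => line_solution F 2 t x + corner_solution_xx D t x + dirichlet H 1 t x)) => t x Ht Hx.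
  - apply: (is_derive_plus (V := R_NormedModule)); last exact: is_derive_dirichlet_t.
    apply: (is_derive_plus (V := R_NormedModule)); [exact: is_derive_line_solution_t|exact: corner_solution_heat_t].
  - apply: (is_derive_plus (V := R_NormedModule)); last exact: is_derive_dirichlet_x.
    apply: (is_derive_plus (V := R_NormedModule)); [exact: is_derive_line_solution_x|exact: corner_solution_heat_x].
  - apply: (is_derive_plus (V := R_NormedModule)); last first.
    { rewrite -[dirichlet H 1 t x]Ropp_involutive. apply: (is_derive_opp (V := R_NormedModule)). exact: is_derive_neumann_x. }
    apply: (is_derive_plus (V := R_NormedModule)); [exact: is_derive_line_solution_x|exact: corner_solution_heat_xx].
Qed.

Definition solution_blowup (tau s : R) : R :=
  line_solution F 0 (tau ^ 2 / 2) (tau * s) + / (2 * integral gauss) * inner_layer D 0 0 0 tau s +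
  dirichlet H 0 (tau ^ 2 / 2) (tau * s).

Definition solution_side (T y : R) : R :=
  line_solution F 0 (T * y ^ 2) y + / (2 * integral gauss * sqrt 2) * outer_layer D 0 0 1 0 T y +
  dirichlet H 0 (T * y ^ 2) y.

Lemma solution_blowup_eq tau s : 0 < tau -> solution_blowup tau s = solution (tau ^ 2 / 2) (tau * s).
Proof. move=> Ht. by rewrite /solution corner_solution_blowup. Qed.

Lemma solution_side_eq T y : 0 <= T -> 0 < y -> solution_side T y = solution (T * y ^ 2) y.
Proof. move=> HT Hy. by rewrite /solution corner_solution_side. Qed.

Lemma Ck_solution_blowup n : Ck quarter n solution_blowup.
Proof.
  have Hc : Ck quarter n (fun tau _ => tau ^ 2 / 2).
  { apply: (Ck_ext _ _ (fun tau _ => / 2 * (tau * tau))); first by move=> a b _; field.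
    apply: Ck_scal. apply: Ck_mult; exact: Ck_coord1. }
  have Hm : Ck quarter n (fun tau s => tau * s) by apply: Ck_mult; [exact: Ck_coord1|exact: Ck_coord2].
  have Hq : forall p r, quarter p r -> quarter (p ^ 2 / 2) (p * r).
  { move=> p r [Hp Hr]. split; [have := pow2_ge_0 p; lra|exact: Rmult_le_pos]. }
  apply: Ck_plus; [apply: Ck_plus|].
  - apply: (Ck_comp _ _ (line_solution F 0)) => //. exact: Ck_line_solution.
  - apply: Ck_scal. exact: Ck_inner_layer.
  - apply: (Ck_comp _ _ (dirichlet H 0)) => //. apply: (proj1 (Ck_potentials H HH H_past n 0)).
Qed.

Lemma Ck_solution_side n : Ck quarter n solution_side.
Proof.
  have Hc : Ck quarter n (fun T y => T * y ^ 2).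
  { apply: (Ck_ext _ _ (fun T y => T * (y * y))); first by move=> a b _ /=; ring.
    apply: Ck_mult; [exact: Ck_coord1|apply: Ck_mult; exact: Ck_coord2]. }
  have Hq : forall p r, quarter p r -> quarter (p * r ^ 2) r.
  { move=> p r [Hp Hr]. split=> //. apply: Rmult_le_pos => //. exact: pow2_ge_0. }
  apply: Ck_plus; [apply: Ck_plus|].
  - apply: (Ck_comp _ _ (line_solution F 0) (fun T y => T * y ^ 2) (fun _ y => y)) => //; [exact: Ck_line_solution|exact: Ck_coord2].
  - apply: Ck_scal. exact: Ck_outer_layer.
  - apply: (Ck_comp _ _ (dirichlet H 0) (fun T y => T * y ^ 2) (fun _ y => y)) => //; last exact: Ck_coord2.
    apply: (proj1 (Ck_potentials H HH H_past n 0)).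
Qed.

Lemma Ck_solution n : Ck quarter_punctured n solution.
Proof.
  apply: (Ck_of_charts n solution solution_blowup solution_side).
  - exact: Ck_solution_blowup.
  - exact: Ck_solution_side.
  - move=> t x [Ht Hx]. have Hs : 0 < sqrt (2 * t) by apply: sqrt_lt_R0; lra.
    rewrite solution_blowup_eq //. congr solution.
    + have -> : sqrt (2 * t) ^ 2 = 2 * t by rewrite pow2_sqrt; lra. field.
    + field. lra.
  - move=> t x [Ht Hx]. have H2 := square_pos x Hx. rewrite solution_side_eq //.
    + congr solution. field. lra.
    + apply: Rmult_le_pos => //. exact: inv_nonneg.
Qed.

Lemma solution_smooth_Qh : smooth_Qh solution.
Proof.
  split; [|split].
  - apply: smooth2_on_of_Ck; [exact: perfect2_quarter_punctured|exact: Ck_solution].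
  - exists solution_blowup. split; last by move=> tau s Ht _; exact: solution_blowup_eq.
    apply: smooth2_on_of_Ck; [exact: perfect2_quarter|exact: Ck_solution_blowup].
  - exists solution_side. split; last by move=> T y; exact: solution_side_eq.
    apply: smooth2_on_of_Ck; [exact: perfect2_quarter|exact: Ck_solution_side].
Qed.

Lemma solution_initial x : solution 0 x = F 0 x.
Proof. rewrite /solution line_solution_initial // corner_solution_initial dirichlet_initial //. ring. Qed.

Lemma solution_boundary t : 0 < t ->
  solution t 0 = line_solution F 0 t 0 + / 2 * line_solution D 0 t 0 + H 0 t.
Proof. move=> Ht. by rewrite /solution corner_solution_boundary // dirichlet_boundary. Qed.

Lemma solution_growth : moderate_growth solution.
Proof.
  have [M1 H1] := line_solution_bounded F HF 0. have [M2 H2] := corner_solution_bounded D HD.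
  have [M3 H3] := dirichlet_bounded H HH 0.
  move=> T HT. exists (M1 + M2 + M3), 0 => t x Ht Hx. rewrite Rmult_0_l exp_0 Rmult_1_r.
  apply: (Rle_trans _ _ _ (Rabs_triang _ _)). apply: Rplus_le_compat; last exact: H3.
  apply: (Rle_trans _ _ _ (Rabs_triang _ _)). apply: Rplus_le_compat; [exact: H1|apply: H2; lra].
Qed.

End Solution.

(** * Matching conditions *)

(** A relation between [f] and its [k]-th right derivative at [0], so that sums of explicit families
    need no identification of iterated derivatives. *)
Fixpoint derivative_at_zero (k : nat) (f : R -> R) (l : R) : Prop :=
  match k with
  | O => f 0 = l
  | S m => exists f', (forall t, 0 <= t -> is_derive_on half_line f t (f' t)) /\ derivative_at_zero m f' l
  end.

Lemma derivative_at_zero_unique k f g l m : (forall t, 0 <= t -> f t = g t) ->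
  derivative_at_zero k f l -> derivative_at_zero k g m -> l = m.
Proof.
  elim: k f g => [|k IH] f g E /=; first by move=> <- <-; apply: E; exact: Rle_refl.
  move=> [f' [Hf Kf]] [g' [Hg Kg]]. apply: (IH f' g') => // t Ht.
  apply: (is_derive_on_unique half_line f t) => //; [exact: non_isolated_half_line|exact: Hf|].
  apply: (is_derive_on_ext _ g) => //. exact: Hg.
Qed.

Lemma derivative_at_zero_ext k f g l : (forall t, 0 <= t -> f t = g t) ->
  derivative_at_zero k f l -> derivative_at_zero k g l.
Proof.
  case: k => [|k] E /=; first by rewrite E //; exact: Rle_refl.
  move=> [f' [Hf Kf]]. exists f'. split=> // t Ht. apply: (is_derive_on_ext _ f) => //; last exact: Hf.
  move=> y Hy. by rewrite E.
Qed.

Lemma derivative_at_zero_plus k f g l m : derivative_at_zero k f l -> derivative_at_zero k g m ->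
  derivative_at_zero k (fun t => f t + g t) (l + m).
Proof.
  elim: k f g => [|k IH] f g /=; first by move=> -> ->.
  move=> [f' [Hf Kf]] [g' [Hg Kg]]. exists (fun t => f' t + g' t). split; last exact: IH.
  move=> t Ht. apply: is_derive_on_plus => //; [exact: Hf|exact: Hg].
Qed.

Lemma derivative_at_zero_scal k c f l : derivative_at_zero k f l -> derivative_at_zero k (fun t => c * f t) (c * l).
Proof.
  elim: k f => [|k IH] f /=; first by move=> ->.
  move=> [f' [Hf Kf]]. exists (fun t => c * f' t). split; last exact: IH.
  move=> t Ht. have -> : c * f' t = 0 * f t + c * f' t by ring.
  apply: (is_derive_on_mult _ (fun _ => c) f) => //; last exact: Hf.
  apply: is_derive_on_of_is_derive => //. exact: is_derive_const.
Qed.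

Lemma derivative_at_zero_jet (G : nat -> R -> R) k j :
  (forall i t, 0 <= t -> is_derive_on half_line (G i) t (G (S i) t)) -> derivative_at_zero k (G j) (G (k + j)%nat 0).
Proof.
  move=> HG. elim: k j => [|k IH] j //=. exists (G (S j)). split; first exact: HG.
  have -> : S (k + j) = (k + S j)%nat by lia. exact: IH.
Qed.

Lemma derivative_at_zero_outer_layer D (HD : bounded_jet D) k j a b m c y :
  derivative_at_zero k (fun t => outer_layer D j a b m (c * t) y) 0.
Proof.
  elim: k b m => [|k IH] b m /=; first by rewrite Rmult_0_r outer_layer_initial.
  exists (fun t => c * (- (INR m + / 2) * outer_layer D j a (b + 2) (S m) (c * t) y + / 4 * outer_layer D j a (b + 2) (S (S m)) (c * t) y)).
  split.
  - move=> t Ht. apply: is_derive_on_of_is_derive => //.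
    apply: (is_derive_comp (fun T => outer_layer D j a b m T y) (fun t => c * t)); first exact: is_derive_outer_layer_T.
    auto_derive => //. ring.
  - have -> : 0 = c * (- (INR m + / 2) * 0 + / 4 * 0) by ring.
    apply: derivative_at_zero_scal. apply: derivative_at_zero_plus; apply: derivative_at_zero_scal; exact: IH.
Qed.

Section Matching.

Variables F D H : nat -> R -> R.
Hypothesis HF : bounded_jet F.
Hypothesis HD : bounded_jet D.
Hypothesis HH : bounded_jet H.
Hypothesis H_past : forall k t, t <= 0 -> H k t = 0.

(** For fixed [x > 0] the corner layer and the boundary potential vanish to infinite order at
    [t = 0]; the evolution on the line contributes [F (2 * k) x]. *)
Lemma solution_time_derivative k x : 0 < x ->
  derivative_at_zero k (fun t => solution F D H t x) (F (k + k)%nat x).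
Proof.
  move=> Hx. have H2 := square_pos x Hx.
  apply: (derivative_at_zero_ext k (fun t => line_solution F 0 t x +
    / (2 * integral gauss * sqrt 2) * outer_layer D 0 0 1 0 (/ x ^ 2 * t) x + dirichlet H 0 t x)).
  { move=> t Ht. rewrite /solution. congr (_ + _ + _).
    rewrite -corner_solution_side //.
    - congr corner_solution. field. lra.
    - apply: Rmult_le_pos => //. exact: inv_nonneg. }
  have -> : F (k + k)%nat x = F (k + k)%nat x + / (2 * integral gauss * sqrt 2) * 0 + 0 by ring.
  apply: derivative_at_zero_plus; [apply: derivative_at_zero_plus|].
  - have := derivative_at_zero_jet (fun i t => line_solution F (i + i) t x) k 0.
    rewrite /= Nat.add_0_r line_solution_initial //. apply.
    move=> i t Ht. rewrite Nat.add_succ_r. exact: is_derive_on_line_solution_t.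
  - apply: derivative_at_zero_scal. exact: derivative_at_zero_outer_layer.
  - have := derivative_at_zero_jet (fun i t => dirichlet H i t x) k 0.
    rewrite dirichlet_initial //. apply. move=> i t Ht. apply: is_derive_on_of_is_derive => //. exact: is_derive_dirichlet_t.
Qed.

End Matching.

Lemma half_line_limit_unique (f g : R -> R) :
  filterlim f (within half_line (locally 0)) (locally (f 0)) ->
  filterlim g (within half_line (locally 0)) (locally (g 0)) ->
  (forall x, 0 < x -> f x = g x) -> f 0 = g 0.
Proof.
  move=> Cf Cg E. apply: NNPP => n.
  have Hp : 0 < Rabs (f 0 - g 0) by apply: Rabs_pos_lt; lra.
  have [d1 H1] := filterlim_R_eps _ _ _ Cf (Rabs (f 0 - g 0) / 2) ltac:(lra).
  have [d2 H2] := filterlim_R_eps _ _ _ Cg (Rabs (f 0 - g 0) / 2) ltac:(lra).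
  have Hm := Rmin_pos _ _ (cond_pos d1) (cond_pos d2).
  have R1 := Rmin_l d1 d2. have R2 := Rmin_r d1 d2.
  set x := Rmin d1 d2 / 2. have Hx : 0 < x /\ x < d1 /\ x < d2 by rewrite /x; lra.
  have B : forall d, x < d -> Rabs (x - 0) < d by move=> d Hd; rewrite Rminus_0_r Rabs_pos_eq; lra.
  have Hh : half_line x by rewrite /half_line; lra.
  have K1 := H1 x (B d1 ltac:(lra)) Hh. have K2 := H2 x (B d2 ltac:(lra)) Hh.
  rewrite E in K1; last lra.
  have : Rabs (f 0 - g 0) <= Rabs (g x - f 0) + Rabs (g x - g 0); last lra.
  have -> : f 0 - g 0 = - (g x - f 0) + (g x - g 0) by ring.
  apply: (Rle_trans _ _ _ (Rabs_triang _ _)). rewrite Rabs_Ropp. lra.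
Qed.

Section TimeDerivatives.

Variable v : R -> R -> R.
Hypothesis smooth_v : smooth2_on quarter v.

Definition time_derivative (k : nat) : R -> R -> R := Nat.iter k (partial1_on quarter) v.

Lemma time_derivative_smooth k : smooth2_on quarter (time_derivative k).
Proof.
  elim: k => [|k IH] //= n. by have [_ [_ [H _]]] := IH (S n).
Qed.

Lemma time_derivative_is_derive k t x : 0 <= t -> 0 <= x ->
  is_derive_on half_line (fun t => time_derivative k t x) t (time_derivative (S k) t x).
Proof.
  move=> Ht Hx. have [_ [H _]] := time_derivative_smooth k 1%nat.
  have Q : quarter t x by split.
  have [E _] := H t x Q. have [A _] := perfect2_quarter t x Q.
  apply: (is_derive_on_local _ (fun t => quarter t x)); [exact: Ht|exact: Q| |exact: (Derive_on_correct (fun t => quarter t x) (fun t => time_derivative k t x) t Q A E)].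
  apply: locally_true => y Hy. by split.
Qed.

Lemma time_derivative_continuous_x k :
  filterlim (fun x => time_derivative k 0 x) (within half_line (locally 0)) (locally (time_derivative k 0 0)).
Proof.
  have [C _] := time_derivative_smooth k 0%nat. move=> P HP.
  have [d Hd] := C (0, 0) (conj (Rle_refl 0) (Rle_refl 0)) P HP.
  exists d => x Hx Hx0. apply: (Hd (0, x)); last by split; [exact: Rle_refl|].
  split=> //=. exact: ball_center.
Qed.

Lemma time_derivative_continuous_t k :
  filterlim (fun t => time_derivative k t 0) (within half_line (locally 0)) (locally (time_derivative k 0 0)).
Proof.
  apply: (is_derive_on_continuous half_line (fun t => time_derivative k t 0)); first by apply: Rle_refl.
  apply: time_derivative_is_derive; exact: Rle_refl.
Qed.

End TimeDerivatives.

(** * The theorem *)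

Section Main.

Variables phi psi : R -> R.
Hypothesis smooth_phi : smooth_on half_line phi.
Hypothesis smooth_psi : smooth_on half_line psi.
Hypothesis supp_phi : forall x, support phi x -> 0 <= x < 1.
Hypothesis supp_psi : forall t, support psi t -> 0 <= t < 1.

Lemma even_part_jet (B : nat -> R -> R) : bounded_jet B ->
  bounded_jet (fun k x => / 2 * (B k x + (-1) ^ k * B k (- x))).
Proof.
  move=> [H1 H2]. split.
  - move=> k x. apply: is_derive_scal. apply: (is_derive_plus (V := R_NormedModule)); first exact: H1.
    have -> : (-1) ^ S k * B (S k) (- x) = (-1) ^ k * (-1 * B (S k) (- x)) by rewrite /=; ring.
    apply: is_derive_scal. apply: (is_derive_comp (B k) (fun x => - x)); first exact: H1. auto_derive => //.
  - move=> k. have [M HM] := H2 k. exists M => x.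
    have A : Rabs ((-1) ^ k * B k (- x)) <= M by rewrite Rabs_mult pow_1_abs Rmult_1_l; exact: HM.
    rewrite Rabs_mult Rabs_pos_eq; last lra.
    have := Rabs_triang (B k x) ((-1) ^ k * B k (- x)). have := HM x. lra.
Qed.

(** [D] is the even part of a Borel function: even coefficients match the derivatives of [psi] and
    [phi] at the corner, odd ones are killed, so that the boundary values of the corner layer are
    smooth in [t].  [H] is what remains of [psi], extended by [0]. *)
Lemma solution_exists : exists F D H : nat -> R -> R,
  bounded_jet F /\ bounded_jet D /\ bounded_jet H /\ (forall k t, t <= 0 -> H k t = 0) /\
  (forall k x, 0 <= x -> F k x = Derive_n_on half_line phi k x) /\
  moderate_solution phi psi (solution F D H).
Proof.
  have [F [HF EF]] := smooth_extension phi smooth_phi supp_phi.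
  have [B [HB EB]] := borel (fun n => 2 * (Derive_n_on half_line psi (Nat.div2 n) 0 - F n 0)).
  pose D k x := / 2 * (B k x + (-1) ^ k * B k (- x)).
  have HD : bounded_jet D by exact: even_part_jet.
  have D_even : forall x, D 0%nat (- x) = D 0%nat x by move=> x; rewrite /D Ropp_involutive /=; ring.
  have D_zero : forall k, D (k + k)%nat 0 = 2 * (Derive_n_on half_line psi k 0 - F (k + k)%nat 0).
  { move=> k. rewrite /D Ropp_0 EB. have -> : (k + k = 2 * k)%nat by lia.
    rewrite pow_1_even Nat.div2_double. field. }
  pose g k t := Derive_n_on half_line psi k t + -1 * line_solution F (k + k) t 0 + - / 2 * line_solution D (k + k) t 0.
  have g_zero : forall k, g k 0 = 0.
  { move=> k. rewrite /g !line_solution_initial // D_zero. field. }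
  have Dg : forall k t, 0 <= t -> is_derive_on half_line (g k) t (g (S k) t).
  { move=> k t Ht.
    have Sc : forall c (G : nat -> R -> R), bounded_jet G ->
      is_derive_on half_line (fun t => c * line_solution G (k + k) t 0) t (c * line_solution G (S k + S k) t 0).
    { move=> c G HG. have -> : c * line_solution G (S k + S k) t 0 =
        0 * line_solution G (k + k) t 0 + c * line_solution G (S k + S k) t 0 by ring.
      apply: (is_derive_on_mult _ (fun _ => c)) => //.
      - apply: is_derive_on_of_is_derive => //. exact: is_derive_const.
      - have -> : (S k + S k = S (S (k + k)))%nat by lia. exact: is_derive_on_line_solution_t. }
    apply: is_derive_on_plus => //; last exact: Sc. apply: is_derive_on_plus => //; last exact: Sc.
    exact: smooth_on_half_line_derive. }
  have Bg : forall k, exists M, forall t, 0 <= t -> Rabs (g k t) <= M.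
  { move=> k. have [M1 H1] := Derive_n_on_bounded psi k smooth_psi supp_psi.
    have [M2 H2] := line_solution_bounded F HF (k + k). have [M3 H3] := line_solution_bounded D HD (k + k).
    exists (M1 + M2 + M3) => t Ht.
    have A2 := H2 t 0. have A3 := H3 t 0. have A3' := Rabs_pos (line_solution D (k + k) t 0).
    apply: (Rle_trans _ _ _ (Rabs_triang _ _)). apply: Rplus_le_compat; last first.
    { rewrite Rabs_mult Rabs_Ropp Rabs_pos_eq; lra. }
    apply: (Rle_trans _ _ _ (Rabs_triang _ _)). apply: Rplus_le_compat; first exact: H1.
    rewrite Rabs_mult Rabs_left; lra. }
  pose H k t := if Rle_dec 0 t then g k t else 0.
  have HH : bounded_jet H.
  { apply: (bounded_jet_piecewise g (fun _ _ => 0)) => //.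
    split; first by move=> k x; exact: is_derive_const. move=> k. exists 0 => x. rewrite Rabs_R0. exact: Rle_refl. }
  have H_past : forall k t, t <= 0 -> H k t = 0.
  { move=> k t Ht. rewrite /H. case: (Rle_dec 0 t) => // Ht'. have -> : t = 0 by lra. exact: g_zero. }
  exists F, D, H. split=> //. split=> //. split=> //. split=> //. split=> //.
  split; first exact: solution_heat. split; last exact: solution_growth.
  split; first exact: (Ck_continuous _ _ _ (Ck_solution F D H HF HD HH H_past 0)).
  split.
  - move=> x Hx. rewrite solution_initial // EF //. lra.
  - move=> t Ht. rewrite solution_boundary // /H. case: (Rle_dec 0 t) => Ht'; last lra.
    rewrite /g /=. lra.
Qed.

End Main.

Theorem theorem4p1 (phi psi : R -> R)
    (smooth_phi : smooth_on half_line phi)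
    (smooth_psi : smooth_on half_line psi)
    (supp_phi : forall x : R, support phi x -> 0 <= x < 1)
    (supp_psi : forall t : R, support psi t -> 0 <= t < 1) :
  (exists u : R -> R -> R, moderate_solution phi psi u) /\
  (forall u : R -> R -> R, moderate_solution phi psi u ->
     (forall u' : R -> R -> R, moderate_solution phi psi u' ->
        eq2_on quarter_punctured u' u) /\
     smooth_Qh u /\
     (smooth_Q u ->
        forall k : nat,
          Derive_n_on half_line psi k 0 = Derive_n_on half_line phi (2 * k) 0)).
Proof.
  have [F [D [H [HF [HD [HH [H_past [EF HS]]]]]]]] := solution_exists phi psi smooth_phi smooth_psi supp_phi supp_psi.
  split; first by exists (solution F D H).
  move=> u Hu. have E := moderate_solution_unique _ _ _ _ HS Hu.
  split; first by move=> u' Hu'; exact: (moderate_solution_unique phi psi).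
  split.
  { apply: smooth_Qh_ext E _. exact: solution_smooth_Qh. }
  move=> [v [Sv Ev]] k.
  have H0 : half_line 0 by apply: Rle_refl.
  (* first the side [x = 0], where the boundary values determine all time derivatives *)
  have A : time_derivative v k 0 0 = Derive_n_on half_line psi k 0.
  { have Hb : forall t, 0 < t -> v t 0 = psi t.
    { move=> t Ht. rewrite Ev; last by apply: positive_time_punctured; split; [|exact: Rle_refl].
      by case: Hu => _ [[_ [_ B]] _]; apply: B. }
    have Hb0 : v 0 0 = psi 0.
    { apply: (half_line_limit_unique (fun t => v t 0) psi) => //; first exact: (time_derivative_continuous_t v Sv 0).
      exact: (is_derive_on_continuous _ _ _ _ H0 (smooth_on_half_line_derive psi 0 0 smooth_psi H0)). }
    have Tv := derivative_at_zero_jet (fun i t => time_derivative v i t 0) k 0.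
    have Tp := derivative_at_zero_jet (fun i t => Derive_n_on half_line psi i t) k 0.
    rewrite Nat.add_0_r in Tv Tp.
    apply: (derivative_at_zero_unique k (fun t => v t 0) psi).
    - move=> t [Ht|<-] //. exact: Hb.
    - apply: Tv => i t Ht. apply: time_derivative_is_derive => //.
    - apply: Tp => i t Ht. exact: smooth_on_half_line_derive. }
  (* then the side [t = 0], where they are given by the explicit solution *)
  have B : forall x, 0 < x -> time_derivative v k 0 x = Derive_n_on half_line phi (2 * k) x.
  { move=> x Hx. have -> : (2 * k = k + k)%nat by lia. rewrite -EF; last lra.
    have Tv := derivative_at_zero_jet (fun i t => time_derivative v i t x) k 0.
    rewrite Nat.add_0_r in Tv.
    apply: (derivative_at_zero_unique k (fun t => v t x) (fun t => solution F D H t x)).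
    - move=> t Ht. have Q : quarter_punctured t x by apply: positive_space_punctured. by rewrite Ev // E.
    - apply: Tv => i t Ht. apply: time_derivative_is_derive => //. lra.
    - exact: solution_time_derivative. }
  rewrite -A.
  apply: (half_line_limit_unique (fun x => time_derivative v k 0 x) (Derive_n_on half_line phi (2 * k))) => //.
  - exact: time_derivative_continuous_x.
  - exact: (is_derive_on_continuous _ _ _ _ H0 (smooth_on_half_line_derive phi (2 * k) 0 smooth_phi H0)).
Qed.
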